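(* There exists a residual set $\mathcal{T}\subset\mathcal{S}$ such that for every $\gamma\in\mathcal{T}$, every periodic orbit $\mathcal{O}$ of $T_\gamma$ of period at least $3$ and every $C^2$ neighborhood $U$ of $\gamma$ in $\mathcal{S}$, there exists an open ball $B\subset Sp(1)$ centered at $DT_\gamma(\mathcal{O})$ such that every element of $B$ equals $DT_{\tilde\gamma}(\mathcal{O})$ for some $\tilde\gamma\in U$ (for which $\mathcal{O}$ is also a periodic orbit of $T_{\tilde\gamma}$). Moreover, such a perturbation $\tilde\gamma$ of $\gamma$ can be supported in an arbitrarily small neighborhood of three successive bouncing points of $\mathcal{O}$ (i.e. $\tilde\gamma=\gamma$ outside such a neighborhood).
   Context: Tables. Let $\mathbb{S}=\mathbb{R}/2\pi\mathbb{Z}$. $\mathcal{S}$ denotes the set of strongly convex planar billiard tables with $C^\infty$ boundary; a table is identified with a $C^\infty$ regular injective parametrization $\gamma:\mathbb{S}\to\mathbb{R}^2$ of its boundary $\Gamma=\gamma(\mathbb{S})$, which is oriented counterclockwise and has everywhere strictly positive curvature. $\mathcal{S}$ carries the Whitney $C^\infty$ topology: $\gamma_m\to\gamma$ iff $\|\gamma_m-\gamma\|_{C^k}\to0$ for every $k\ge0$. With it $\mathcal{S}$ is a Baire space. A subset of $\mathcal{S}$ is residual if it contains a countable intersection of open dense subsets. A $C^2$ neighborhood is a neighborhood for the topology of the $C^2$ norm. Symplectic billiard. For $t\in\mathbb{S}$, $t^*\ne t$ is the unique parameter with $\det(\gamma'(t),\gamma'(t^* ))=0$. The phase space is $\hat{\mathcal{P}}_\gamma=\{(\gamma(t_1),\gamma(t_2)):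 t_1<t_2<t_1^*\}$ (cyclic counterclockwise order). The symplectic billiard map is $\hat T_\gamma(\gamma(t_1),\gamma(t_2))=(\gamma(t_2),\gamma(t_3))$, where $\gamma(t_3)$ is the unique point of $\Gamma$ with $(\gamma(t_2),\gamma(t_3))\in\hat{\mathcal{P}}_\gamma$ and $\det(\gamma'(t_2),\gamma(t_3)-\gamma(t_1))=0$. Coordinates. Fix an origin $O$ in the interior of the table (the same for $\gamma$ and its small perturbations), let $L(t_1,t_2)=\det(\gamma(t_1)-O,\gamma(t_2)-O)$ and let $L_1,L_2$ be its partial derivatives. Then $(t_1,s_1)$ with $s_1=-L_1(t_1,t_2)$ are coordinates on the phase space, which becomes $\mathcal{P}_\gamma=\{(t,s): -L_1(t,t^* )<s<-L_1(t,t)\}\subset\mathbb{S}\times\mathbb{R}$; in them the map is $T_\gamma:\mathcal{P}_\gamma\to\mathcal{P}_\gamma$, $(t_1,-L_1(t_1,t_2))\mapsto(t_2,L_2(t_1,t_2))$. It preserves $ds\wedge dt$. A periodic orbit of period $n$ is $\mathcal{O}=\{(t_1,s_1),\ldots,(t_n,s_n)\}\subset\mathcal{P}_\gamma$ with $T_\gamma(t_i,s_i)=(t_{i+1},s_{i+1})$, $(t_{n+1},s_{n+1})=(t_1,s_1)$, $n$ being the least period; its bouncing points are $\gamma(t_1),\ldots,\gamma(t_n)$. $DT_\gamma(\mathcal{O})$ denotes the derivative along the orbit, $DT_\gamma(\mathcal{O})=DT_\gamma(t_n,s_n)\cdots DT_\gamma(t_2,s_2)\,DT_\gamma(t_1,s_1)$,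 and $Sp(1)$ is the group of $2\times2$ real symplectic matrices (i.e. $SL(2,\mathbb{R})$). *)

(* Defs.v *)
From HB Require Import structures.
From mathcomp Require Import all_boot all_order all_algebra.
From mathcomp Require Import all_classical all_reals all_analysis.
From mathcomp Require Import ring.
Set Implicit Arguments.
Unset Strict Implicit.
Unset Printing Implicit Defensive.
Import Order.TTheory GRing.Theory Num.Theory.
Import numFieldNormedType.Exports.
Local Open Scope ring_scope.
Local Open Scope classical_set_scope.

(* The circle S = R/2piZ is handled through its universal cover: a function on
   S is a 2pi-periodic function on R, and points of S are reals up to
   [circ_eq]. *)
Definition circ_eq (R : realType) (t u : R) : Prop :=
  exists k : int, u = t + k%:~R * (2 * pi).

Definition det2 (R : realType) (u v : R * R) : R := u.1 * v.2 - u.2 * v.1.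

Definition smooth (R : realType) (g : R -> R * R) : Prop :=
  forall n t, derivable g^`(n) t 1.

Definition curvature (R : realType) (g : R -> R * R) (t : R) : R :=
  det2 (g^`() t) (g^`(2) t) /
  Num.sqrt ((g^`() t).1 ^+ 2 + (g^`() t).2 ^+ 2) ^+ 3.

(* The signed curvature of a simple closed curve is positive everywhere only
   if the curve is oriented counterclockwise, so [table_curvature] also fixes
   the orientation. *)
Record table (R : realType) := Table {
  table_fun :> R -> R * R ;
  table_periodic : forall t, table_fun (t + 2 * pi) = table_fun t ;
  table_smooth : smooth table_fun ;
  table_inj : forall t u, table_fun t = table_fun u -> circ_eq t u ;
  table_regular : forall t, table_fun^`() t != 0 ;
  table_curvature : forall t, 0 < curvature table_fun t }.

(* Meant for smooth 2pi-periodic functions, for which the suprema are finite.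
   The norm on [R * R] is the maximum norm. *)
Definition Ck_norm (R : realType) (k : nat) (f : R -> R * R) : R :=
  \big[Num.max/0]_(j < k.+1) sup (range (fun t => `|f^`(j) t|)).

Definition Ck_nbhs (R : realType) (k : nat) (g : table R) (U : set (table R)) :
    Prop :=
  exists2 e : R, 0 < e &
    forall h : table R, Ck_norm k (h \- g) < e -> U h.

Definition Cinf_open (R : realType) : set_system (table R) :=
  [set A | forall g, A g -> exists k, Ck_nbhs k g A].

Lemma Ck_norm_le (R : realType) (k l : nat) (f : R -> R * R) :
  (k <= l)%N -> Ck_norm k f <= Ck_norm l f.
Proof.
move=> kl; apply: bigmax_le => [|i _]; first exact: bigmax_ge_id.
have il : (i < l.+1)%N by apply: leq_trans (ltn_ord i) _.
exact: (le_bigmax _ (fun j : 'I_l.+1 => sup (range (fun t => `|f^`(j) t|)))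
          (Ordinal il)).
Qed.

Lemma Cinf_openT (R : realType) : Cinf_open [set: table R].
Proof. by move=> g _; exists 0%N; exists 1. Qed.

Lemma Cinf_openI (R : realType) : setI_closed (@Cinf_open R).
Proof.
move=> A B oA oB g [Ag Bg].
have [k [e e0 kA]] := oA _ Ag; have [l [d d0 lB]] := oB _ Bg.
exists (maxn k l); exists (Num.min e d); first by rewrite lt_min e0 d0.
move=> h; rewrite lt_min => /andP[he hd]; split.
- by apply/kA/(le_lt_trans _ he)/Ck_norm_le/leq_maxl.
- by apply/lB/(le_lt_trans _ hd)/Ck_norm_le/leq_maxr.
Qed.

Lemma Cinf_open_bigU (R : realType) (I : Type) (f : I -> set (table R)) :
  (forall i, Cinf_open (f i)) -> Cinf_open (\bigcup_i f i).
Proof.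
move=> fo g [i _ fig]; have [k [e e0 kf]] := fo _ _ fig.
by exists k; exists e => // h /kf ?; exists i.
Qed.

HB.instance Definition _ (R : realType) := gen_eqMixin (table R).
HB.instance Definition _ (R : realType) := gen_choiceMixin (table R).
HB.instance Definition _ (R : realType) :=
  @isOpenTopological.Build (table R) (@Cinf_open R) (@Cinf_openT R)
    (@Cinf_openI R) (@Cinf_open_bigU R).

Definition residual (T : topologicalType) (A : set T) : Prop :=
  exists2 U : nat -> set T,
    (forall n, open (U n) /\ dense (U n)) & \bigcap_n U n `<=` A.

(* The open region enclosed by the closed curve g. *)
Definition table_interior (R : realType) (g : table R) : set (R * R) :=
  [set p | ~ range g p /\ bounded_set (connected_component (~` range g) p)].

(* The lift of t^* to ]t, t + 2pi[. *)
Definition star (R : realType) (g : table R) (t : R) : R :=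
  xget t [set u | t < u < t + 2 * pi /\ det2 (g^`() t) (g^`() u) = 0].

Definition genL (R : realType) (g : table R) (O : R * R) (t1 t2 : R) : R :=
  det2 (g t1 - O) (g t2 - O).

Definition genL1 (R : realType) (g : table R) (O : R * R) (t1 t2 : R) : R :=
  derive1 (fun t => genL g O t t2) t1.

Definition genL2 (R : realType) (g : table R) (O : R * R) (t1 t2 : R) : R :=
  derive1 (genL g O t1) t2.

Lemma table_derivable (R : realType) (g : table R) (t : R) :
  (fun h => h^-1 *: (g (h + t) - g t)) @ (0 : R)^' --> g^`() t.
Proof.
have := @table_smooth R g 0%N t; rewrite /derivable /=.
rewrite /derive1.
suff -> : (fun h : R => h^-1 *: (g (h *: (1 : R) + t) - g t)) =
          (fun h => h^-1 *: (g (h + t) - g t)) by [].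
by apply/funext => h; rewrite /GRing.scale /= mulr1.
Qed.

Lemma det2_cvgl (R : realType) (F : set_system R) {FF : Filter F}
    (q : R -> R * R) (l v : R * R) :
  q @ F --> l -> (fun h => det2 (q h) v) @ F --> det2 l v.
Proof.
move=> ql.
have q1 : (fun h => (q h).1) @ F --> l.1.
  by apply: (@cvg_comp _ _ _ q fst F (nbhs l)) => //; exact: cvg_fst.
have q2 : (fun h => (q h).2) @ F --> l.2.
  by apply: (@cvg_comp _ _ _ q snd F (nbhs l)) => //; exact: cvg_snd.
by apply: cvgB; apply: cvgM => //; exact: cvg_cst.
Qed.

Lemma det2C (R : realType) (u v : R * R) : det2 u v = - det2 v u.
Proof. by rewrite /det2; ring. Qed.

Lemma genL1E (R : realType) (g : table R) (O : R * R) (t1 t2 : R) :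
  genL1 g O t1 t2 = det2 (g^`() t1) (g t2 - O).
Proof.
rewrite /genL1 [LHS]/derive1.
have -> : (fun h : R => h^-1 *: (genL g O (h + t1) t2 - genL g O t1 t2)) =
    (fun h => det2 (h^-1 *: (g (h + t1) - g t1)) (g t2 - O)).
  apply/funext => h; rewrite /genL /det2; case: (g (h + t1)) => a b.
  case: (g t1) => c d; case: (g t2) => e f; case: O => u v.
  by rewrite /= /GRing.scale /=; ring.
apply: cvg_lim => //.
by apply: det2_cvgl; exact: table_derivable.
Qed.

Lemma genL2E (R : realType) (g : table R) (O : R * R) (t1 t2 : R) :
  genL2 g O t1 t2 = det2 (g t1 - O) (g^`() t2).
Proof.
rewrite /genL2 [LHS]/derive1 det2C.
have -> : (fun h : R => h^-1 *: (genL g O t1 (h + t2) - genL g O t1 t2)) =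
    (fun h => - det2 (h^-1 *: (g (h + t2) - g t2)) (g t1 - O)).
  apply/funext => h; rewrite /genL /det2; case: (g (h + t2)) => a b.
  case: (g t1) => c d; case: (g t2) => e f; case: O => u v.
  by rewrite /= /GRing.scale /=; ring.
apply: cvg_lim => //.
by apply: cvgN; apply: det2_cvgl; exact: table_derivable.
Qed.

(* The reflection law at t2 reads: L_2(t1, t2) is the coordinate s of
   the pair (t2, t3). *)
Lemma symplectic_law (R : realType) (g : table R) (O : R * R) (t1 t2 t3 : R) :
  det2 (g^`() t2) (g t3 - g t1) = 0 <-> genL2 g O t1 t2 = - genL1 g O t2 t3.
Proof.
rewrite genL1E genL2E.
have -> : det2 (g^`() t2) (g t3 - g t1) =
    det2 (g t1 - O) (g^`() t2) + det2 (g^`() t2) (g t3 - O).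
  rewrite /det2; case: (g t1) (g t3) O => [a b] [c d] [u v] /=; ring.
by split=> [/eqP|->]; rewrite ?addNr // addr_eq0 => /eqP.
Qed.

(* Lift to R * R of the phase space in the coordinates (t, s). *)
Definition phase_space (R : realType) (g : table R) (O : R * R) :
    set (R * R) :=
  [set p | - genL1 g O p.1 (star g p.1) < p.2 < - genL1 g O p.1 p.1].

(* The t2 in ]t1, t1^*[ with s1 = - L_1(t1, t2). *)
Definition next_param (R : realType) (g : table R) (O : R * R) (p : R * R) : R :=
  xget p.1 [set t2 | p.1 < t2 < star g p.1 /\ p.2 = - genL1 g O p.1 t2].

(* Lift to the universal cover of the symplectic billiard map in the
   coordinates (t, s); only its values on [phase_space] are meaningful.
   See [symplectic_law] for the reflection law. *)
Definition billiard (R : realType) (g : table R) (O : R * R) (p : R * R) :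
    R * R :=
  let t2 := next_param g O p in (t2, genL2 g O p.1 t2).

(* Two lifts of the same point of S x R. *)
Definition phase_eq (R : realType) (p q : R * R) : Prop :=
  circ_eq p.1 q.1 /\ p.2 = q.2.

(* A periodic orbit is given by its points [o 0], ..., [o n.-1], listed
   cyclically, each of them lifted arbitrarily to R * R. *)
Definition periodic_orbit (R : realType) (g : table R) (O : R * R) (n : nat)
    (o : nat -> R * R) : Prop :=
  [/\ (0 < n)%N,
      forall i, phase_space g O (o i),
      forall i, phase_eq (billiard g O (o i)) (o i.+1),
      phase_eq (o n) (o 0%N) &
      forall m, (0 < m < n)%N -> ~ phase_eq (o m) (o 0%N)].

(* Matrix acting on column vectors (dt, ds): the columns are the images of
   the two basis vectors. *)
Definition Dbilliard (R : realType) (g : table R) (O : R * R) (p : R * R) :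
    'M[R]_2 :=
  let D : R * R -> R * R := 'd (billiard g O) p in
  let c (j : 'I_2) : R * R := D (if j == ord0 then (1, 0) else (0, 1)) in
  \matrix_(i, j) (if i == ord0 then (c j).1 else (c j).2).

(* Dbilliard (o n.-1) * ... * Dbilliard (o 1) * Dbilliard (o 0) *)
Definition Dorbit (R : realType) (g : table R) (O : R * R) (n : nat)
    (o : nat -> R * R) : 'M[R]_2 :=
  \prod_(i <- rev (iota 0 n)) Dbilliard g O (o i).

Definition symplectic_form (R : realType) : 'M[R]_2 :=
  \matrix_(i, j) (if i == j then 0 else if (i < j)%N then 1 else -1).

Definition Sp1 (R : realType) : set 'M[R]_2 :=
  [set A | A^T *m symplectic_form R *m A = symplectic_form R].

(* Main.v *)
Require Import Defs.
From HB Require Import structures.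
From mathcomp Require Import all_boot all_order all_algebra.
From mathcomp Require Import all_classical all_reals all_analysis.
From mathcomp Require Import zify ring lra.
Set Implicit Arguments.
Unset Strict Implicit.
Unset Printing Implicit Defensive.
Import Order.TTheory GRing.Theory Num.Theory.
Import numFieldNormedType.Exports.
Local Open Scope ring_scope.
Local Open Scope classical_set_scope.

(** The derivative of the billiard map along one step of an orbit is a product
[shear b *m turn l *m shear a]: the turn depends only on the 1-jets of the
boundary at the two bouncing points, while a and b are linear in the second
derivatives there ([Dbilliard_link]).  Along an orbit the two shears that meet
at a bouncing point merge, so the derivative along the orbit alternates turns
and shears.  A perturbation of the boundary that keeps its 1-jets at the
bouncing points keeps the orbit ([orbit_transfer]) and all the turns, and moves
the shears freely: strong convexity makes each merged shear parameter nonzero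
([orbit_bend]), so rescaling the second derivative at one bouncing point gives
it any nearby value.  The bumps used for this have a C^2 size that does not depend on
how small their support is ([curvature_bump]); this is why the size of the ball
in Sp(1) can be chosen before the neighbourhood V.

If the period is at least 4 and the bouncing points are pairwise distinct, the
rest of the orbit contributes constant factors on both sides of a product of
three shears separated by two turns, and these three parameters are local
coordinates on SL(2) ([solve_three]).  If the period is 3, the shear at one of
the three points is split between the two ends of the product; two parameters
are again read off the matrix, and the third one solves a quadratic equation
([solve_closed]), which is nondegenerate for a suitable direction of the second
derivative ([triangle_direction]).  Bouncing points of orbits of period 3 are
always distinct.

When a bouncing point is visited twice, its curvature enters several factors,
and the argument breaks down.  Such orbits are excluded by genericity.  An
orbit with a repeated bouncing point yields, for some q, q distinct parameters
that satisfy q reflection equations plus one more, independent, equation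
([generic_simple]).  There are countably many combinatorial types of such
systems.  For each of them, the tables without solutions among parameters at
mutual distance bounded below form an open set, by compactness.  This set is
dense: near a given configuration the boundary is moved in q + 1 directions
whose effect on the q + 1 equations is triangular, so that the moves that leave
a solution depend in a Lipschitz way on the q parameters of the solution; a
grid count then finds a move that leaves none ([lipschitz_pigeonhole],
[local_removal]).

All this needs the elementary geometry of a table, which is obtained from the
fact that its tangent turns exactly once ([table_angle]): a simple closed curve
with positive curvature that turned more than once would cross itself
([no_spiral]). *)

(** * Real functions of class C^infinity *)

(** The recursion on n passes to the derivative, so that closure of the class
    under an operation follows by induction from its differentiation rule. *)
Fixpoint Cn (R : realType) (n : nat) (f : R -> R) : Prop :=
  if n is m.+1 then (forall t, derivable f t 1) /\ Cn m f^`() else True.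

Definition Cinf (R : realType) (f : R -> R) : Prop := forall n, Cn n f.

Lemma derive1_eq (R : realType) (V : normedModType R) (f df : R -> V) :
  (forall t, is_derive t (1 : R) f (df t)) -> f^`() = df.
Proof. by move=> fdf; apply/funext => t; rewrite derive1E derive_val. Qed.

Lemma CnS (R : realType) n (f df : R -> R) :
  (forall t : R, is_derive t 1 f (df t)) -> Cn n df -> Cn n.+1 f.
Proof.
by move=> fdf cdf; split=> [t|]; [case: (fdf t)|rewrite (derive1_eq fdf)].
Qed.

Lemma CnW (R : realType) n (f : R -> R) : Cn n.+1 f -> Cn n f.
Proof. by elim: n f => [|n IH] f // [df cf]; split=> //; exact: IH. Qed.

Lemma Cn_is_derive (R : realType) n (f : R -> R) (t : R) :
  Cn n.+1 f -> is_derive t 1 f (f^`() t).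
Proof. by move=> [df _]; rewrite derive1E; apply: derivableP. Qed.

Lemma Cinf_derive1 (R : realType) (f : R -> R) : Cinf f -> Cinf f^`().
Proof. by move=> cf n; have [] := cf n.+1. Qed.

Lemma Cinf_is_derive (R : realType) (f : R -> R) (t : R) :
  Cinf f -> is_derive t 1 f (f^`() t).
Proof. by move=> /(_ 1%N); apply: Cn_is_derive. Qed.

Lemma Cinf_derive1n (R : realType) (f : R -> R) n : Cinf f -> Cinf f^`(n).
Proof. by move=> cf; elim: n => // n IH; exact: Cinf_derive1. Qed.

Lemma Cinf_continuous (R : realType) (f : R -> R) : Cinf f -> continuous f.
Proof.
move=> cf t; apply/differentiable_continuous/derivable1_diffP.
by case: (Cinf_is_derive t cf).
Qed.

(** Derivatives are computed by combining the rules below; the value they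
    produce is then compared with the expected one by a ring identity. *)
Lemma dv_eq (R : realType) (f : R -> R) (t d d' : R) :
  is_derive t (1 : R) f d -> d = d' -> is_derive t (1 : R) f d'.
Proof. by move=> h <-. Qed.

Lemma dv_cst (R : realType) (t c : R) : is_derive t (1 : R) (fun=> c) 0.
Proof. exact: is_derive_cst. Qed.

Lemma dv_id (R : realType) (t : R) : is_derive t (1 : R) (fun t => t) 1.
Proof. exact: is_derive_id. Qed.

Lemma dv_D (R : realType) (f g : R -> R) (t df dg : R) :
  is_derive t (1 : R) f df -> is_derive t (1 : R) g dg ->
  is_derive t (1 : R) (fun t => f t + g t) (df + dg).
Proof. by move=> hf hg; exact: is_deriveD. Qed.

Lemma dv_N (R : realType) (f : R -> R) (t df : R) :
  is_derive t (1 : R) f df -> is_derive t (1 : R) (fun t => - f t) (- df).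
Proof. by move=> hf; exact: is_deriveN. Qed.

Lemma dv_M (R : realType) (f g : R -> R) (t df dg : R) :
  is_derive t (1 : R) f df -> is_derive t (1 : R) g dg ->
  is_derive t (1 : R) (fun t => f t * g t) (df * g t + f t * dg).
Proof.
move=> hf hg; apply: (dv_eq (is_deriveM hf hg)).
by rewrite /GRing.scale /= addrC [g t * _]mulrC.
Qed.

Lemma dv_X (R : realType) (f : R -> R) n (t df : R) :
  is_derive t (1 : R) f df ->
  is_derive t (1 : R) (fun t => f t ^+ n) (n%:R * f t ^+ n.-1 * df).
Proof.
move=> hf; have := is_deriveX n hf; rewrite /GRing.scale /= -mulr_natl.
by congr (is_derive _ _ _ _); apply/funext => x; rewrite fctE.
Qed.

Lemma dv_V (R : realType) (f : R -> R) (t df : R) :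
  is_derive t (1 : R) f df -> f t != 0 ->
  is_derive t (1 : R) (fun t => (f t)^-1) (- (f t)^-1 ^+ 2 * df).
Proof.
by move=> hf f0; apply: (dv_eq (is_deriveV f0 hf)); rewrite exprVn.
Qed.

Lemma dv_comp (R : realType) (f g : R -> R) (t df dg : R) :
  is_derive (g t) (1 : R) f df -> is_derive t (1 : R) g dg ->
  is_derive t (1 : R) (fun t => f (g t)) (df * dg).
Proof.
move=> hf hg; have := @is_derive1_comp R f g t df dg hf hg.
by rewrite mulrC.
Qed.

Lemma dv_cos (R : realType) (f : R -> R) (t df : R) :
  is_derive t (1 : R) f df ->
  is_derive t (1 : R) (fun t => cos (f t)) (- sin (f t) * df).
Proof. by move=> hf; apply: (dv_comp (is_derive_cos _) hf). Qed.

Lemma dv_sin (R : realType) (f : R -> R) (t df : R) :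
  is_derive t (1 : R) f df ->
  is_derive t (1 : R) (fun t => sin (f t)) (cos (f t) * df).
Proof. by move=> hf; apply: (dv_comp (is_derive_sin _) hf). Qed.

Lemma Cn_cst (R : realType) n (c : R) : Cn n (fun=> c).
Proof.
elim: n c => // n IH c; apply: (CnS (df := fun=> 0)) => // t.
Qed.

Lemma CnD (R : realType) n (f g : R -> R) :
  Cn n f -> Cn n g -> Cn n (fun t => f t + g t).
Proof.
elim: n f g => // n IH f g cf cg.
apply: (CnS (df := fun t => derive1 f t + derive1 g t)); last first.
  by apply: IH; [case: cf|case: cg].
by move=> t; apply: is_deriveD; apply: Cn_is_derive; [exact: cf|exact: cg].
Qed.

Lemma CnM (R : realType) n (f g : R -> R) :
  Cn n f -> Cn n g -> Cn n (fun t => f t * g t).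
Proof.
elim: n f g => // n IH f g cf cg.
apply: (CnS (df := fun t => f t * derive1 g t + g t * derive1 f t)); last first.
  by apply: CnD; apply: IH; [exact: CnW|case: cg|exact: CnW|case: cf].
by move=> t; apply: is_deriveM; apply: Cn_is_derive; [exact: cf|exact: cg].
Qed.

Lemma CnN (R : realType) n (f : R -> R) : Cn n f -> Cn n (fun t => - f t).
Proof.
move=> cf; have := CnM (Cn_cst n (-1)) cf.
by congr Cn; apply/funext => t; rewrite mulN1r.
Qed.

Lemma Cn_comp (R : realType) n (f g : R -> R) :
  Cn n f -> Cn n g -> Cn n (fun t => f (g t)).
Proof.
elim: n f g => // n IH f g cf cg.
apply: (@CnS R n (fun t => f (g t)) (fun t => derive1 f (g t) * derive1 g t)); last first.
  by apply: CnM; [apply: IH; [case: cf|exact: CnW]|case: cg].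
by move=> t; apply: dv_comp; apply: Cn_is_derive; [exact: cf|exact: cg].
Qed.

Lemma CnV (R : realType) n (f : R -> R) :
  (forall t, f t != 0) -> Cn n f -> Cn n (fun t => (f t)^-1).
Proof.
move=> f0; elim: n => // n IH cf.
have cV := IH (CnW cf).
apply: (@CnS R n (fun t => (f t)^-1) (fun t => - ((f t)^-1 * (f t)^-1) * derive1 f t)); last first.
  by apply: CnM; [apply: CnN; exact: CnM|case: cf].
move=> t; have ft := Cn_is_derive t cf.
by apply: (dv_eq (dv_V ft (f0 t))); rewrite expr2.
Qed.

Lemma Cinf_cos (R : realType) : Cinf (@cos R).
Proof.
move=> n; suff : Cn n (@cos R) /\ Cn n (@sin R) by case.
elim: n => // n [ch sh]; split.
  by apply: (CnS (df := fun t => - sin t)); exact: CnN.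
by apply: (CnS (df := cos)).
Qed.

Lemma Cinf_sin (R : realType) : Cinf (@sin R).
Proof.
move=> [|n] //; apply: (CnS (df := cos)) => //; exact: Cinf_cos.
Qed.

(** The factor x^-k closes the family under differentiation, so that the
    smoothness of all its members is proved by one induction. *)
Definition flat (R : realType) (k : nat) (x : R) : R :=
  if 0 < x then x^-1 ^+ k * expR (- x^-1) else 0.

Lemma flat_ge0 (R : realType) k (x : R) : 0 <= flat k x.
Proof.
rewrite /flat; case: ifPn => // x0.
by rewrite mulr_ge0 ?exprn_ge0 ?invr_ge0 ?expR_ge0 // ltW.
Qed.

Lemma flat_gt0 (R : realType) k (x : R) : 0 < x -> 0 < flat k x.
Proof.
by move=> x0; rewrite /flat x0 mulr_gt0 ?expR_gt0 ?exprn_gt0 ?invr_gt0.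
Qed.

Lemma exprn_expRN_le (R : realType) (k : nat) (y : R) : 0 <= y ->
  y ^+ k * expR (- y) <= k%:R ^+ k.
Proof.
move=> y0; case: k => [|k].
  by rewrite !expr0 mul1r -expR0 ler_expR oppr_le0.
rewrite expRN ler_pdivrMr ?expR_gt0//.
have -> : expR y = expR (y / k.+1%:R) ^+ k.+1.
  by rewrite -expRM_natl -mulr_natl mulrCA divff ?mulr1// pnatr_eq0.
rewrite -exprMn lerXn2r ?nnegrE ?mulr_ge0 ?expR_ge0//.
rewrite mulrC -ler_pdivrMr ?ltr0n//.
by apply: le_trans (expR_ge1Dx _); rewrite lerDr.
Qed.

(** Near 0 the exponential beats every power; the square is what the
    derivative at 0 needs. *)
Lemma flat_le (R : realType) k (x : R) :
  flat k x <= (k + 2)%:R ^+ (k + 2) * x ^+ 2.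
Proof.
rewrite /flat; case: ifPn => [x0|_]; last by rewrite mulr_ge0 ?sqr_ge0 ?exprn_ge0.
have := @exprn_expRN_le R (k + 2) x^-1; rewrite invr_ge0 => /(_ (ltW x0)).
rewrite -ler_pdivrMr ?exprn_gt0// [X in X * _]exprD.
by rewrite mulrAC -exprVn.
Qed.

Lemma is_derive_flat (R : realType) k (x : R) :
  is_derive x 1 (flat k) (flat (k + 2) x - k%:R * flat (k + 1) x).
Proof.
have [x0|x0|->] := ltgtP x 0.
- rewrite /flat !(ltNge 0) (ltW x0) /= mulr0 subr0.
  apply: (near_eq_is_derive (f := fun=> 0)).
    by near=> y; rewrite ifF//; apply/negbTE; rewrite -leNgt ltW//; near: y; exact: lt_nbhsl.
- apply: (near_eq_is_derive (f := fun x : R => x^-1 ^+ k * expR (- x^-1))).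
    by near=> y; rewrite /flat ifT//; near: y; exact: lt_nbhsr.
  have xn0 : x != 0 by rewrite gt_eqF.
  have dV : is_derive x 1 (fun y : R => y^-1) (- x^-1 ^+ 2).
    by apply: (dv_eq (dv_V (dv_id x) xn0)); rewrite mulr1.
  apply: (dv_eq (dv_M (dv_X k dV) (dv_comp (is_derive_expR _) (dv_N dV)))).
  rewrite /flat x0.
  case: k => [|k]; rewrite ?exprD /= ?expr0 ?expr1 ?expr2 ?[x^-1 ^+ k.+1]exprS; ring.
- rewrite /flat ltxx mulr0 subr0.
  have key : (fun h : R => h^-1 *: (flat k (h + 0) - flat k 0)) @ 0^' --> (0 : R).
    have : 0 <= (k + 2)%:R ^+ (k + 2) :> R by rewrite exprn_ge0.
    have := @flat_le R k; move: (_ ^+ _) => C Cle C0.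
    have C1 : 0 < C + 1 by rewrite ltr_wpDl.
    apply/cvgrPdist_le => e e0.
    have eC : 0 < (C + 1)^-1 * e by rewrite mulr_gt0 ?invr_gt0.
    near=> h.
    rewrite sub0r normrN addr0 [flat k 0]/flat ltxx subr0 /GRing.scale/=.
    have hn0 : h != 0 by near: h; exact: nbhs_dnbhs_neq.
    rewrite normrM normfV ler_pdivrMl ?normr_gt0// (ger0_norm (flat_ge0 _ _)).
    apply: le_trans (Cle _) _.
    rewrite -[h ^+ 2]ger0_norm ?sqr_ge0// normrX expr2 mulrA mulrC ler_wpM2l//.
    apply: (@le_trans _ _ ((C + 1) * `|h|)).
      by rewrite ler_wpM2r// lerDl.
    rewrite -ler_pdivlMl//.
    by near: h; exact: dnbhs0_le.
  have dk : derivable (@flat R k) 0 1.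
    apply/cvg_ex; exists 0; rewrite /= .
    by move: key; apply: cvg_trans; apply: near_eq_cvg; near=> h; rewrite /= /GRing.scale/= mulr1.
  apply: DeriveDef => //; rewrite -derive1E; exact: cvg_lim.
Unshelve. all: by end_near. Qed.

Lemma Cinf_flat (R : realType) k : Cinf (@flat R k).
Proof.
move=> n; elim: n k => // n IH k; apply: (CnS (@is_derive_flat R k)).
by apply: CnD => //; apply: CnN; apply: CnM => //; exact: Cn_cst.
Qed.

(** A smooth plateau: the denominator vanishes nowhere because 2 - x and
    x - 1 are never both nonpositive. *)
Definition step (R : realType) (x : R) : R :=
  flat 0 (2 - x) * (flat 0 (2 - x) + flat 0 (x - 1))^-1.

Lemma step_den (R : realType) (x : R) : flat 0 (2 - x) + flat 0 (x - 1) != 0.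
Proof.
rewrite gt_eqF//; have [x1|x1] := ltP 1 x.
  by rewrite ltr_wpDl ?flat_ge0// flat_gt0// subr_gt0.
by rewrite ltr_pwDl ?flat_ge0// flat_gt0// subr_gt0 (le_lt_trans x1) ?ltr1n.
Qed.

Lemma Cinf_step (R : realType) : Cinf (@step R).
Proof.
have cid n : Cn n (@id R).
  by case: n => // n; apply: (CnS (df := fun=> 1)) (Cn_cst _ _).
have c2 : Cinf (fun x : R => flat 0 (2 - x)).
  move=> n; apply: Cn_comp; first exact: Cinf_flat.
  by apply: CnD; [exact: Cn_cst|exact: CnN].
have c1 : Cinf (fun x : R => flat 0 (x - 1)).
  move=> n; apply: Cn_comp; first exact: Cinf_flat.
  by apply: CnD; [|exact: Cn_cst].
move=> n; apply: CnM => //; apply: CnV; first exact: step_den.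
exact: CnD.
Qed.

Lemma step1 (R : realType) (x : R) : x <= 1 -> step x = 1.
Proof.
move=> x1; have := step_den x; rewrite /step [flat 0 (x - 1)]/flat.
by rewrite subr_gt0 ltNge x1 /= addr0 => /divff.
Qed.

Lemma step0 (R : realType) (x : R) : 2 <= x -> step x = 0.
Proof. by move=> x2; rewrite /step {1}/flat subr_gt0 ltNge x2 /= mul0r. Qed.

(** * The circle and periodic functions *)

Lemma twopi_gt0 (R : realType) : 0 < 2 * pi :> R.
Proof. by rewrite mulr_gt0// pi_gt0. Qed.

Lemma periodic_int (R : realType) (T : Type) (p : R) (f : R -> T) :
  (forall t, f (t + p) = f t) -> forall (k : int) t, f (t + k%:~R * p) = f t.
Proof.
move=> pf k t; have pn n s : f (s + n%:R * p) = f s.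
  elim: n s => [|n IH] s; first by rewrite mul0r addr0.
  by rewrite -natr1 mulrDl mul1r addrA pf.
case: k => n; first by rewrite -pmulrn pn.
rewrite NegzE mulrNz mulNr -pmulrn -[LHS](pn n.+1).
by rewrite subrK.
Qed.

Lemma circ_eqP (R : realType) (T : Type) (f : R -> T) (t u : R) :
  (forall t, f (t + 2 * pi) = f t) -> circ_eq t u -> f u = f t.
Proof. by move=> pf [k ->]; exact: periodic_int. Qed.

Lemma circ_refl (R : realType) (t : R) : circ_eq t t.
Proof. by exists 0; rewrite mul0r addr0. Qed.

Lemma circ_sym (R : realType) (t u : R) : circ_eq t u -> circ_eq u t.
Proof. by move=> [k ->]; exists (- k); rewrite mulrNz mulNr addrK. Qed.

Lemma circ_trans (R : realType) (t u v : R) :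
  circ_eq t u -> circ_eq u v -> circ_eq t v.
Proof. by move=> [k ->] [l ->]; exists (k + l); rewrite intrD; ring. Qed.

Lemma circ_window (R : realType) (a t : R) :
  exists2 u, circ_eq t u & a <= u < a + 2 * pi.
Proof.
have p0 := twopi_gt0 R.
pose k := Num.floor ((t - a) / (2 * pi)).
exists (t + (- k)%:~R * (2 * pi)); first by exists (- k).
have := floor_itv ((t - a) / (2 * pi)); rewrite -/k => /andP[].
rewrite ler_pdivlMr// ltr_pdivrMr// intrD mulrDl mul1r mulrNz mulNr => h1 h2.
by apply/andP; split; lra.
Qed.

Lemma circ_near (R : realType) (t u : R) :
  circ_eq t u -> `|u - t| < 2 * pi -> u = t.
Proof.
move=> [k ->]; rewrite addrC addKr normrM (gtr0_norm (twopi_gt0 R)).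
rewrite gtr_pMl ?twopi_gt0// -intr_norm -[1]/(1%:~R) ltr_int => k1.
have -> : k = 0 by move: k1; case: k => [[|n]|n].
by rewrite mul0r addr0.
Qed.

(** A period is compact. *)
Lemma periodic_bounded (R : realType) (f : R -> R) : continuous f ->
  (forall t, f (t + 2 * pi) = f t) -> exists2 C, 0 < C & forall t, `|f t| <= C.
Proof.
move=> cf pf.
have cn : {within `[0 : R, 2 * pi], continuous (fun t => `|f t|)}.
  by apply: continuous_subspaceT => t; apply: continuous_comp (cf _) _; exact: norm_continuous.
have [c _ cmax] := EVT_max (ltW (twopi_gt0 R)) cn.
exists (`|f c| + 1); first by rewrite ltr_wpDl.
move=> t; have [u tu] := circ_window 0 t; rewrite add0r => /andP[u0 u1].
rewrite -(circ_eqP pf tu) ler_wpDr// cmax//.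
by rewrite in_itv /= u0 ltW.
Qed.

Lemma periodic_pos (R : realType) (f : R -> R) : continuous f ->
  (forall t, f (t + 2 * pi) = f t) -> (forall t, 0 < f t) ->
  exists2 c, 0 < c & forall t, c <= f t.
Proof.
move=> cf pf f0.
have cn : {within `[0 : R, 2 * pi], continuous f} by exact: continuous_subspaceT.
have [c _ cmin] := EVT_min (ltW (twopi_gt0 R)) cn.
exists (f c) => // t; have [u tu] := circ_window 0 t; rewrite add0r => /andP[u0 u1].
by rewrite -(circ_eqP pf tu) cmin// in_itv /= u0 ltW.
Qed.

(** * Smooth plane curves and their norms *)

Lemma dv_pair (R : realType) (f : R -> R * R) (t : R) (d : R * R) :
  is_derive t 1 (fun s => (f s).1) d.1 -> is_derive t 1 (fun s => (f s).2) d.2 ->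
  is_derive t 1 f d.
Proof.
move=> [h1 e1] [h2 e2].
have key : (fun h : R => h^-1 *: (f (h *: 1 + t) - f t)) @ 0^' --> d.
  rewrite [d]surjective_pairing -e1 -e2.
  apply: (cvg_trans _ (cvg_pair h1 h2)).
  by apply: near_eq_cvg; near=> h; rewrite /= /GRing.scale/=.
have dk : derivable f t 1 by apply/cvg_ex; exists d.
by apply: DeriveDef => //; exact: cvg_lim.
Unshelve. all: by end_near. Qed.

Lemma dv_pair_inv (R : realType) (f : R -> R * R) (t : R) : derivable f t 1 ->
  is_derive t 1 (fun s => (f s).1) (derive1 f t).1 /\
  is_derive t 1 (fun s => (f s).2) (derive1 f t).2.
Proof.
move=> h; have hl : (fun h : R => h^-1 *: (f (h *: 1 + t) - f t)) @ 0^' --> derive1 f t.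
  by rewrite derive1E.
have h1 : (fun h : R => h^-1 *: ((f (h *: 1 + t)).1 - (f t).1)) @ 0^' --> (derive1 f t).1.
  exact: (cvg_comp _ _ hl (@cvg_fst _ _ _ _ _)).
have h2 : (fun h : R => h^-1 *: ((f (h *: 1 + t)).2 - (f t).2)) @ 0^' --> (derive1 f t).2.
  exact: (cvg_comp _ _ hl (@cvg_snd _ _ _ _ _)).
have d1 : derivable (fun s => (f s).1) t 1 by apply/cvg_ex; exists (derive1 f t).1.
have d2 : derivable (fun s => (f s).2) t 1 by apply/cvg_ex; exists (derive1 f t).2.
by split; [exact: (DeriveDef d1 (cvg_lim _ h1))|exact: (DeriveDef d2 (cvg_lim _ h2))].
Qed.

Lemma smooth_iter (R : realType) (f : R -> R * R) n : smooth f ->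
  derive1n n (fun t => (f t).1) = (fun t => (derive1n n f t).1) /\
  derive1n n (fun t => (f t).2) = (fun t => (derive1n n f t).2).
Proof.
move=> sf; elim: n => [|n [IH1 IH2]]; first by [].
rewrite !derive1nS IH1 IH2; split; apply: derive1_eq => t;
  by have [] := dv_pair_inv (sf n t).
Qed.

Lemma Cinf_of_derivable (R : realType) (f : R -> R) :
  (forall n t, derivable (derive1n n f) t 1) -> Cinf f.
Proof.
move=> df n; elim: n f df => // n IH f df; split; first exact: (df 0%N).
by apply: IH => m t; rewrite -derive1Sn; exact: df.
Qed.

Lemma smooth_Cinf (R : realType) (f : R -> R * R) : smooth f ->
  Cinf (fun t => (f t).1) /\ Cinf (fun t => (f t).2).
Proof.
move=> sf; split; apply: Cinf_of_derivable => n t;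
  have [e1 e2] := smooth_iter n sf; have [[d1 _] [d2 _]] := dv_pair_inv (sf n t).
  by rewrite e1; exact: d1.
by rewrite e2; exact: d2.
Qed.

Lemma Cinf_smooth (R : realType) (f : R -> R * R) :
  Cinf (fun t => (f t).1) -> Cinf (fun t => (f t).2) -> smooth f.
Proof.
move=> s1 s2.
have h n : derive1n n f = (fun t => (derive1n n (fun t => (f t).1) t, derive1n n (fun t => (f t).2) t)).
  elim: n => [|n IH]; first by apply/funext => t /=; case: (f t).
  rewrite derive1nS IH; apply: derive1_eq => t; apply: dv_pair => /=;
    rewrite ?derive1nS; exact: (Cinf_is_derive t (Cinf_derive1n n _)).
move=> n t; rewrite h.
have d1 := Cinf_is_derive t (Cinf_derive1n n s1).
have d2 := Cinf_is_derive t (Cinf_derive1n n s2).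
by case: (@dv_pair R (fun t => (derive1n n (fun t => (f t).1) t, derive1n n (fun t => (f t).2) t)) t (_, _) d1 d2).
Qed.

Lemma smooth_derive1 (R : realType) (f : R -> R * R) : smooth f -> smooth (derive1 f).
Proof. by move=> sf n t; rewrite -derive1Sn; exact: sf. Qed.

Lemma smooth_derive1n (R : realType) (f : R -> R * R) n : smooth f -> smooth (derive1n n f).
Proof.
by move=> sf; elim: n => [|n IH]; [|rewrite derive1nS; exact: (smooth_derive1 IH)].
Qed.

Lemma smooth_dv (R : realType) (f : R -> R * R) (t : R) : smooth f ->
  is_derive t 1 (fun s => (f s).1) (derive1 f t).1 /\
  is_derive t 1 (fun s => (f s).2) (derive1 f t).2.
Proof. by move=> sf; apply: dv_pair_inv; exact: (sf 0%N). Qed.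

Lemma smooth_dv1 (R : realType) (f : R -> R * R) (t : R) : smooth f ->
  is_derive t 1 (fun s => (f s).1) (derive1 f t).1.
Proof. by move=> /(smooth_dv t) []. Qed.

Lemma smooth_dv2 (R : realType) (f : R -> R * R) (t : R) : smooth f ->
  is_derive t 1 (fun s => (f s).2) (derive1 f t).2.
Proof. by move=> /(smooth_dv t) []. Qed.

Lemma smooth_ct1 (R : realType) (f : R -> R * R) : smooth f -> continuous (fun s => (f s).1).
Proof. by move=> /smooth_Cinf [] /Cinf_continuous. Qed.

Lemma smooth_ct2 (R : realType) (f : R -> R * R) : smooth f -> continuous (fun s => (f s).2).
Proof. by move=> /smooth_Cinf [] _ /Cinf_continuous. Qed.

Lemma smooth_ct (R : realType) (f : R -> R * R) : smooth f -> continuous f.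
Proof.
by move=> sf t; apply: differentiable_continuous; exact: (derivable1_diffP f t).1 (sf 0%N t).
Qed.

Lemma derive1_periodic (R : realType) (V : normedModType R) (p : R) (f : R -> V) :
  (forall t, f (t + p) = f t) -> forall t, derive1 f (t + p) = derive1 f t.
Proof.
move=> pf t; rewrite /derive1; suff -> : (fun h => h^-1 *: (f (h + (t + p)) - f (t + p))) =
          (fun h => h^-1 *: (f (h + t) - f t)) by [].
by apply/funext => h /=; rewrite addrA !pf.
Qed.

Lemma derive1n_periodic (R : realType) (V : normedModType R) (p : R) (f : R -> V) n :
  (forall t, f (t + p) = f t) -> forall t, derive1n n f (t + p) = derive1n n f t.
Proof. by move=> pf; elim: n => // n IH; apply: (@derive1_periodic R V p (derive1n n f)). Qed.

(** The norm of a pair is the maximum norm. *)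
Lemma norm_pair_le (R : realType) (v : R * R) (c : R) :
  `|v| <= c <-> `|v.1| <= c /\ `|v.2| <= c.
Proof. by rewrite prod_normE ge_max; split=> [/andP[]|[-> ->]]. Qed.

Lemma norm1_le (R : realType) (v : R * R) : `|v.1| <= `|v|.
Proof. by have [] := (norm_pair_le v `|v|).1 (lexx _). Qed.

Lemma norm2_le (R : realType) (v : R * R) : `|v.2| <= `|v|.
Proof. by have [] := (norm_pair_le v `|v|).1 (lexx _). Qed.

Lemma smooth_bounded (R : realType) (f : R -> R * R) n : smooth f ->
  (forall t, f (t + 2 * pi) = f t) ->
  exists2 C, 0 < C & forall t, `|derive1n n f t| <= C.
Proof.
move=> sf pf; have sn := smooth_derive1n (n := n) sf.
have pn := derive1n_periodic n pf.
have p1 t : (derive1n n f (t + 2 * pi)).1 = (derive1n n f t).1 by rewrite pn.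
have p2 t : (derive1n n f (t + 2 * pi)).2 = (derive1n n f t).2 by rewrite pn.
have [C C0 hC] := periodic_bounded (smooth_ct1 sn) p1.
have [D D0 hD] := periodic_bounded (smooth_ct2 sn) p2.
exists (C + D); first exact: addr_gt0.
move=> t; apply/norm_pair_le; split.
  by apply: le_trans (hC t) _; rewrite lerDl ltW.
by apply: le_trans (hD t) _; rewrite lerDr ltW.
Qed.

Lemma smooth_bounded_upto (R : realType) (f : R -> R * R) k : smooth f ->
  (forall t, f (t + 2 * pi) = f t) ->
  exists2 C, 0 < C & forall j t, (j <= k)%N -> `|derive1n j f t| <= C.
Proof.
move=> sf pf; elim: k => [|k [C C0 hC]].
  have [C C0 hC] := smooth_bounded 0 sf pf.
  by exists C => // j t; rewrite leqn0 => /eqP ->.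
have [D D0 hD] := smooth_bounded k.+1 sf pf.
exists (C + D); first exact: addr_gt0.
move=> j t; rewrite leq_eqVlt => /orP[/eqP ->|jk].
  by apply: le_trans (hD t) _; rewrite lerDr ltW.
by apply: le_trans (hC j t jk) _; rewrite lerDl ltW.
Qed.

(** For smooth periodic functions the suprema in the C^k norm are finite,
    so that they do bound the values. *)
Lemma Ck_norm_lt (R : realType) k (f : R -> R * R) (e : R) : smooth f ->
  (forall t, f (t + 2 * pi) = f t) -> Ck_norm k f < e ->
  forall j t, (j <= k)%N -> `|derive1n j f t| < e.
Proof.
move=> sf pf fe j t jk; apply: le_lt_trans fe.
have [C C0 hC] := smooth_bounded j sf pf.
apply: (@le_trans _ _ (sup (range (fun t => `|derive1n j f t|)))).
  apply: sup_upper_bound; last by exists t.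
  split; first by exists `|derive1n j f t|, t.
  by exists C => _ [s _ <-]; exact: hC.
exact: (le_bigmax _ (fun j : 'I_k.+1 => sup (range (fun t => `|derive1n j f t|)))
          (Ordinal (jk : (j < k.+1)%N))).
Qed.

Lemma Ck_norm_le_bound (R : realType) k (f : R -> R * R) (c : R) : 0 <= c ->
  (forall j t, (j <= k)%N -> `|derive1n j f t| <= c) -> Ck_norm k f <= c.
Proof.
move=> c0 fc; apply: bigmax_le => // i _.
apply: ge_sup; first by exists `|derive1n i f 0|, 0.
by move=> _ [t _ <-]; apply: fc; rewrite -ltnS.
Qed.

Lemma derive1n_add (R : realType) (f g : R -> R * R) n : smooth f -> smooth g ->
  derive1n n (fun t => f t + g t) = (fun t => derive1n n f t + derive1n n g t).
Proof.
move=> sf sg; elim: n => // n IH; rewrite derive1nS IH.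
by apply: derive1_eq => t; apply: is_deriveD; rewrite derive1nS derive1E; apply: derivableP; [exact: sf|exact: sg].
Qed.

Lemma derive1n_scale (R : realType) (f : R -> R * R) (c : R) n : smooth f ->
  derive1n n (fun t => c *: f t) = (fun t => c *: derive1n n f t).
Proof.
move=> sf; elim: n => // n IH; rewrite derive1nS IH.
by apply: derive1_eq => t; apply: is_deriveZ; rewrite derive1nS derive1E; apply: derivableP; exact: sf.
Qed.

Lemma smooth_add (R : realType) (f g : R -> R * R) : smooth f -> smooth g ->
  smooth (fun t => f t + g t).
Proof.
by move=> sf sg n t; rewrite derive1n_add//; apply: derivableD; [exact: sf|exact: sg].
Qed.

Lemma smooth_scale (R : realType) (f : R -> R * R) (c : R) : smooth f ->
  smooth (fun t => c *: f t).
Proof. by move=> sf n t; rewrite derive1n_scale//; apply: derivableZ; exact: sf. Qed.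

Lemma smooth_cst (R : realType) (c : R * R) : smooth (fun=> c).
Proof. by apply: Cinf_smooth => n; exact: Cn_cst. Qed.

Lemma smooth_opp (R : realType) (f : R -> R * R) : smooth f -> smooth (fun t => - f t).
Proof.
by move=> sf; have := smooth_scale (c := -1) sf; under eq_fun do rewrite scaleN1r.
Qed.

Lemma smooth_sub (R : realType) (f g : R -> R * R) : smooth f -> smooth g -> smooth (f \- g).
Proof. move=> sf sg; exact: (smooth_add sf (smooth_opp sg)). Qed.

Lemma derive1n_sub (R : realType) (f g : R -> R * R) n t : smooth f -> smooth g ->
  derive1n n (f \- g) t = derive1n n f t - derive1n n g t.
Proof.
move=> sf sg; have := derive1n_add n sf (smooth_opp sg) => /(congr1 (fun F => F t)) /= ->.
congr (_ + _); have := derive1n_scale (-1) n sg => /(congr1 (fun F => F t)) /=.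
by under eq_fun do rewrite scaleN1r; rewrite scaleN1r.
Qed.

Lemma derive1n_sum (R : realType) (I : eqType) (r : seq I) (F : I -> R -> R * R) n :
  (forall i, smooth (F i)) ->
  smooth (fun t => \sum_(i <- r) F i t) /\
  derive1n n (fun t => \sum_(i <- r) F i t) = (fun t => \sum_(i <- r) derive1n n (F i) t).
Proof.
move=> sF; elim: r => [|i r [sr dr]].
  have -> : (fun t => \sum_(i <- [::]) F i t) = fun=> 0 by apply/funext => t; rewrite big_nil.
  have s0 := @smooth_cst R 0; split=> //.
  have := derive1n_scale 0 n s0; under eq_fun do rewrite scale0r.
  by move=> ->; apply/funext => t; rewrite big_nil scale0r.
have -> : (fun t => \sum_(j <- i :: r) F j t) = (fun t => F i t + \sum_(j <- r) F j t).
  by apply/funext => t; rewrite big_cons.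
split; first exact: (smooth_add (sF i) sr).
by rewrite (derive1n_add n (sF i) sr) dr; apply/funext => t; rewrite big_cons.
Qed.

Lemma smooth_scalar (R : realType) (a : R -> R) (v : R * R) : Cinf a ->
  smooth (fun t => a t *: v).
Proof.
move=> ca; apply: Cinf_smooth => n /=; apply: CnM => //; exact: Cn_cst.
Qed.

Lemma derive1n_scalar (R : realType) (a : R -> R) (v : R * R) n : Cinf a ->
  derive1n n (fun t => a t *: v) = (fun t => derive1n n a t *: v).
Proof.
move=> ca; elim: n => // n IH; rewrite derive1nS IH; apply: derive1_eq => t.
apply: dv_pair => /=; apply: (dv_eq (dv_M (Cinf_is_derive t (Cinf_derive1n n ca)) (dv_cst _ _)));
by rewrite mulr0 addr0 ?derive1nS.
Qed.

(** * The determinant of two plane vectors *)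

Lemma det2_le (R : realType) (u v : R * R) : `|det2 u v| <= 2 * `|u| * `|v|.
Proof.
rewrite /det2; apply: le_trans (ler_normB _ _) _; rewrite !normrM.
have -> : 2 * `|u| * `|v| = `|u| * `|v| + `|u| * `|v| by ring.
by apply: lerD; apply: ler_pM; rewrite ?normr_ge0 ?norm1_le ?norm2_le.
Qed.

Lemma det2Dl (R : realType) (u v w : R * R) : det2 (u + v) w = det2 u w + det2 v w.
Proof. by rewrite /det2 /=; ring. Qed.
Lemma det2Dr (R : realType) (u v w : R * R) : det2 w (u + v) = det2 w u + det2 w v.
Proof. by rewrite /det2 /=; ring. Qed.
Lemma det2Bl (R : realType) (u v w : R * R) : det2 (u - v) w = det2 u w - det2 v w.
Proof. by rewrite /det2 /=; ring. Qed.
Lemma det2Br (R : realType) (u v w : R * R) : det2 w (u - v) = det2 w u - det2 w v.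
Proof. by rewrite /det2 /=; ring. Qed.
Lemma det2Zl (R : realType) (c : R) (u v : R * R) : det2 (c *: u) v = c * det2 u v.
Proof. by rewrite /det2 /= /GRing.scale/=; ring. Qed.
Lemma det2Zr (R : realType) (c : R) (u v : R * R) : det2 u (c *: v) = c * det2 u v.
Proof. by rewrite /det2 /= /GRing.scale/=; ring. Qed.
Lemma det2vv (R : realType) (u : R * R) : det2 u u = 0.
Proof. by rewrite /det2; ring. Qed.

Lemma det2r0 (R : realType) (u : R * R) : det2 u 0 = 0.
Proof. by rewrite /det2 /=; ring. Qed.

Lemma dv_det2 (R : realType) (f g : R -> R * R) (t : R) (df dg : R * R) :
  is_derive t 1 (fun s => (f s).1) df.1 -> is_derive t 1 (fun s => (f s).2) df.2 ->
  is_derive t 1 (fun s => (g s).1) dg.1 -> is_derive t 1 (fun s => (g s).2) dg.2 ->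
  is_derive t 1 (fun s => det2 (f s) (g s)) (det2 df (g t) + det2 (f t) dg).
Proof.
move=> f1 f2 g1 g2; rewrite /det2.
apply: (dv_eq (dv_D (dv_M f1 g2) (dv_N (dv_M f2 g1)))); ring.
Qed.

Lemma dv_det2r (R : realType) (v w : R * R) (g : R -> R * R) (t : R) : smooth g ->
  is_derive t 1 (fun s => det2 v (g s - w)) (det2 v (derive1 g t)).
Proof.
move=> sg; have h1 := smooth_dv1 t sg; have h2 := smooth_dv2 t sg; rewrite /det2 /=.
by apply: (dv_eq (dv_D (dv_M (dv_cst _ _) (dv_D h2 (dv_cst _ _)))
  (dv_N (dv_M (dv_cst _ _) (dv_D h1 (dv_cst _ _)))))); ring.
Qed.

Lemma det2_ct (R : realType) (f g : R -> R * R) : smooth f -> smooth g ->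
  continuous (fun s => det2 (f s) (g s)).
Proof.
move=> sf sg t; apply/differentiable_continuous/derivable1_diffP.
by case: (dv_det2 (smooth_dv1 t sf) (smooth_dv2 t sf) (smooth_dv1 t sg) (smooth_dv2 t sg)).
Qed.

(** * Calculus on the line *)

Lemma dv_ct (R : realType) (f : R -> R) (t d : R) :
  is_derive t (1 : R) f d -> {for t, continuous f}.
Proof.
by case=> h _; apply: differentiable_continuous; exact/derivable1_diffP.
Qed.

Lemma dv_within (R : realType) (f df : R -> R) (a b : R) :
  (forall t, a <= t <= b -> is_derive t (1 : R) f (df t)) ->
  {within `[a, b], continuous f}.
Proof.
move=> fd; apply: derivable_within_continuous => t tab.
by case: (fd t) => //; move: tab; rewrite in_itv.
Qed.

Lemma dv_shift (R : realType) (f : R -> R) (t c d : R) :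
  is_derive (t + c) (1 : R) f d -> is_derive t (1 : R) (fun t => f (t + c)) d.
Proof.
move=> fd; have ds : is_derive t (1 : R) (fun t => t + c) 1.
  by apply: (dv_eq (dv_D (dv_id t) (dv_cst t c))); rewrite addr0.
by apply: (dv_eq (dv_comp (f := f) (g := fun t => t + c) fd ds)); rewrite mulr1.
Qed.

Lemma mvt (R : realType) (f df : R -> R) (a b : R) : a < b ->
  (forall t, a <= t <= b -> is_derive t (1 : R) f (df t)) ->
  exists2 c, a < c < b & f b - f a = df c * (b - a).
Proof.
move=> ab fd; have [||c] := @MVT R f df a b ab.
- by move=> x; rewrite in_itv /= => /andP[ax xb]; apply: fd; rewrite !ltW.
- exact: dv_within fd.
- by rewrite in_itv /= => cab e; exists c.
Qed.

Lemma dv_incr (R : realType) (f df : R -> R) (a b : R) : a < b ->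
  (forall t, a <= t <= b -> is_derive t (1 : R) f (df t)) ->
  (forall t, a < t < b -> 0 < df t) -> f a < f b.
Proof.
move=> ab fd fp; have [c cab e] := mvt ab fd.
by rewrite -subr_gt0 e mulr_gt0 ?fp// subr_gt0.
Qed.

Lemma dv_decr (R : realType) (f df : R -> R) (a b : R) : a < b ->
  (forall t, a <= t <= b -> is_derive t (1 : R) f (df t)) ->
  (forall t, a < t < b -> df t < 0) -> f b < f a.
Proof.
move=> ab fd fp; have [c cab e] := mvt ab fd.
by rewrite -subr_lt0 e nmulr_rlt0 ?fp// subr_gt0.
Qed.

Lemma dv_const (R : realType) (f : R -> R) (a b : R) : a <= b ->
  (forall t, a <= t <= b -> is_derive t (1 : R) f 0) -> f a = f b.
Proof.
rewrite le_eqVlt => /orP[/eqP ->//|ab] fd; have [c cab e] := mvt ab fd.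
by apply/esym/eqP; rewrite -subr_eq0 e mul0r.
Qed.

Lemma ivt (R : realType) (f : R -> R) (a b v : R) : a <= b -> continuous f ->
  (f a <= v <= f b) || (f b <= v <= f a) -> exists2 c, a <= c <= b & f c = v.
Proof.
move=> ab cf h; have [||c] := @IVT R f a b v ab.
- exact: continuous_subspaceT.
- rewrite ge_min le_max; case/orP: h => /andP[-> ->]; rewrite ?orbT //.
- by rewrite in_itv /= => cab e; exists c.
Qed.

Lemma min_dv0 (R : realType) (f df : R -> R) (t : R) :
  (forall s, is_derive s (1 : R) f (df s)) -> (forall s, f t <= f s) -> df t = 0.
Proof.
move=> fd fm.
have := @derive1_at_min R f (t - 1) (t + 1) t.
move=> K; have [//||||_ <-] := K; first by lra.
- by move=> s _; case: (fd s).
- by rewrite in_itv /=; apply/andP; split; lra.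
- by move=> s _; exact: fm.
- by case: (fd t).
Qed.

(** At the infimum z of the points where f <= 0, f vanishes; as z is an
    upcrossing, f is negative just before z, a contradiction. *)
Lemma no_upcrossing (R : realType) (f df : R -> R) (a b : R) : a < b ->
  (forall t, is_derive t (1 : R) f (df t)) ->
  (forall t, f t = 0 -> 0 < df t) -> 0 <= f a -> f b <= 0 -> False.
Proof.
move=> ab fd up fa fb.
have cf : continuous f by move=> t; exact: dv_ct (fd t).
(* right after, resp. left before, a zero the sign is known *)
have near_zero z : f z = 0 ->
    exists2 d, 0 < d & forall x, `|x - z| < d -> x - z != 0 -> 0 < (x - z)^-1 * f x.
  move=> z0; have dz := up z z0; have [dv dve] := fd z.
  have hl : (fun h : R => h^-1 *: (f (h *: 1 + z) - f z)) @ 0^' --> df z by rewrite -dve.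
  have := cvgr_gt _ hl => /(_ _ 0 dz) [d /= d0 hd]; exists d => // x xz xz0.
  have := hd (x - z) _ xz0.
  by rewrite /= sub0r normrN => /(_ xz); rewrite /GRing.scale /= mulr1 subrK z0 subr0.
have [a' aa' [a'b fa']] : exists2 a', a <= a' & a' < b /\ 0 < f a'.
  move: fa; rewrite le_eqVlt => /orP[/eqP/esym fa|fa]; last by exists a.
  have [d d0 hd] := near_zero a fa.
  pose e := Num.min (d / 2) ((b - a) / 2).
  have e0 : 0 < e by rewrite lt_min !divr_gt0// subr_gt0.
  have ed : e <= d / 2 by rewrite ge_min lexx.
  have eb : e <= (b - a) / 2 by rewrite ge_min lexx orbT.
  exists (a + e); first by rewrite lerDl ltW.
  split; first by lra.
  have := hd (a + e); rewrite addrC addKr gtr0_norm// => /(_ ltac:(lra) (lt0r_neq0 e0)).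
  by rewrite pmulr_rgt0// invr_gt0.
pose S := [set x | a' <= x <= b /\ f x <= 0].
have Sb : S b by split=> //; rewrite lexx ltW.
have iS : has_inf S by split; [exists b|exists a' => x [/andP[]]].
pose z := inf S.
have a'z : a' <= z by apply: lb_le_inf; [exists b|move=> x [/andP[]]].
have zb : z <= b by apply: ge_inf => //; case: iS.
have below x : a' <= x -> x < z -> 0 < f x.
  move=> a'x xz; rewrite ltNge; apply/negP => fx.
  have : z <= x by apply: ge_inf; [case: iS|split; rewrite ?a'x ?(le_trans (ltW xz))].
  by rewrite leNgt xz.
have fz : f z <= 0.
  rewrite leNgt; apply/negP => fz0.
  have [d /= d0 hd] := cvgr_gt _ (cf z) _ fz0.
  have [x Sx xz] := inf_adherent d0 iS.
  have zx : z <= x by apply: ge_inf => //; case: iS.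
  have : 0 < f x by apply: hd => /=; rewrite ltr_distlC; apply/andP; split; rewrite -/z in xz; lra.
  by case: Sx => _; rewrite leNgt => /negP.
have a'z' : a' < z by rewrite lt_neqAle a'z andbT; apply: contraTneq fa' => ->; rewrite -leNgt.
have fz0 : f z = 0.
  have [c /andP[ac cz] fc] : exists2 c, a' <= c <= z & f c = 0.
    by apply: ivt => //; apply/orP; right; rewrite fz ltW.
  have [zc|cz'] := leP z c; first by rewrite (le_anti (introT andP (conj zc cz))).
  by have := below c ac cz'; rewrite fc ltxx.
have [d d0 hd] := near_zero z fz0.
pose e := Num.min (d / 2) ((z - a') / 2).
have e0 : 0 < e by rewrite lt_min !divr_gt0// subr_gt0.
have ed : e <= d / 2 by rewrite ge_min lexx.
have eb : e <= (z - a') / 2 by rewrite ge_min lexx orbT.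
have : f (z - e) < 0.
  have := hd (z - e); rewrite addrC addKr normrN gtr0_norm// oppr_eq0.
  move=> /(_ ltac:(lra) (lt0r_neq0 e0)).
  by rewrite nmulr_rgt0// invr_lt0 oppr_lt0.
by apply/negP; rewrite -leNgt ltW// below; lra.
Qed.

(** The integral from -M is a primitive on ]-M, +oo[ only.  Letting M depend
    on x gives a global one, since two such primitives differ by a constant
    where both are defined. *)
Lemma antiderivative (R : realType) (f : R -> R) : continuous f ->
  exists F : R -> R, forall t, is_derive t (1 : R) F (f t).
Proof.
move=> cf.
pose G M x := (\int[@lebesgue_measure R]_(t in `[- M, x]) f t)%R.
have dG (M x : R) : - M < x -> is_derive x (1 : R) (G M) (f x).
  move=> Mx; have [||||d e] := @continuous_FTC1_closed R f (- M) x (x + 1).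
  - by rewrite ltrDl.
  - apply: continuous_compact_integrable; first exact: segment_compact.
    exact: continuous_subspaceT.
  - exact: Mx.
  - exact: cf.
  - by rewrite derive1E in e; exact: (DeriveDef d e).
exists (fun x => G (`|x| + 1) x - G (`|x| + 1) 0) => t.
have key : \forall x \near t, G (`|t| + 2) x - G (`|t| + 2) 0 = G (`|x| + 1) x - G (`|x| + 1) 0.
  near=> x.
  have xt : `|x| < `|t| + 1.
    rewrite -[x](subrK t); apply: le_lt_trans (ler_normD _ _) _; rewrite addrC ltrD2l.
    by rewrite distrC; near: x; exact: cvgr_dist_lt.
  have nx := ler_norm x; have nx' := ler_norm (- x); rewrite normrN in nx'.
  have nx0 := normr_ge0 x.
  suff h a b : a <= b -> - (`|x| + 1) < a -> G (`|t| + 2) a - G (`|x| + 1) a = G (`|t| + 2) b - G (`|x| + 1) b.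
    have e2 : G (`|t| + 2) x - G (`|x| + 1) x = G (`|t| + 2) 0 - G (`|x| + 1) 0.
      by have [x0|x0] := leP 0 x; [apply/esym|]; apply: h => //; lra.
    by move: e2; move: (G _ _) (G _ _) (G _ _) (G _ _) => g1 g2 g3 g4; lra.
  move=> ab xa; apply: (@dv_const R (fun s => G (`|t| + 2) s - G (`|x| + 1) s)) => // s /andP[s1 s2].
  by apply: (dv_eq (dv_D (dG _ _ _) (dv_N (dG _ _ _)))); rewrite ?subrr//; lra.
apply: (near_eq_is_derive key).
have nt := ler_norm (- t); rewrite normrN in nt.
by apply: (dv_eq (dv_D (dG _ _ _) (dv_cst _ _))); [lra|rewrite addr0].
Unshelve. all: by end_near. Qed.

(** * Curvature and the tangent angle *)

Lemma speed_gt0 (R : realType) (v : R * R) : v != 0 -> 0 < v.1 ^+ 2 + v.2 ^+ 2.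
Proof.
move=> v0; rewrite lt_neqAle addr_ge0 ?sqr_ge0// andbT eq_sym paddr_eq0 ?sqr_ge0//.
rewrite !sqrf_eq0; apply: contra v0; case: v => a b /= /andP[/eqP -> /eqP ->].
by [].
Qed.

Lemma curvature_gt0 (R : realType) (g : R -> R * R) (t : R) : derive1 g t != 0 ->
  (0 < curvature g t) = (0 < det2 (derive1 g t) (derive1 (derive1 g) t)).
Proof.
move=> v0; rewrite /curvature pmulr_lgt0// invr_gt0 exprn_gt0// sqrtr_gt0.
exact: speed_gt0.
Qed.

Lemma table_det_gt0 (R : realType) (g : table R) (t : R) :
  0 < det2 (derive1 g t) (derive1 (derive1 g) t).
Proof. by rewrite -curvature_gt0; [exact: table_curvature|exact: table_regular]. Qed.

(** The component of v normal to the direction a changes sign between a and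
    a + pi; one of the two opposite zeros is the direction of v. *)
Lemma polar_angle (R : realType) (v : R * R) : v != 0 ->
  exists2 a : R, - v.1 * sin a + v.2 * cos a = 0 & 0 < v.1 * cos a + v.2 * sin a.
Proof.
move=> v0; pose q a := - v.1 * sin a + v.2 * cos a.
have cq : continuous q.
  by move=> a; apply: dv_ct; exact: dv_D (dv_M (dv_cst _ _) (is_derive_sin _)) (dv_M (dv_cst _ _) (is_derive_cos _)).
have qpi a : q (a + pi) = - q a by rewrite /q sinDpi cosDpi; ring.
have [a _ qa] : exists2 a, 0 <= a <= 0 + pi & q a = 0.
  apply: ivt => //; first by rewrite add0r pi_ge0.
  by rewrite qpi; case: (lerP 0 (q 0)) => h; apply/orP; [right|left]; lra.
have [p0|p0|p0] := ltgtP 0 (v.1 * cos a + v.2 * sin a).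
- by exists a.
- exists (a + pi); first by have := qpi a; rewrite qa oppr0.
  by rewrite sinDpi cosDpi; lra.
- have := speed_gt0 v0; rewrite -[X in 0 < X]mulr1 -(cos2Dsin2 a).
  rewrite (_ : _ * _ = (v.1 * cos a + v.2 * sin a) ^+ 2 + (q a) ^+ 2); last by rewrite /q; ring.
  by rewrite -p0 qa expr0n /= addr0 ltxx.
Qed.

(** The angle is built as a primitive of the angular speed.  Why it is the
    angle of the vector: the square of the sine between the vector and the
    direction of this angle has derivative zero. *)
Lemma velocity_angle (R : realType) (x1 y1 x2 y2 : R -> R) :
  (forall t, is_derive t (1 : R) x1 (x2 t)) ->
  (forall t, is_derive t (1 : R) y1 (y2 t)) ->
  continuous (fun t => (x1 t * y2 t - y1 t * x2 t) / (x1 t ^+ 2 + y1 t ^+ 2)) ->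
  (forall t, 0 < x1 t ^+ 2 + y1 t ^+ 2) -> (x1 0, y1 0) != 0 ->
  exists th rho : R -> R,
    [/\ forall t, is_derive t (1 : R) th ((x1 t * y2 t - y1 t * x2 t) / (x1 t ^+ 2 + y1 t ^+ 2)),
        forall t, 0 < rho t,
        forall t, x1 t = rho t * cos (th t) &
        forall t, y1 t = rho t * sin (th t)].
Proof.
move=> dx dy ck N0 v0.
have dN t : is_derive t (1 : R) (fun t => x1 t ^+ 2 + y1 t ^+ 2) (2 * (x1 t * x2 t + y1 t * y2 t)).
  apply: (dv_eq (dv_D (dv_X 2 (dx t)) (dv_X 2 (dy t)))).
  by move: (x1 t) (x2 t) (y1 t) (y2 t) => x x' y y' /=; ring.
have [F dF] := antiderivative ck.
have [a /= Qa Pa] := polar_angle v0.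
pose th t := F t + (a - F 0).
have [th0 dth] : th 0 = a /\ forall t, is_derive t (1 : R) th ((x1 t * y2 t - y1 t * x2 t) / (x1 t ^+ 2 + y1 t ^+ 2)).
  split; first by rewrite /th addrC subrK.
  by move=> t; apply: (dv_eq (dv_D (dF t) (dv_cst _ _))); rewrite addr0.
move: th th0 dth => th th0 dth {F dF ck}.
have dQ t := dv_D (dv_M (dv_N (dx t)) (dv_sin (dth t))) (dv_M (dy t) (dv_cos (dth t))).
have dP t := dv_D (dv_M (dx t) (dv_cos (dth t))) (dv_M (dy t) (dv_sin (dth t))).
have dW t : is_derive t (1 : R) (fun t => (- x1 t * sin (th t) + y1 t * cos (th t)) ^+ 2 * (x1 t ^+ 2 + y1 t ^+ 2)^-1) 0.
  apply: (dv_eq (dv_M (dv_X 2 (dQ t)) (dv_V (dN t) (lt0r_neq0 (N0 t))))) => /=.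
  have := lt0r_neq0 (N0 t); have := cos2Dsin2 (th t).
  move: (x1 t) (x2 t) (y1 t) (y2 t) (cos (th t)) (sin (th t)) => x x' y y' c s cs Nn.
  have {}cs : c ^+ 2 = 1 - s ^+ 2 by rewrite -cs addrK.
  by field: cs.
have Q0 t : - x1 t * sin (th t) + y1 t * cos (th t) = 0.
  have W0 : (- x1 t * sin (th t) + y1 t * cos (th t)) ^+ 2 * (x1 t ^+ 2 + y1 t ^+ 2)^-1 = 0.
    pose W t := (- x1 t * sin (th t) + y1 t * cos (th t)) ^+ 2 * (x1 t ^+ 2 + y1 t ^+ 2)^-1.
    have e0 : W 0 = 0 by rewrite /W th0 Qa expr0n /= mul0r.
    change (W t = 0).
    rewrite -e0; have [t0|t0] := leP 0 t.
      by apply/esym; exact: (dv_const t0 (fun t _ => dW t)).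
    exact: (dv_const (ltW t0) (fun t _ => dW t)).
  move/eqP: W0; rewrite mulf_eq0 invr_eq0 (gt_eqF (N0 t)) orbF sqrf_eq0.
  by move/eqP.
pose P t := x1 t * cos (th t) + y1 t * sin (th t).
have NPQ t : x1 t ^+ 2 + y1 t ^+ 2 = P t ^+ 2.
  transitivity ((x1 t ^+ 2 + y1 t ^+ 2) * (cos (th t) ^+ 2 + sin (th t) ^+ 2)).
    by rewrite cos2Dsin2 mulr1.
  transitivity (P t ^+ 2 + (- x1 t * sin (th t) + y1 t * cos (th t)) ^+ 2).
    by rewrite /P; move: (x1 t) (y1 t) (cos (th t)) (sin (th t)) => x y c s; ring.
  by rewrite Q0 expr0n /= addr0.
have cP : continuous P by move=> t; exact: dv_ct (dP t).
have Pn0 t : P t != 0 by have := N0 t; rewrite NPQ => /lt0r_neq0; rewrite sqrf_eq0.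
have P0 t : 0 < P t.
  rewrite lt_neqAle eq_sym Pn0 /= leNgt; apply/negP => Pt.
  have P00 : 0 < P 0 by rewrite /P th0.
  have [s _ Ps] : exists2 s, Num.min 0 t <= s <= Num.max 0 t & P s = 0.
    apply: ivt => //; first by rewrite ge_min le_max lexx.
    by case: (leP 0 t) => _; apply/orP; [right|left]; rewrite !ltW.
  by move: (Pn0 s); rewrite Ps eqxx.
exists th, P; split=> // t; have := Q0 t; have := cos2Dsin2 (th t); rewrite /P.
  move: (cos (th t)) (sin (th t)) (x1 t) (y1 t) => c s x y cs q0.
  transitivity (x * (c ^+ 2 + s ^+ 2)); first by rewrite cs mulr1.
  transitivity ((x * c + y * s) * c - s * (- x * s + y * c)); first by ring.
  by rewrite q0 mulr0 subr0.
move: (cos (th t)) (sin (th t)) (x1 t) (y1 t) => c s x y cs q0.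
transitivity (y * (c ^+ 2 + s ^+ 2)); first by rewrite cs mulr1.
transitivity ((x * c + y * s) * s + c * (- x * s + y * c)); first by ring.
by rewrite q0 mulr0 addr0.
Qed.

(** Dividing by the squared speed gives the angular speed of the tangent. *)
Lemma tangent_angle (R : realType) (g : R -> R * R) : smooth g ->
  (forall t, derive1 g t != 0) ->
  exists th rho : R -> R,
    [/\ forall t, is_derive t (1 : R) th (det2 (derive1 g t) (derive1 (derive1 g) t) /
                          ((derive1 g t).1 ^+ 2 + (derive1 g t).2 ^+ 2)),
        forall t, 0 < rho t &
        forall t, derive1 g t = (rho t * cos (th t), rho t * sin (th t))].
Proof.
move=> sg g0; have s1 := smooth_derive1 sg; have s2 := smooth_derive1 s1.
have N0 t : 0 < (derive1 g t).1 ^+ 2 + (derive1 g t).2 ^+ 2 by exact: speed_gt0.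
have [|||th [rho [h1 h2 h3 h4]]] := @velocity_angle R (fun t => (derive1 g t).1)
  (fun t => (derive1 g t).2) (fun t => (derive1 (derive1 g) t).1)
  (fun t => (derive1 (derive1 g) t).2) (fun t => smooth_dv1 t s1) (fun t => smooth_dv2 t s1).
- move=> t; apply: dv_ct.
  have dN := dv_D (dv_X 2 (smooth_dv1 t s1)) (dv_X 2 (smooth_dv2 t s1)).
  exact: dv_M (dv_D (dv_M (smooth_dv1 t s1) (smooth_dv2 t s2)) (dv_N (dv_M (smooth_dv2 t s1) (smooth_dv1 t s2)))) (dv_V dN (lt0r_neq0 (N0 t))).
- exact: N0.
- by rewrite -surjective_pairing.
exists th, rho; split=> // t.
by rewrite [LHS]surjective_pairing h3 h4.
Qed.

(** * A simple closed curve of positive curvature turns once *)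

Lemma sin_lt0_pi2pi (R : realType) (t : R) : pi < t < 2 * pi -> sin t < 0.
Proof.
move=> /andP[t1 t2]; rewrite -[t](subrK pi) sinDpi oppr_lt0.
by apply: sin_gt0_pi; apply/andP; split; lra.
Qed.

Lemma cos_lt0_mid (R : realType) (t : R) : pi / 2 < t < 3 * (pi / 2) -> cos t < 0.
Proof.
move=> /andP[t1 t2]; rewrite -[t](subrK pi) cosDpi oppr_lt0.
by apply: cos_gt0_pihalf; apply/andP; split; lra.
Qed.

Lemma sinD2piE (R : realType) (t : R) : sin (t + 2 * pi) = sin t.
Proof. by rewrite mulr_natl; exact: sinD2pi. Qed.

Lemma cosD2piE (R : realType) (t : R) : cos (t + 2 * pi) = cos t.
Proof. by rewrite mulr_natl; exact: cosD2pi. Qed.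

(** The inverse is total but meaningful on [f a, f b] only. *)
Lemma inverse_on (R : realType) (f : R -> R) (a b : R) : a <= b -> continuous f ->
  (f a <= f b) ->
  (forall x y, a <= x -> x < y -> y <= b -> f x < f y) ->
  exists u : R -> R, (forall h, f a <= h <= f b -> a <= u h <= b /\ f (u h) = h) /\
     {within `[f a, f b], continuous u}.
Proof.
move=> ab cf fab mf.
have /choice [u hu] : forall h, exists x, f a <= h <= f b -> a <= x <= b /\ f x = h.
  move=> h; case: (boolP (f a <= h <= f b)) => hh; last by exists a.
  by have [x xab <-] := ivt ab cf (introT orP (or_introl hh)); exists x.
exists u; split=> //; apply: segment_can_le_continuous => //.
  exact: continuous_subspaceT.
move=> x; rewrite in_itv /= => /andP[ax xb].
have fx : f a <= f x <= f b.
  apply/andP; split.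
    by move: ax; rewrite le_eqVlt => /orP[/eqP -> //|ax]; exact/ltW/mf.
  by move: xb; rewrite le_eqVlt => /orP[/eqP -> //|xb]; exact/ltW/mf.
have [/andP[au ub] fu] := hu _ fx.
have [h|h|//] := ltgtP (u (f x)) x.
  by have := mf _ _ au h xb; rewrite fu ltxx.
by have := mf _ _ ax h ub; rewrite fu ltxx.
Qed.

(** An arc that turns exactly once, starts and ends at the same height and
    ends to the right of its start must cross itself.  Take the two points at
    height h on the rising half and on the falling half: the first is to the
    left of the second for h minimal, and to its right for h close to the top. *)
Lemma loop_crossing (R : realType) (X Y r : R -> R) :
  (forall t, is_derive t (1 : R) X (r t * cos t)) ->
  (forall t, is_derive t (1 : R) Y (r t * sin t)) ->
  (forall t, 0 < r t) -> Y (2 * pi) = Y 0 -> X 0 < X (2 * pi) ->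
  exists b1 b2, [/\ 0 < b1, b1 < b2, b2 < 2 * pi, X b1 = X b2 & Y b1 = Y b2].
Proof.
move=> dX dY r0 Y2 X2; have p0 := pi_gt0 R.
have cX : continuous X by move=> t; exact: dv_ct (dX t).
have cY : continuous Y by move=> t; exact: dv_ct (dY t).
have up x y : 0 <= x -> x < y -> y <= pi -> Y x < Y y.
  move=> x0 xy yp; apply: (dv_incr xy (fun t _ => dY t)) => t /andP[xt ty].
  by rewrite mulr_gt0// sin_gt0_pi//; apply/andP; split; lra.
have dn x y : pi <= x -> x < y -> y <= 2 * pi -> Y y < Y x.
  move=> x0 xy yp; apply: (dv_decr xy (fun t _ => dY t)) => t /andP[xt ty].
  by rewrite pmulr_rlt0// sin_lt0_pi2pi//; apply/andP; split; lra.
have dX' x y : pi / 2 <= x -> x < y -> y <= 3 * (pi / 2) -> X y < X x.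
  move=> x0 xy yp; apply: (dv_decr xy (fun t _ => dX t)) => t /andP[xt ty].
  by rewrite pmulr_rlt0// cos_lt0_mid//; apply/andP; split; lra.
have Y0p : Y 0 < Y pi by apply: up.
have [u [uP cu]] := inverse_on (ltW p0) cY (ltW Y0p) up.
pose Z t := Y (- t).
have cZ : continuous Z.
  by move=> t; apply: (@continuous_comp _ _ _ -%R Y); [exact: opp_continuous|exact: cY].
have upZ x y : - (2 * pi) <= x -> x < y -> y <= - pi -> Z x < Z y.
  by move=> h1 h2 h3; apply: dn; rewrite ?ltrN2//; lra.
have Za : Z (- (2 * pi)) = Y 0 by rewrite /Z opprK.
have Zb : Z (- pi) = Y pi by rewrite /Z opprK.
have [||v [vP cv]] := @inverse_on R Z (- (2 * pi)) (- pi) _ cZ _ upZ.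
- by lra.
- by rewrite Za Zb ltW.
rewrite Za Zb in vP cv.
pose w h := X (u h) - X (- v h).
(* At this height the two points lie in [pi / 2, 3 pi / 2], where X decreases. *)
pose h1 := Num.max (Y (pi / 2)) (Y (3 * (pi / 2))).
have Y1 : Y 0 < Y (pi / 2) by apply: up => //; lra.
have Y2' : Y (pi / 2) < Y pi by apply: up => //; lra.
have Y3 : Y (3 * (pi / 2)) < Y pi by apply: dn => //; lra.
have h1p : h1 < Y pi by rewrite gt_max Y2' Y3.
have h10 : Y 0 < h1 by rewrite lt_max Y1.
have [/andP[u1 u2] u3] := uP h1 (introT andP (conj (ltW h10) (ltW h1p))).
have [/andP[v1 v2] v3] := vP h1 (introT andP (conj (ltW h10) (ltW h1p))).
have w1 : 0 < w h1.
  have uu : pi / 2 <= u h1.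
    rewrite leNgt; apply/negP => k; have := @up _ _ u1 k ltac:(lra).
    by rewrite u3 gt_max ltxx.
  have vv : - v h1 <= 3 * (pi / 2).
    rewrite leNgt; apply/negP => k; have := @dn _ _ _ k; rewrite -/(Z _) v3.
    by move=> /(_ ltac:(lra) ltac:(lra)); rewrite gt_max ltxx andbF.
  have up' : u h1 < pi.
    by rewrite lt_neqAle u2 andbT; apply: contraTneq h1p => k; rewrite -u3 k ltxx.
  by rewrite subr_gt0; apply: dX' => //; lra.
have [/andP[ua ub] uc] := uP (Y 0) (introT andP (conj (lexx _) (ltW Y0p))).
have [/andP[va vb] vc] := vP (Y 0) (introT andP (conj (lexx _) (ltW Y0p))).
have u0 : u (Y 0) = 0.
  apply/eqP; rewrite eq_le ua andbT leNgt; apply/negP => k.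
  by have := up _ _ (lexx 0) k ub; rewrite uc ltxx.
have v0 : v (Y 0) = - (2 * pi).
  apply/eqP; rewrite eq_le va andbT leNgt; apply/negP => k.
  by have := upZ _ _ (lexx _) k vb; rewrite vc Za ltxx.
have w0 : w (Y 0) < 0 by rewrite /w u0 v0 opprK subr_lt0.
have cw : {within `[Y 0, h1], continuous w}.
  apply: (@continuous_subspaceW _ _ _ `[Y 0, Y pi]).
    by move=> x /=; rewrite !in_itv /= => /andP[-> /= k]; rewrite (le_trans k)// ltW.
  move=> x; apply: cvgB.
    by apply: continuous_comp; [exact: cu|exact: cX].
  by apply: continuous_comp; [apply: cvgN; exact: cv|exact: cX].
have [||h] := @IVT R w (Y 0) h1 0 _ cw.
- exact: ltW.
- by rewrite ge_min le_max (ltW w0) (ltW w1) orbT.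
rewrite in_itv /= => /andP[hY hh] /eqP; rewrite subr_eq0 => /eqP wh.
have hp : h < Y pi := le_lt_trans hh h1p.
have h0 : Y 0 < h.
  by rewrite lt_neqAle hY andbT; apply: contraTneq w0 => ->; rewrite /w wh subrr ltxx.
have [/andP[k1 k2] k3] := uP h (introT andP (conj hY (ltW hp))).
have [/andP[l1 l2] l3] := vP h (introT andP (conj hY (ltW hp))).
exists (u h), (- v h); split=> //.
- by rewrite lt_neqAle k1 andbT; apply: contraTneq h0 => k; rewrite -k3 -k ltxx.
- have : u h < pi by rewrite lt_neqAle k2 andbT; apply: contraTneq hp => k; rewrite -k3 k ltxx.
  by lra.
- have : - (2 * pi) < v h.
    by rewrite lt_neqAle l1 andbT; apply: contraTneq h0 => k; rewrite -l3 -k Za ltxx.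
  by lra.
- by rewrite k3 -[LHS]l3.
Qed.

(** The curve is parametrized by its tangent angle t, and T is the total
    turning.  E and D are the components along the tangent and the normal of
    the displacement over one full turn; D' = - E.  Where D vanishes, E > 0
    would give a crossing by loop_crossing and E = 0 a double point, so every
    zero of D is an upcrossing.  But D is nonnegative at the lowest point m and
    nonpositive at the parameter m - 2 pi + T > m. *)
Lemma no_spiral (R : realType) (c1 c2 r : R -> R) (T : R) :
  (forall t, is_derive t (1 : R) c1 (r t * cos t)) ->
  (forall t, is_derive t (1 : R) c2 (r t * sin t)) ->
  (forall t, 0 < r t) ->
  (forall t, c1 (t + T) = c1 t) -> (forall t, c2 (t + T) = c2 t) ->
  cos T = 1 -> sin T = 0 ->
  (forall t u, t < u -> u < t + T -> c1 t = c1 u -> c2 t = c2 u -> False) ->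
  2 * pi < T -> False.
Proof.
move=> d1 d2 r0 p1 p2 cT sT inj T2; have pp := twopi_gt0 R.
have T0 : 0 < T := lt_trans pp T2.
pose D t := cos t * (c2 (t + 2 * pi) - c2 t) - sin t * (c1 (t + 2 * pi) - c1 t).
pose E t := cos t * (c1 (t + 2 * pi) - c1 t) + sin t * (c2 (t + 2 * pi) - c2 t).
have dc1 t := dv_D (dv_shift (d1 (t + 2 * pi))) (dv_N (d1 t)).
have dc2 t := dv_D (dv_shift (d2 (t + 2 * pi))) (dv_N (d2 t)).
have dD t : is_derive t (1 : R) D (- E t).
  apply: (dv_eq (dv_D (dv_M (dv_cos (dv_id t)) (dc2 t)) (dv_N (dv_M (dv_sin (dv_id t)) (dc1 t))))).
  rewrite /E sinD2piE cosD2piE.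
  by move: (c1 _) (c1 t) (c2 _) (c2 t) (r _) (r t) (cos t) (sin t) => *; ring.
have up t : D t = 0 -> 0 < - E t.
  move=> Dt; rewrite oppr_gt0 lt_neqAle; apply/andP; split.
    apply/eqP => Et.
    have e1 : c1 (t + 2 * pi) - c1 t = 0.
      transitivity ((c1 (t + 2 * pi) - c1 t) * (cos t ^+ 2 + sin t ^+ 2)); first by rewrite cos2Dsin2 mulr1.
      transitivity (cos t * E t - sin t * D t); first by rewrite /E /D; move: (c1 _) (c1 t) (c2 _) (c2 t) (cos t) (sin t) => *; ring.
      by rewrite Et Dt !mulr0 subrr.
    have e2 : c2 (t + 2 * pi) - c2 t = 0.
      transitivity ((c2 (t + 2 * pi) - c2 t) * (cos t ^+ 2 + sin t ^+ 2)); first by rewrite cos2Dsin2 mulr1.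
      transitivity (sin t * E t + cos t * D t); first by rewrite /E /D; move: (c1 _) (c1 t) (c2 _) (c2 t) (cos t) (sin t) => *; ring.
      by rewrite Et Dt !mulr0 addr0.
    by apply: (inj t (t + 2 * pi)); [lra|lra|apply/esym/eqP; rewrite -subr_eq0 e1|apply/esym/eqP; rewrite -subr_eq0 e2].
  rewrite leNgt; apply/negP => Et.
  pose X b := cos t * c1 (b + t) + sin t * c2 (b + t).
  pose Y b := - sin t * c1 (b + t) + cos t * c2 (b + t).
  have dX b : is_derive b (1 : R) X (r (b + t) * cos b).
    apply: (dv_eq (dv_D (dv_M (dv_cst _ _) (dv_shift (d1 (b + t)))) (dv_M (dv_cst _ _) (dv_shift (d2 (b + t)))))).
    have -> : cos b = cos (b + t) * cos t + sin (b + t) * sin t by rewrite -cosB addrK.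
    move: (c1 _) (c2 _) (r _) (cos t) (sin t) (cos _) (sin _) => *; ring.
  have dY b : is_derive b (1 : R) Y (r (b + t) * sin b).
    apply: (dv_eq (dv_D (dv_M (dv_cst _ _) (dv_shift (d1 (b + t)))) (dv_M (dv_cst _ _) (dv_shift (d2 (b + t)))))).
    have -> : sin b = sin (b + t) * cos t - cos (b + t) * sin t by rewrite -sinB addrK.
    move: (c1 _) (c2 _) (r _) (cos t) (sin t) (cos _) (sin _) => *; ring.
  have [|||b1 [b2 [b10 b12 b2p eX eY]]] := loop_crossing dX dY.
  - by move=> b; exact: r0.
  - apply/eqP; rewrite -subr_eq0; apply/eqP; rewrite -[RHS]Dt /Y /D add0r [2 * pi + t]addrC.
    by move: (c1 _) (c1 t) (c2 _) (c2 t) (cos t) (sin t) => *; ring.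
  - rewrite -subr_gt0; move: Et; rewrite /E /X add0r [2 * pi + t]addrC.
    by move: (c1 _) (c1 t) (c2 _) (c2 t) (cos t) (sin t) => ? ? ? ? ? ? h; apply: (lt_le_trans h); lra.
  apply: (inj (b1 + t) (b2 + t)).
  - by rewrite ltrD2r.
  - by lra.
  - transitivity (c1 (b1 + t) * (cos t ^+ 2 + sin t ^+ 2)); first by rewrite cos2Dsin2 mulr1.
    transitivity (cos t * X b1 - sin t * Y b1); first by rewrite /X /Y; move: (c1 _) (c2 _) (cos t) (sin t) => *; ring.
    rewrite eX eY; transitivity (c1 (b2 + t) * (cos t ^+ 2 + sin t ^+ 2)); last by rewrite cos2Dsin2 mulr1.
    by rewrite /X /Y; move: (c1 _) (c2 _) (cos t) (sin t) => *; ring.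
  - transitivity (c2 (b1 + t) * (cos t ^+ 2 + sin t ^+ 2)); first by rewrite cos2Dsin2 mulr1.
    transitivity (sin t * X b1 + cos t * Y b1); first by rewrite /X /Y; move: (c1 _) (c2 _) (cos t) (sin t) => *; ring.
    rewrite eX eY; transitivity (c2 (b2 + t) * (cos t ^+ 2 + sin t ^+ 2)); last by rewrite cos2Dsin2 mulr1.
    by rewrite /X /Y; move: (c1 _) (c2 _) (cos t) (sin t) => *; ring.
(* At the lowest point m the tangent is horizontal, so D m is a height above
   the minimum, and D one loop earlier is the opposite of such a height. *)
have cc2 : continuous c2 by move=> t; exact: dv_ct (d2 t).
have [m _ mmin] := @EVT_min R c2 0 T (ltW T0) (continuous_subspaceT cc2).
have low t : c2 m <= c2 t.
  pose k := Num.floor (t / T).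
  have /andP[k1 k2] := floor_itv (t / T); rewrite -/k in k1 k2.
  rewrite ler_pdivlMr// in k1; rewrite ltr_pdivrMr// intrD mulrDl mul1r in k2.
  rewrite -[c2 t](periodic_int p2 (- k)); apply: mmin.
  by rewrite in_itv /= mulrNz mulNr; apply/andP; split; lra.
have sm : sin m = 0.
  have /eqP := min_dv0 d2 low; rewrite mulf_eq0 (gt_eqF (r0 m)) /=.
  by move/eqP.
have cm : 0 < cos m.
  (* otherwise c2 decreases just after m *)
  rewrite ltNge; apply/negP => cm.
  have c1m : cos m = -1.
    have := sin0cos1 sm; rewrite ler0_norm// => h.
    by rewrite -[cos m]opprK h.
  have p0 := pi_gt0 R.
  have : c2 (m + 1) < c2 m.
    have mm : m < m + 1 by rewrite ltrDl.
    apply: (dv_decr mm (fun t _ => d2 t)).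
    move=> t /andP[t1 t2]; rewrite pmulr_rlt0//.
    rewrite -[t](subrK m) sinD sm c1m mulr0 addr0 mulrN1 oppr_lt0.
    apply: sin_gt0_pi; have := pi_ge2 R => pi2; apply/andP; split; lra.
  by rewrite ltNge low.
have c1m : cos m = 1.
  by have := sin0cos1 sm; rewrite gtr0_norm.
have Dm : 0 <= D m.
  by rewrite /D sm c1m mul0r subr0 mul1r subr_ge0.
have De : D (m - 2 * pi + T) <= 0.
  have -> : D (m - 2 * pi + T) = D (m - 2 * pi).
    have cTT t : cos (t + T) = cos t by rewrite cosD cT sT mulr1 mulr0 subr0.
    have sTT t : sin (t + T) = sin t by rewrite sinD cT sT mulr1 mulr0 addr0.
    rewrite /D cTT sTT p1 p2.
    rewrite (_ : m - 2 * pi + T + 2 * pi = m - 2 * pi + 2 * pi + T); last by ring.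
    by rewrite p1 p2.
  rewrite /D subrK.
  have -> : cos (m - 2 * pi) = 1 by rewrite -cosD2piE subrK.
  have -> : sin (m - 2 * pi) = 0 by rewrite -sinD2piE subrK.
  by rewrite mul0r subr0 mul1r subr_le0.
by apply: (no_upcrossing _ dD up Dm De); lra.
Qed.

(** Half of t lies where the sine is positive. *)
Lemma cos_lt1 (R : realType) (t : R) : 0 < t < 2 * pi -> cos t < 1.
Proof.
move=> /andP[t0 t2]; have -> : t = (t / 2) *+ 2 by rewrite -mulr_natr divfK// pnatr_eq0.
have s0 : 0 < sin (t / 2) by apply: sin_gt0_pi; apply/andP; split; lra.
rewrite cos_mulr2n cos2sin2.
have s2 : 0 < sin (t / 2) ^+ 2 by rewrite exprn_gt0.
lra.
Qed.

(** 1 - cos (t - u) serves below as a smooth squared distance on the circle. *)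
Lemma circ_cos1 (R : realType) (t u : R) : cos (t - u) = 1 -> circ_eq t u.
Proof.
move=> h; have [v tv /andP[v1 v2]] := circ_window u t.
suff -> : u = v by [].
have cv : cos (v - u) = 1.
  rewrite -h; apply: (@circ_eqP _ _ (fun s => cos (s - u)) t v _ tv) => s.
  by rewrite -[RHS]cosD2piE; congr cos; ring.
apply/esym/eqP; rewrite eq_le v1 andbT leNgt; apply/negP => uv.
have := @cos_lt1 R (v - u); rewrite cv ltxx => k.
by have : false by apply: k; apply/andP; split; lra.
Qed.

(** The turning T over one period satisfies cos T = 1, the tangent being
    periodic, so T >= 2 pi; it cannot be larger by no_spiral. *)
Lemma table_angle (R : realType) (g : table R) :
  exists th rho dth : R -> R,
    [/\ forall t, is_derive t (1 : R) th (dth t),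
        forall t, 0 < dth t,
        forall t, 0 < rho t,
        forall t, derive1 g t = (rho t * cos (th t), rho t * sin (th t)) &
        forall t, th (t + 2 * pi) = th t + 2 * pi].
Proof.
have sg := @table_smooth R g; have pg := @table_periodic R g.
have [th [rho [dth rho0 gth]]] := tangent_angle sg (@table_regular R g).
pose d t := det2 (derive1 g t) (derive1 (derive1 g) t) /
                 ((derive1 g t).1 ^+ 2 + (derive1 g t).2 ^+ 2).
have {}dth t : is_derive t (1 : R) th (d t) by exact: dth.
have d0 t : 0 < d t.
  by rewrite divr_gt0 ?table_det_gt0// speed_gt0// table_regular.
have pg1 := derive1_periodic pg; have pg2 := derive1_periodic pg1.
have pd t : d (t + 2 * pi) = d t by rewrite /d pg1 pg2.
move: d d0 dth pd => d d0 dth pd.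
have p0 := twopi_gt0 R.
have cth : continuous th by move=> t; exact: dv_ct (dth t).
have mth t u : t < u -> th t < th u.
  by move=> tu; exact: (dv_incr tu (fun s _ => dth s) (fun s _ => d0 s)).
have ith : injective th.
  move=> t u e; have [h|h|//] := ltgtP t u; have := mth _ _ h; by rewrite e ltxx.
pose T := th (2 * pi) - th 0.
have pth t : th (t + 2 * pi) = th t + T.
  have ds s : is_derive s (1 : R) (fun s => th (s + 2 * pi) - th s) 0.
    by apply: (dv_eq (dv_D (dv_shift (dth (s + 2 * pi))) (dv_N (dth s)))); rewrite pd subrr.
  suff : th (t + 2 * pi) - th t = T by move=> <-; rewrite [RHS]addrC subrK.
  rewrite /T -[2 * pi in RHS]add0r; have [h|h] := leP 0 t.
    exact/esym/(@dv_const R (fun s => th (s + 2 * pi) - th s) 0 t h (fun s _ => ds s)).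
  exact: (@dv_const R (fun s => th (s + 2 * pi) - th s) t 0 (ltW h) (fun s _ => ds s)).
have T0 : 0 < T by rewrite subr_gt0 mth.
have [sT cT] : sin T = 0 /\ cos T = 1.
  have := pg1 0; rewrite !gth pth => -[].
  have r0 := rho0 0; have r1 := rho0 (0 + 2 * pi).
  move: (rho 0) (rho (0 + 2 * pi)) (th 0) r0 r1 => a b t a0 b0 e1 e2.
  have s0 : sin T = 0.
    have : b * sin T = 0.
      have -> : b * sin T = cos t * (b * sin (t + T)) - sin t * (b * cos (t + T)).
        transitivity (b * sin ((t + T) - t)); first by rewrite addrC addKr.
        by rewrite sinB; ring.
      by rewrite e1 e2; ring.
    by move/eqP; rewrite mulf_eq0 (gt_eqF b0) => /eqP.
  split=> //; have := sin0cos1 s0; rewrite gtr0_norm//.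
  have : b * cos T = a.
    have -> : b * cos T = cos t * (b * cos (t + T)) + sin t * (b * sin (t + T)).
      transitivity (b * cos ((t + T) - t)); first by rewrite addrC addKr.
      by rewrite cosB; ring.
    rewrite e1 e2; transitivity (a * (cos t ^+ 2 + sin t ^+ 2)); first by ring.
    by rewrite cos2Dsin2 mulr1.
  by move=> e; rewrite -(pmulr_rgt0 _ b0) e.
suff T2 : T = 2 * pi.
  by exists th, rho, d; split=> // t; rewrite pth T2.
(* Reparametrized by the tangent angle, the boundary meets the hypotheses of
   no_spiral with period T. *)
have /choice [ta ta1] : forall a, exists t, th t = a.
  move=> a; pose k := Num.floor ((a - th 0) / T).
  have /andP[k1 k2] := floor_itv ((a - th 0) / T); rewrite -/k in k1 k2.
  rewrite ler_pdivlMr// in k1; rewrite ltr_pdivrMr// intrD mulrDl mul1r in k2.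
  have tk (j : int) : th (j%:~R * (2 * pi)) = th 0 + j%:~R * T.
    have : forall s, (fun s => th s - s / (2 * pi) * T) (s + 2 * pi) = (fun s => th s - s / (2 * pi) * T) s.
      move=> s /=; rewrite pth; have : 2 * pi != 0 :> R by rewrite gt_eqF.
      by move: (th s) (2 * pi) => A P P0; field.
    move=> /periodic_int /(_ j 0) /=; rewrite add0r mul0r mul0r subr0 mulfK ?gt_eqF//.
    by move=> <-; rewrite subrK.
  have [||t _ <-] := @ivt R th (k%:~R * (2 * pi)) ((k + 1)%:~R * (2 * pi)) a _ cth.
  - by rewrite intrD; move: p0 (k%:~R : R) => h z; lra.
  - by rewrite !tk intrD mulrDl mul1r; apply/orP; left; apply/andP; split; lra.
  - by exists t.
have ta2 t : ta (th t) = t by apply: ith; rewrite ta1.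
have dta a : is_derive a (1 : R) ta (d (ta a))^-1.
  have := @is_derive_inverse R th ta (d (ta a)) (ta a) _ _ (dth _) (lt0r_neq0 (d0 _)).
  by rewrite ta1; apply; near=> x; [exact: ta2|exact: cth].
have tam a b : a < b -> ta a < ta b.
  move=> ab; rewrite ltNge; apply/negP; rewrite le_eqVlt => /orP[/eqP e|/mth].
    by move: ab; rewrite -[a]ta1 -[b]ta1 e ltxx.
  by rewrite !ta1 ltNge (ltW ab).
have tap a : ta (a + T) = ta a + 2 * pi by apply: ith; rewrite ta1 pth ta1.
apply/eqP; rewrite eq_le; apply/andP; split; last first.
  rewrite leNgt; apply/negP => h.
  by have := @cos_lt1 R T; rewrite T0 h cT ltxx => /(_ isT).
rewrite leNgt; apply/negP.
apply: (@no_spiral R (fun a => (g (ta a)).1) (fun a => (g (ta a)).2) (fun a => rho (ta a) * (d (ta a))^-1)) => //.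
- move=> a; apply: (dv_eq (dv_comp (f := fun t => (g t).1) (smooth_dv1 (ta a) sg) (dta a))).
  by rewrite gth /= ta1 mulrAC.
- move=> a; apply: (dv_eq (dv_comp (f := fun t => (g t).2) (smooth_dv2 (ta a) sg) (dta a))).
  by rewrite gth /= ta1 mulrAC.
- by move=> a; rewrite mulr_gt0// invr_gt0.
- by move=> a; rewrite tap pg.
- by move=> a; rewrite tap pg.
move=> a b ab bT e1 e2.
have := @table_inj R g (ta a) (ta b).
rewrite [g (ta a)]surjective_pairing e1 e2 -surjective_pairing => /(_ erefl) ce.
have h1 := tam _ _ ab; have h2 := tam _ _ bT; rewrite tap in h2.
have : ta b = ta a by apply: circ_near => //; rewrite gtr0_norm; lra.
by move=> e; move: h1; rewrite e ltxx.
Unshelve. all: by end_near. Qed.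

(** * Strong convexity *)

Section Convex.
Context (R : realType) (g : table R).

(** The sign of the determinant of two tangents is that of the sine of the
    difference of their angles. *)
Lemma table_tangent_det : exists th rho : R -> R,
  [/\ forall t, 0 < rho t, continuous th, forall t u, t < u -> th t < th u,
      forall t, th (t + 2 * pi) = th t + 2 * pi &
      forall t u, det2 (derive1 g t) (derive1 g u) = rho t * rho u * sin (th u - th t)].
Proof.
have [th [rho [dth [d1 d0 r0 gth pth]]]] := table_angle g.
exists th, rho; split=> //.
- by move=> t; exact: dv_ct (d1 t).
- by move=> t u tu; exact: (dv_incr tu (fun s _ => d1 s) (fun s _ => d0 s)).
move=> t u; rewrite !gth /det2 /= sinB.
by move: (rho _) (rho _) (cos _) (sin _) (cos _) (sin _) => *; ring.
Qed.

(** t^* is the parameter where the tangent angle has increased by pi. *)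
Lemma starP t : [/\ t < star g t < t + 2 * pi,
  det2 (derive1 g t) (derive1 g (star g t)) = 0,
  (forall u, t < u -> u < star g t -> 0 < det2 (derive1 g t) (derive1 g u)) &
  (forall u, star g t < u -> u < t + 2 * pi -> det2 (derive1 g t) (derive1 g u) < 0)].
Proof.
have [th [rho [r0 cth mth pth dE]]] := table_tangent_det.
have p0 := pi_gt0 R.
have tt2 : t < t + 2 * pi by rewrite ltrDl twopi_gt0.
have [||s /andP[s1 s2] ths] := @ivt R th t (t + 2 * pi) (th t + pi) _ cth.
- exact: ltW.
- by rewrite pth; apply/orP; left; apply/andP; split; lra.
have mle x y : x <= y -> th x <= th y.
  by rewrite le_eqVlt => /orP[/eqP -> //|/mth /ltW].
have ts : t < s.
  by rewrite lt_neqAle s1 andbT; apply/eqP => e; move: ths; rewrite -e; lra.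
have st : s < t + 2 * pi.
  by rewrite lt_neqAle s2 andbT; apply/eqP => e; move: ths; rewrite e pth; lra.
have dpos u : t < u -> u < s -> 0 < det2 (derive1 g t) (derive1 g u).
  move=> /mth h1 /mth h2; rewrite dE !mulr_gt0//.
  by apply: sin_gt0_pi; apply/andP; split; lra.
have dneg u : s < u -> u < t + 2 * pi -> det2 (derive1 g t) (derive1 g u) < 0.
  move=> /mth h1 /mth h2; rewrite dE pmulr_rlt0 ?mulr_gt0//.
  by rewrite pth in h2; apply: sin_lt0_pi2pi; apply/andP; split; lra.
have sE : star g t = s.
  rewrite /star; set A := (X in xget _ X).
  have As : A s.
    by split; [rewrite ts st|rewrite dE ths addrC addKr sinpi mulr0].
  have [/andP[h1 h2] h3] : A (xget t A) := xgetI t As.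
  have [h|h|//] := ltgtP (xget t A) s.
    by have := dpos _ h1 h; rewrite h3 ltxx.
  by have := dneg _ h h2; rewrite h3 ltxx.
rewrite sE; split=> //; first by rewrite ts st.
by rewrite dE ths addrC addKr sinpi mulr0.
Qed.

Lemma lt_starP t u : t < u -> u < t + 2 * pi ->
  (u < star g t) = (0 < det2 (derive1 g t) (derive1 g u)).
Proof.
have [/andP[s1 s2] s3 s4 s5] := starP t => tu ut.
apply/idP/idP; first exact: s4.
apply: contraTT; rewrite -leNgt le_eqVlt => /orP[/eqP <-|h]; first by rewrite s3 ltxx.
by rewrite -leNgt ltW// s5.
Qed.

(** The height of g u over the tangent at t increases for u up to t^*, then
    decreases, and vanishes at both ends of the period. *)
Lemma support_lt t u : t < u -> u < t + 2 * pi -> 0 < det2 (derive1 g t) (g u - g t).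
Proof.
move=> tu ut; have [/andP[s1 s2] s3 s4 s5] := starP t.
have dd v := dv_det2r (derive1 g t) (g t) v (@table_smooth R g).
have [us|su] := leP u (star g t).
  have := dv_incr tu (fun v _ => dd v); rewrite subrr det2r0.
  by apply=> v /andP[v1 v2]; apply: s4 => //; exact: lt_le_trans v2 us.
have := dv_decr ut (fun v _ => dd v); rewrite table_periodic subrr det2r0.
by apply=> v /andP[v1 v2]; apply: s5 => //; exact: lt_trans v1.
Qed.

Lemma support_gt0 t u : ~ circ_eq t u -> 0 < det2 (derive1 g t) (g u - g t).
Proof.
move=> tu; have [v uv /andP[v1 v2]] := circ_window t u.
rewrite -(circ_eqP (@table_periodic R g) uv); apply: support_lt => //.
rewrite lt_neqAle v1 andbT; apply/eqP => e; apply: tu; rewrite e; exact: circ_sym.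
Qed.

Lemma support_ge0 t u : 0 <= det2 (derive1 g t) (g u - g t).
Proof.
have [tu|tu] := pselect (circ_eq t u); last exact/ltW/support_gt0.
by rewrite (circ_eqP (@table_periodic R g) tu) subrr det2r0.
Qed.

End Convex.

(** * Distances between points of a table *)

Lemma compact_box (R : realType) n (a b : 'I_n -> R) :
  compact [set v : 'rV[R]_n | forall i, a i <= v ord0 i <= b i].
Proof.
have := @rV_compact R n (fun i => `[a i, b i]%classic) (fun i => @segment_compact R (a i) (b i)).
by congr compact; apply/seteqP; split => v h i; have := h i; rewrite /= in_itv.
Qed.

(** All these functions are continuous and periodic. *)
Lemma table_speed_bounds (R : realType) (g : table R) : exists m M : R,
  [/\ 0 < m, 0 < M, forall t, m <= det2 (derive1 g t) (derive1 (derive1 g) t),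
      forall t, `|derive1 g t| <= M & forall t, `|derive1 (derive1 g) t| <= M].
Proof.
have sg := @table_smooth R g; have pg := @table_periodic R g.
have pg1 := derive1_periodic pg; have pg2 := derive1_periodic pg1.
have s1 := smooth_derive1 sg; have s2 := smooth_derive1 s1.
have [m m0 hm] := periodic_pos (det2_ct s1 s2) (fun t => congr2 (@det2 R) (pg1 t) (pg2 t))
  (@table_det_gt0 R g).
have [M M0 hM] := smooth_bounded_upto 2 sg pg.
by exists m, M; split=> // t; [exact: (hM 1%N t)|exact: (hM 2%N t)].
Qed.

(** Compactness in the pair (t, u - t), the curve being injective. *)
Lemma table_far (R : realType) (g : table R) (d : R) : 0 < d -> d <= pi ->
  exists2 c, 0 < c & forall t u, d <= u - t <= 2 * pi - d -> c <= `|g u - g t|.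
Proof.
move=> d0 dp; have sg := @table_smooth R g; have pg := @table_periodic R g.
have p0 := pi_gt0 R.
(* The coordinates of v are t and u - t. *)
pose F (v : 'rV[R]_2) := `|g (v ord0 ord0 + v ord0 (lift ord0 ord0)) - g (v ord0 ord0)|.
have cF : continuous F.
  have cg : continuous g by exact: smooth_ct.
  move=> v.
  have e0 : {for v, continuous (fun v : 'rV[R]_2 => v ord0 ord0)} by exact: coord_continuous.
  have e1 : {for v, continuous (fun v : 'rV[R]_2 => v ord0 (lift ord0 ord0))} by exact: coord_continuous.
  have c1 := continuous_comp (cvgD e0 e1) (cg (v ord0 ord0 + v ord0 (lift ord0 ord0))).
  have c0 := continuous_comp e0 (cg (v ord0 ord0)).
  exact: (cvg_norm (cvgB (c1 _) c0)).
pose a (i : 'I_2) : R := if i == ord0 then 0 else d.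
pose b (i : 'I_2) : R := if i == ord0 then 2 * pi else 2 * pi - d.
pose B := [set v : 'rV[R]_2 | forall i, a i <= v ord0 i <= b i].
have B0 : B !=set0.
  exists (\row_i a i) => i; rewrite mxE lexx /a /b; case: eqP => _ /=; lra.
have [v] := compact_EVT_min B0 (@compact_box R 2 a b) (continuous_subspaceT cF).
rewrite inE => vB vmin; exists (F v).
  rewrite normr_gt0 subr_eq0; apply/eqP => /table_inj /circ_sym ce.
  have := vB (lift ord0 ord0); rewrite /a /b /= => /andP[h1 h2].
  have := circ_near ce; rewrite [_ + v _ _]addrC addrK gtr0_norm ?(lt_le_trans d0)//.
  by move=> /(_ ltac:(lra)) /eqP; rewrite -subr_eq0 addrK => /eqP h; lra.
move=> t u /andP[h1 h2]; have [t' tt /andP[t0 t1]] := circ_window 0 t.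
have -> : g t = g t' by rewrite (circ_eqP pg tt).
have -> : g u = g (t' + (u - t)).
  apply/esym; apply: circ_eqP pg _; case: tt => k ->; exists k; ring.
pose w : 'rV[R]_2 := \row_i (if i == ord0 then t' else u - t).
have := vmin w; rewrite inE /F !mxE /=; apply=> i; rewrite mxE /a /b.
by case: eqP => _; apply/andP; split; lra.
Qed.

(** q1 vanishes between t and u by Rolle, and M bounds its rate of change. *)
Lemma derivative_small (R : realType) (q q1 q2 : R -> R) (t u M : R) :
  (forall s, is_derive s (1 : R) q (q1 s)) ->
  (forall s, is_derive s (1 : R) q1 (q2 s)) ->
  (forall s, `|q2 s| <= M) -> t != u -> q t = q u -> `|q1 t| <= M * `|u - t|.
Proof.
move=> d0 d1 hM tu e.
have M0 : 0 <= M := le_trans (normr_ge0 _) (hM 0).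
have key a b : a < b -> q a = q b -> exists2 c, a < c < b & q1 c = 0.
  move=> ab eab; have [c cab] := mvt ab (fun s _ => d0 s).
  rewrite eab subrr => /esym/eqP; rewrite mulf_eq0 subr_eq0 (gt_eqF ab) orbF => /eqP.
  by exists c.
have lip a b : a < b -> `|q1 b - q1 a| <= M * (b - a).
  move=> ab; have [x _ ->] := mvt ab (fun s _ => d1 s).
  rewrite normrM (gtr0_norm (_ : 0 < b - a)) ?subr_gt0//.
  by apply: ler_wpM2r => //; rewrite subr_ge0 ltW.
have [ltu|lut|k] := ltgtP t u; last by rewrite k eqxx in tu.
  have [c /andP[c1 c2] pc] := key _ _ ltu e.
  have := lip _ _ c1; rewrite pc sub0r normrN => /le_trans; apply.
  by rewrite gtr0_norm ?subr_gt0// ler_wpM2l// lerB// ltW.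
have [c /andP[c1 c2] pc] := key _ _ lut (esym e).
have := lip _ _ c2; rewrite pc subr0 => /le_trans; apply.
by rewrite ltr0_norm ?subr_lt0// opprB ler_wpM2l// lerB// ltW.
Qed.

(** Injectivity at a scale that depends only on a lower bound of the speed and
    an upper bound of the second derivative, hence stable in the C^2 sense. *)
Lemma locally_injective (R : realType) (h : R -> R * R) (t u m M : R) : smooth h ->
  (forall s, `|derive1 (derive1 h) s| <= M) -> m <= `|derive1 h t| ->
  M * `|u - t| < m -> h t = h u -> t = u.
Proof.
move=> sh hM hm ut e; have s1 := smooth_derive1 sh.
apply/eqP; case: (boolP (t == u)) => // tu.
have M1 s : `|(derive1 (derive1 h) s).1| <= M by apply: le_trans (hM s); exact: norm1_le.
have M2 s : `|(derive1 (derive1 h) s).2| <= M by apply: le_trans (hM s); exact: norm2_le.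
have e1 := congr1 fst e; have e2 := congr1 snd e.
have n1 := derivative_small (fun s => smooth_dv1 s sh) (fun s => smooth_dv1 s s1) M1 tu e1.
have n2 := derivative_small (fun s => smooth_dv2 s sh) (fun s => smooth_dv2 s s1) M2 tu e2.
by have := le_trans hm ((norm_pair_le _ _).2 (conj n1 n2)); rewrite leNgt ut.
Qed.

(** * The interior of a table *)

Lemma det2_ct2 (R : realType) (v w : R * R) : continuous (fun p : R * R => det2 v (p - w)).
Proof.
move=> p; rewrite /det2 /=.
have c1 : {for p, continuous (fun p : R * R => p.1)} by exact: cvg_fst.
have c2 : {for p, continuous (fun p : R * R => p.2)} by exact: cvg_snd.
by apply: cvgB; apply: cvgM; [exact: cvg_cst| |exact: cvg_cst|]; apply: cvgB => //; exact: cvg_cst.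
Qed.

Lemma det2vN (R : realType) (u : R * R) : det2 u (- u) = 0.
Proof. by rewrite /det2 /=; ring. Qed.

Lemma det2_indep (R : realType) (a b q : R * R) : det2 a b != 0 ->
  det2 a q = 0 -> det2 b q = 0 -> q = 0.
Proof.
case: a b q => [a1 a2] [b1 b2] [q1 q2]; rewrite /det2 /= => d0.
move=> /eqP; rewrite subr_eq0 => /eqP e1 /eqP; rewrite subr_eq0 => /eqP e2.
have k1 : (a1 * b2 - a2 * b1) * q1 = 0.
  transitivity (a1 * (b2 * q1) - b1 * (a2 * q1)); first by ring.
  by rewrite -e1 -e2; ring.
have k2 : (a1 * b2 - a2 * b1) * q2 = 0.
  transitivity (b2 * (a1 * q2) - a2 * (b1 * q2)); first by ring.
  by rewrite e1 e2; ring.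
by move: k1 k2 => /eqP + /eqP; rewrite !mulf_eq0 (negbTE d0) => /eqP -> /eqP ->.
Qed.

Section Interior.
Context (R : realType) (g : table R).

Let H := [set p : R * R | forall t, 0 < det2 (derive1 g t) (p - g t)].

Lemma det2_curve_ct p : continuous (fun t => det2 (derive1 g t) (p - g t)).
Proof.
have sg := @table_smooth R g.
have := det2_ct (smooth_derive1 sg) (smooth_sub (smooth_cst (c := p)) sg).
exact.
Qed.

(** Periodicity turns the strict inequality into a uniform one. *)
Lemma inside_margin p : H p -> exists2 m, 0 < m & forall t, m <= det2 (derive1 g t) (p - g t).
Proof.
move=> Hp; apply: periodic_pos Hp; first exact: det2_curve_ct.
by move=> t; rewrite table_periodic derive1_periodic//; exact: table_periodic.
Qed.

(** The tangent angle takes every value modulo 2 pi. *)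
Lemma direction_reached (a : R) : exists t k : R, 0 < k /\ derive1 g t = (k * cos a, k * sin a).
Proof.
have [th [rho [dth [d1 d0 r0 gth pth]]]] := table_angle g.
have [b [k ab] /andP[b1 b2]] := circ_window (th 0) a.
have cth : continuous th by move=> t; exact: dv_ct (d1 t).
have [||t _ tht] := @ivt R th 0 (0 + 2 * pi) b _ cth.
- by rewrite add0r ltW// twopi_gt0.
- by rewrite pth; apply/orP; left; rewrite b1 ltW.
exists t, (rho t); split=> //; rewrite gth tht ab.
by congr (_ * _, _ * _); [exact: (periodic_int (@cosD2piE R))|exact: (periodic_int (@sinD2piE R))].
Qed.

(** The tangents parallel to the axes enclose the region in a box. *)
Lemma inside_bounded : exists M : R, forall p, H p -> `|p| <= M.
Proof.
have [M M0 hM] := smooth_bounded 0 (@table_smooth R g) (@table_periodic R g).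
have b t : `|(g t).1| <= M /\ `|(g t).2| <= M by apply/norm_pair_le; exact: hM.
have bb t : [/\ - M <= (g t).1, (g t).1 <= M, - M <= (g t).2 & (g t).2 <= M].
  by have [] := b t; rewrite !ler_norml => /andP[-> ->] /andP[-> ->].
exists M => p Hp.
have [t0 [k0 [k00 e0]]] := direction_reached 0.
have [t1 [k1 [k10 e1]]] := direction_reached (pi / 2).
have [t2 [k2 [k20 e2]]] := direction_reached pi.
have [t3 [k3 [k30 e3]]] := direction_reached (- (pi / 2)).
have := Hp t0; rewrite e0 /det2 /= cos0 sin0 mulr1 mulr0 mul0r subr0 pmulr_rgt0// => h0.
have := Hp t1; rewrite e1 /det2 /= cos_pihalf sin_pihalf mulr0 mul0r sub0r mulr1 oppr_gt0 pmulr_rlt0// => h1.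
have := Hp t2; rewrite e2 /det2 /= cospi sinpi mulr0 mul0r subr0 mulrN1 mulNr oppr_gt0 pmulr_rlt0// => h2.
have := Hp t3; rewrite e3 /det2 /= cosN sinN cos_pihalf sin_pihalf mulr0 mul0r sub0r mulrN1 mulNr opprK pmulr_rgt0// => h3.
have [a1 a2 a3 a4] := bb t0; have [b1 b2 b3 b4] := bb t1.
have [c1 c2 c3 c4] := bb t2; have [d1 d2 d3 d4] := bb t3.
move: (g t0) (g t1) (g t2) (g t3) a1 a2 a3 a4 b1 b2 b3 b4 c1 c2 c3 c4 d1 d2 d3 d4 h0 h1 h2 h3 => u0 u1 u2 u3 *.
by apply/norm_pair_le; rewrite !ler_norml; split; apply/andP; split; lra.
Qed.

Lemma inside_open : open H.
Proof.
rewrite openE => p Hp; have [m m0 hm] := inside_margin Hp.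
have [_ [M [_ M0 _ hM _]]] := table_speed_bounds g.
have e0 : 0 < m / (2 * M + 1) by rewrite divr_gt0// addr_gt0// mulr_gt0.
apply/nbhs_ballP; exists (m / (2 * M + 1)) => // q; rewrite -ball_normE /= => pq t.
have -> : det2 (derive1 g t) (q - g t) = det2 (derive1 g t) (p - g t) - det2 (derive1 g t) (p - q).
  by rewrite -det2Br; congr det2; rewrite opprB [RHS]addrC addrA subrK.
have k1 := hm t; have k2 := det2_le (derive1 g t) (p - q).
have k3 : 2 * `|derive1 g t| * `|p - q| < m.
  apply: (@le_lt_trans _ _ ((2 * M + 1) * `|p - q|)).
    by apply: ler_wpM2r => //; have := hM t; lra.
  by rewrite mulrC -ltr_pdivlMr// addr_gt0// mulr_gt0.
have := ler_norm (det2 (derive1 g t) (p - q)).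
by move: (det2 _ _) (det2 _ _) k1 k2 k3 => x y; lra.
Qed.

(** If the determinant vanished at t, it would be minimal there, so its
    derivative, the determinant of g''(t) and p - g t, would vanish too; as g'
    and g'' are independent, p would be g t. *)
Lemma inside_closed_off_curve p : ~ range g p ->
  (forall t, 0 <= det2 (derive1 g t) (p - g t)) -> H p.
Proof.
move=> pg h t; rewrite lt_neqAle h andbT eq_sym; apply/eqP => e.
have sg := @table_smooth R g; have s1 := smooth_derive1 sg.
apply: pg; exists t => //.
have dd s : is_derive s (1 : R) (fun s => det2 (derive1 g s) (p - g s)) (det2 (derive1 (derive1 g) s) (p - g s)).
  have q1 : is_derive s (1 : R) (fun s => (p - g s).1) (- derive1 g s).1.
    by apply: (dv_eq (dv_D (dv_cst _ _) (dv_N (smooth_dv1 s sg)))); rewrite add0r.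
  have q2 : is_derive s (1 : R) (fun s => (p - g s).2) (- derive1 g s).2.
    by apply: (dv_eq (dv_D (dv_cst _ _) (dv_N (smooth_dv2 s sg)))); rewrite add0r.
  have K := dv_det2 (smooth_dv1 s s1) (smooth_dv2 s s1) q1 q2.
  exact: (dv_eq K (etrans (congr1 (+%R _) (det2vN _)) (addr0 _))).
have e2 : det2 (derive1 (derive1 g) t) (p - g t) = 0.
  by apply: (min_dv0 dd) => s; rewrite [X in X <= _]e; exact: h.
have := det2_indep (lt0r_neq0 (table_det_gt0 g t)) e e2.
by move/eqP; rewrite subr_eq0 => /eqP.
Qed.

(** Off the curve the region left of all tangents is both open and closed. *)
Lemma inside_connected_component p : H p -> connected_component (~` range g) p `<=` H.
Proof.
move=> Hp; set C := connected_component _ _.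
have HC : H `<=` ~` range g.
  by move=> q Hq [t _ gt]; have := Hq t; rewrite gt subrr det2r0 ltxx.
have cC : connected C by exact: component_connected.
have CH : C `&` H = C.
  apply: cC.
  - by exists p; split=> //; apply: connected_component_refl; exact: HC.
  - by exists H => //; exact: inside_open.
  exists [set q | forall t, 0 <= det2 (derive1 g t) (q - g t)].
    rewrite [X in closed X](_ : _ = \bigcap_t [set q | 0 <= det2 (derive1 g t) (q - g t)]); last first.
      by apply/seteqP; split => q h t; [move=> _; exact: h|exact: (h t I)].
    apply: closed_bigI => t _.
    have /closed_comp := @closed_ge R 0; apply=> q _; exact: det2_ct2.
  apply/seteqP; split=> q [Cq Hq]; split=> //; first by move=> t; exact/ltW/Hq.
  by apply: inside_closed_off_curve => //; exact: (connected_component_sub Cq).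
by rewrite -CH => q [].
Qed.

Lemma inside_table_interior p : H p -> table_interior g p.
Proof.
move=> Hp; split.
  by move=> [t _ gt]; have := Hp t; rewrite gt subrr det2r0 ltxx.
have [M hM] := inside_bounded.
exists M; split; first exact: num_real.
move=> M' MM' q /= Cq; apply: le_trans (ltW MM'); apply: hM.
exact: inside_connected_component Cq.
Qed.

(** A point on the wrong side of a tangent can escape to infinity along the
    outer normal without meeting the curve. *)
Lemma table_interior_inside p : table_interior g p -> H p.
Proof.
move=> [pg pb] t; rewrite ltNge; apply/negP => dp.
(* the outer normal *)
pose n : R * R := ((derive1 g t).2, - (derive1 g t).1).
have n0 : det2 (derive1 g t) n < 0.
  rewrite /det2 /= mulrN -opprD oppr_lt0 -!expr2.
  by apply: speed_gt0; exact: table_regular.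
pose A := (fun s : R => p + s *: n) @` [set s | 0 <= s].
have sA : A `<=` ~` range g.
  move=> _ [s /= s0 <-] [u _ gu].
  have := support_ge0 g t u; rewrite gu -addrA addrCA addrC det2Dr det2Zr.
  have [s00|sp] := eqVneq s 0.
    by move=> _; apply: pg; exists u => //; rewrite gu s00 scale0r addr0.
  have s1 : 0 < s by rewrite lt_neqAle eq_sym sp.
  by rewrite leNgt => /negP; apply; have := nmulr_llt0 s n0; rewrite s1 => h; lra.
have cA : connected A.
  apply: connected_continuous_connected.
    apply/connected_intervalP => x y /= x0 y0 z /andP[xz zy].
    exact: le_trans x0 xz.
  apply: continuous_subspaceT => s; apply: cvgD; first exact: cvg_cst.
  by apply: cvgZr_tmp; exact: cvg_id.
have Ap : A p by exists 0; rewrite /= ?lexx// scale0r addr0.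
have AC := connected_component_max Ap sA cA.
have [M M0 hM] := ex_strict_bound_gt0 pb.
have nn : 0 < `|n|.
  by rewrite normr_gt0; apply/eqP => e; move: n0; rewrite e det2r0 ltxx.
pose s := (M + `|p|) / `|n|.
have s0 : 0 <= s by rewrite divr_ge0// addr_ge0// ltW.
have /hM /= : connected_component (~` range g) p (p + s *: n) by apply: AC; exists s.
rewrite ltNge => /negP; apply.
have -> : M = `|s *: n| - `|p|.
  by rewrite normrZ ger0_norm// /s divfK ?gt_eqF// addrK.
rewrite -[X in X - _]/(`|s *: n|) lerBlDl -[X in `|X| <= _](addKr p).
by apply: le_trans (ler_normD _ _) _; rewrite normrN.
Qed.

End Interior.

(** * Small perturbations of tables *)

Lemma curve_jets (R : realType) (g f : R -> R * R) (t : R) : smooth g -> smooth f ->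
  derive1 (fun s => g s + f s) t = derive1 g t + derive1 f t /\
  derive1 (derive1 (fun s => g s + f s)) t = derive1 (derive1 g) t + derive1 (derive1 f) t.
Proof.
move=> sg sf; split.
  exact: (congr1 (fun F => F t) (derive1n_add 1 sg sf)).
exact: (congr1 (fun F => F t) (derive1n_add 2 sg sf)).
Qed.

(** The constant comes from d^2 <= d. *)
Lemma det2_close (R : realType) (a b u v : R * R) (d M : R) : 0 <= M -> 0 <= d -> d <= 1 ->
  `|a| <= M -> `|b| <= M -> `|u| <= d -> `|v| <= d ->
  `|det2 (a + u) (b + v) - det2 a b| <= (4 * M + 2) * d.
Proof.
move=> M0 d0 d1 aM bM ud vd.
have -> : det2 (a + u) (b + v) - det2 a b = det2 a v + (det2 u b + det2 u v).
  by rewrite det2Dl !det2Dr; ring.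
have k1 : `|det2 a v| <= 2 * M * d.
  apply: le_trans (det2_le _ _) _; rewrite -!mulrA ler_wpM2l//; exact: ler_pM.
have k2 : `|det2 u b| <= 2 * M * d.
  apply: le_trans (det2_le _ _) _; rewrite -!mulrA ler_wpM2l// mulrC; exact: ler_pM.
have k3 : `|det2 u v| <= 2 * d.
  apply: le_trans (det2_le _ _) _; rewrite -!mulrA ler_wpM2l//.
  by rewrite -[leRHS]mulr1; apply: ler_pM => //; exact: le_trans d1.
apply: le_trans (ler_normD _ _) _; apply: le_trans (lerD k1 (ler_normD _ _)) _.
by apply: le_trans (lerD (lexx _) (lerD k2 k3)) _; rewrite le_eqVlt; apply/orP; left; apply/eqP; ring.
Qed.

(** Positivity of the curvature and regularity are C^2-open.  For
    injectivity, points at parameter distance less than d are separated by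
    locally_injective, and the others stay at positive distance. *)
Lemma table_perturb (R : realType) (g : table R) : exists2 d : R, 0 < d &
  forall f : R -> R * R, smooth f -> (forall t, f (t + 2 * pi) = f t) ->
    (forall j t, (j <= 2)%N -> `|derive1n j f t| <= d) ->
  exists h : table R, forall t, h t = g t + f t.
Proof.
have sg := @table_smooth R g; have pg := @table_periodic R g.
have [m [M [m0 M0 gm gM1 gM2]]] := table_speed_bounds g.
have p0 := pi_gt0 R; have p20 := twopi_gt0 R.
pose m1 := m / (4 * (M + 1)).
have m10 : 0 < m1 by rewrite divr_gt0// mulr_gt0// addr_gt0.
have aux (z : R) : m / 2 <= 2 * z * (M + 1) -> m <= z * (4 * (M + 1)) by lra.
(* Below this parameter distance locally_injective applies to g + f. *)
pose d := Num.min pi (m1 / (2 * (M + 1))).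
have d0 : 0 < d by rewrite lt_min p0 divr_gt0// mulr_gt0// addr_gt0.
have dp : d <= pi by rewrite ge_min lexx.
have dm : (M + 1) * d < m1.
  apply: (@le_lt_trans _ _ (m1 / 2)); last by lra.
  apply: (@le_trans _ _ ((M + 1) * (m1 / (2 * (M + 1))))).
    by apply: ler_wpM2l; [rewrite addr_ge0// ltW|rewrite ge_min lexx orbT].
  have : M + 1 != 0 by rewrite gt_eqF// addr_gt0.
  by move: (M + 1) {d d0 dp} m1 m10 => N z _ N0; rewrite le_eqVlt; apply/orP; left; apply/eqP; field.
have [c c0 far] := table_far g d0 dp.
pose e := Num.min 1 (Num.min (m / (8 * M + 4)) (c / 4)).
have den : 0 < 8 * M + 4 by lra.
have e0 : 0 < e by rewrite !lt_min ltr01 !divr_gt0.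
have e1 : e <= 1 by rewrite ge_min lexx.
have em : (8 * M + 4) * e <= m.
  by rewrite mulrC -ler_pdivlMr// !ge_min lexx !orbT.
have ec : e <= c / 4 by rewrite !ge_min lexx !orbT.
have ee : e + e < c by lra.
exists e => // f sf pf fe.
pose h t := g t + f t.
have sh : smooth h by exact: (smooth_add sg sf).
have ph t : h (t + 2 * pi) = h t by rewrite /h pg pf.
have f0 t : `|f t| <= e by exact: (fe 0%N t).
have f1 t : `|derive1 f t| <= e by exact: (fe 1%N t).
have f2 t : `|derive1 (derive1 f) t| <= e by exact: (fe 2%N t).
have hdet t : m / 2 <= det2 (derive1 h t) (derive1 (derive1 h) t).
  have [-> ->] := curve_jets t sg sf.
  have := det2_close (ltW M0) (ltW e0) e1 (gM1 t) (gM2 t) (f1 t) (f2 t).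
  rewrite ler_norml => /andP[k _]; have := gm t; move: k em.
  by move: (det2 _ _) (det2 _ _) => x y; lra.
have h2 t : `|derive1 (derive1 h) t| <= M + 1.
  have [_ ->] := curve_jets t sg sf.
  exact: le_trans (ler_normD _ _) (lerD (gM2 t) (le_trans (f2 t) e1)).
have h1 t : m1 <= `|derive1 h t|.
  rewrite ler_pdivrMr ?mulr_gt0 ?addr_gt0//.
  have := le_trans (hdet t) (ler_norm _); move=> /le_trans /(_ (det2_le _ _)).
  have k : 2 * `|derive1 h t| * `|derive1 (derive1 h) t| <= 2 * `|derive1 h t| * (M + 1).
    by apply: ler_wpM2l (h2 t); rewrite mulr_ge0.
  by move=> /le_trans /(_ k); exact: aux.
have hreg t : derive1 h t != 0.
  by apply/eqP => e'; have := h1 t; rewrite e' normr0 leNgt m10.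
have hcur t : 0 < curvature h t.
  by rewrite curvature_gt0//; apply: lt_le_trans (hdet t); rewrite divr_gt0.
have hinj t u : h t = h u -> circ_eq t u.
  move=> htu; have [v uv /andP[v1 v2]] := circ_window t u.
  have htv : h t = h v by rewrite (circ_eqP ph uv).
  suff -> : t = v by exact: circ_sym.
  have loc s : h t = h s -> `|s - t| < d -> t = s.
    move=> hts st; apply: (locally_injective sh h2 (h1 t) _ hts).
    by apply: le_lt_trans dm; apply: ler_wpM2l; [rewrite addr_ge0// ltW|exact: ltW].
  have [vd|vd] := ltP (v - t) d.
    by apply: loc => //; rewrite ger0_norm// subr_ge0.
  have [vd'|vd'] := leP (v - t) (2 * pi - d).
    have := far t v; rewrite vd vd' => /(_ isT).
    have gE s : g s = h s - f s by rewrite addrK.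
    rewrite !gE htv opprB addrC addrA subrK => k1.
    have := le_trans k1 (le_trans (ler_normB _ _) (lerD (f0 t) (f0 v))).
    by rewrite leNgt ee.
  have : t = v - 2 * pi.
    apply: loc; first by rewrite htv -[RHS]ph subrK.
    by rewrite ltr0_norm; lra.
  by lra.
by exists (Table ph sh hinj hreg hcur).
Qed.

(** The interior is described by inequalities that hold with a margin. *)
Lemma interior_perturb (R : realType) (g : table R) (O : R * R) : table_interior g O ->
  exists2 d : R, 0 < d & forall h : table R,
    (forall t, `|h t - g t| <= d) -> (forall t, `|derive1 h t - derive1 g t| <= d) ->
    table_interior h O.
Proof.
move=> /table_interior_inside Og; have [m m0 gm] := inside_margin Og.
have [M1 M10 hM1] := smooth_bounded_upto 1 (@table_smooth R g) (@table_periodic R g).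
pose M := M1 + `|O|.
have M0 : 0 < M by rewrite ltr_pwDl.
have den : 0 < 4 * M + 2 by lra.
pose e := Num.min 1 (m / 2 / (4 * M + 2)).
have e0 : 0 < e by rewrite lt_min ltr01 !divr_gt0.
have e1 : e <= 1 by rewrite ge_min lexx.
have em : (4 * M + 2) * e <= m / 2 by rewrite mulrC -ler_pdivlMr// ge_min lexx orbT.
have aux (x y : R) : - ((4 * M + 2) * e) <= y - x -> m <= x -> 0 < y by lra.
exists e => // h hg0 hg1; apply: inside_table_interior => t.
have k1 : `|derive1 g t| <= M by apply: le_trans (hM1 1%N t isT) _; rewrite lerDl.
have k2 : `|O - g t| <= M.
  by apply: le_trans (ler_normB _ _) _; rewrite addrC lerD//; exact: (hM1 0%N t).
have k3 : `|g t - h t| <= e by rewrite distrC.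
have := det2_close (ltW M0) (ltW e0) e1 k1 k2 (hg1 t) k3.
rewrite [derive1 g t + _]addrC subrK addrA subrK ler_norml => /andP[k _].
exact: aux k (gm t).
Qed.

(** * Differentials from slopes *)

(** The linear map with columns m and n. *)
Definition dmap (R : realType) (m n v : R * R) : R * R := v.1 *: m + v.2 *: n.

Lemma dmap_is_linear (R : realType) (m n : R * R) : linear (dmap m n).
Proof.
by move=> a u v; rewrite /dmap /= !scalerDl scalerDr !scalerA addrACA.
Qed.

HB.instance Definition _ (R : realType) (m n : R * R) :=
  GRing.isLinear.Build R (R * R)%type (R * R)%type *:%R (dmap m n) (dmap_is_linear m n).

Lemma dmap_continuous (R : realType) (m n : R * R) : continuous (dmap m n).
Proof.
move=> v; rewrite /dmap.
have c1 : {for v, continuous (fun p : R * R => p.1)} by exact: cvg_fst.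
have c2 : {for v, continuous (fun p : R * R => p.2)} by exact: cvg_snd.
by apply: cvgD; apply: cvgZr_tmp.
Qed.

(** A function whose increments are combinations of the coordinate increments
    with continuous coefficients is differentiable. *)
Lemma diff_caratheodory (R : realType) (F M N : R * R -> R * R) (p m n : R * R) :
  M x @[x --> p] --> m -> N x @[x --> p] --> n ->
  (\forall q \near p, F q - F p = (q.1 - p.1) *: M q + (q.2 - p.2) *: N q) ->
  'd F p = dmap m n :> (R * R -> R * R).
Proof.
move=> Mm Nn FMN; apply: diff_unique; first exact: dmap_continuous.
apply/eqaddoP => e e0.
have e20 : 0 < e / 2 by rewrite divr_gt0.
suff : \forall q \near p, `|F q - F p - dmap m n (q - p)| <= e * `|q - p|.
  move=> /nbhs_ballP[r /= r0 Hr]; apply/nbhs_ballP; exists r => // h.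
  rewrite -ball_normE /= sub0r normrN => hr.
  have := Hr (h + p); rewrite -ball_normE /= opprD addrCA subrr addr0 normrN addrK.
  by move=> /(_ hr); rewrite -addrA -opprD.
have H1 : \forall q \near p, `|m - M q| <= e / 2 by move/cvgrPdist_le: Mm => /(_ _ e20).
have H2 : \forall q \near p, `|n - N q| <= e / 2 by move/cvgrPdist_le: Nn => /(_ _ e20).
near=> q.
have -> : F q - F p = (q.1 - p.1) *: M q + (q.2 - p.2) *: N q by near: q.
have -> : (q.1 - p.1) *: M q + (q.2 - p.2) *: N q - dmap m n (q - p) =
    (q - p).1 *: (M q - m) + (q - p).2 *: (N q - n).
  by rewrite /dmap opprD addrACA !scalerBr.
apply: le_trans (ler_normD _ _) _; rewrite !normrZ.
have k1 : `|M q - m| <= e / 2 by rewrite distrC; near: q.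
have k2 : `|N q - n| <= e / 2 by rewrite distrC; near: q.
rewrite [e in leRHS]splitr mulrDl; apply: lerD; rewrite mulrC; apply: ler_pM => //; [exact: norm1_le|exact: norm2_le].
Unshelve. all: by end_near. Qed.

(** A derivative as the value of a continuous slope function. *)
Lemma slope (R : realType) (f : R -> R) (t d : R) : is_derive t (1 : R) f d ->
  exists A : R -> R, [/\ forall s, f s - f t = A s * (s - t), {for t, continuous A} & A t = d].
Proof. by move/is_derive1_caratheodory. Qed.

Lemma slope_curve (R : realType) (f : R -> R * R) (t : R) : smooth f ->
  exists A : R -> R * R, [/\ forall s, f s - f t = (s - t) *: A s, {for t, continuous A} & A t = derive1 f t].
Proof.
move=> sf; have [A [A1 A2 A3]] := slope (smooth_dv1 t sf).
have [B [B1 B2 B3]] := slope (smooth_dv2 t sf).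
exists (fun s => (A s, B s)); split.
- move=> s; rewrite [LHS]surjective_pairing /= A1 B1 /GRing.scale /=.
  by congr pair; exact: mulrC.
- exact: (cvg_pair A2 B2).
- by rewrite A3 B3 -surjective_pairing.
Qed.

Lemma diff_caratheodory2 (R : realType) (F : R * R -> R * R)
    (M1 M2 N1 N2 : R * R -> R) (p : R * R) (m1 m2 n1 n2 : R) :
  M1 x @[x --> p] --> m1 -> M2 x @[x --> p] --> m2 ->
  N1 x @[x --> p] --> n1 -> N2 x @[x --> p] --> n2 ->
  (\forall q \near p, F q - F p =
     ((q.1 - p.1) * M1 q + (q.2 - p.2) * N1 q,
      (q.1 - p.1) * M2 q + (q.2 - p.2) * N2 q)) ->
  'd F p = dmap (m1, m2) (n1, n2) :> (R * R -> R * R).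
Proof.
move=> c1 c2 c3 c4 H.
apply: (@diff_caratheodory R F (fun q => (M1 q, M2 q)) (fun q => (N1 q, N2 q)) p (m1, m2) (n1, n2)).
- exact: (cvg_pair c1 c2).
- exact: (cvg_pair c3 c4).
- exact: H.
Qed.

(** * The billiard map and its differential *)

(** The relation between p = (t1, s1) and the next parameter t2, stated with
    determinants only: neither t1^* nor a choice of t2 occurs in it. *)
Definition link (R : realType) (g : R -> R * R) (O p : R * R) (u : R) : Prop :=
  [/\ p.1 < u, u < p.1 + 2 * pi, 0 < det2 (derive1 g p.1) (derive1 g u) &
      p.2 = - det2 (derive1 g p.1) (g u - O)].

Section Billiard.
Context (R : realType) (g : table R) (O : R * R).

Lemma link_lt_star p u : link g O p u -> u < star g p.1.
Proof. by move=> [h1 h2 h3 _]; rewrite lt_starP. Qed.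

(** The derivative of the momentum in the second parameter is minus the
    determinant of the two tangents, negative up to t^*. *)
Lemma momentum_decr t u v : t <= u -> u < v -> v <= star g t ->
  - det2 (derive1 g t) (g v - O) < - det2 (derive1 g t) (g u - O).
Proof.
move=> tu uv vs; have [_ _ s3 _] := starP g t.
have dd x := dv_N (dv_det2r (derive1 g t) O x (@table_smooth R g)).
apply: (dv_decr uv (fun x _ => dd x)) => x /andP[ux xv].
rewrite oppr_lt0; apply: s3; first exact: le_lt_trans ux.
exact: lt_le_trans vs.
Qed.

(** The momentum decreases from its value at t to its value at t^*. *)
Lemma phase_space_link p : phase_space g O p <-> exists u, link g O p u.
Proof.
have [/andP[s1 s2] s3 s4 s5] := starP g p.1.
rewrite /phase_space /= !genL1E; split.
  move=> /andP[h1 h2].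
  have cF : continuous (fun u => - det2 (derive1 g p.1) (g u - O)).
    by move=> u; exact: dv_ct (dv_N (dv_det2r (derive1 g p.1) O u (@table_smooth R g))).
  have [|u /andP[u1 u2] up] := ivt (ltW s1) cF (v := p.2).
    by rewrite (ltW h1) (ltW h2) orbT.
  have pu : p.1 < u.
    by rewrite lt_neqAle u1 andbT; apply/eqP => e; move: h2; rewrite -up e ltxx.
  have us : u < star g p.1.
    by rewrite lt_neqAle u2 andbT; apply/eqP => e; move: h1; rewrite -up e ltxx.
  by exists u; split=> //; [exact: lt_trans us s2|exact: s4].
move=> [u L]; have us := link_lt_star L; case: L => pu _ _ ->.
by rewrite !momentum_decr// ltW.
Qed.

Lemma link_uniq p u v : link g O p u -> link g O p v -> u = v.
Proof.
move=> Lu Lv; have us := link_lt_star Lu; have vs := link_lt_star Lv.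
case: Lu Lv => u1 _ _ eu [v1 _ _ ev].
have [h|h|//] := ltgtP u v.
  by have := momentum_decr (ltW u1) h (ltW vs); rewrite -eu -ev ltxx.
by have := momentum_decr (ltW v1) h (ltW us); rewrite -eu -ev ltxx.
Qed.

Lemma next_param_link p u : link g O p u -> next_param g O p = u.
Proof.
move=> L; have us := link_lt_star L; rewrite /next_param; set A := (X in xget _ X).
have [h1 h2 h3 h4] := L.
have Au : A u by split; [rewrite h1 us|rewrite genL1E].
have [/andP[a1 a2] a3] : A (xget p.1 A) := xgetI p.1 Au.
have [/andP[s1 s2] _ _ _] := starP g p.1.
have Lx : link g O p (xget p.1 A).
  have x2 := lt_trans a2 s2.
  split; [exact: a1|exact: x2|by rewrite -(lt_starP g a1 x2)|by rewrite a3 genL1E].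
exact: (link_uniq Lx L).
Qed.

Lemma billiard_link p u : link g O p u ->
  billiard g O p = (u, det2 (g p.1 - O) (derive1 g u)).
Proof. by move=> L; rewrite /billiard (next_param_link L) genL2E. Qed.

(** Continuity of the implicit function: the momentum condition changes
    sign between u - d and u + d, and this persists for q close to p. *)
Lemma next_param_near p u : link g O p u -> forall e, 0 < e ->
  \forall q \near p, link g O q (next_param g O q) /\ `|u - next_param g O q| < e.
Proof.
move=> L e e0; have us := link_lt_star L; have [u1 u2 u3 u4] := L.
have [/andP[s1 s2] _ s3 _] := starP g p.1.
have sg := @table_smooth R g.
pose d := Num.min (e / 2) (Num.min ((u - p.1) / 2) ((star g p.1 - u) / 2)).
have d0 : 0 < d by rewrite !lt_min !divr_gt0// subr_gt0.
have de : d < e.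
  by apply: (@le_lt_trans _ _ (e / 2)); [rewrite ge_min lexx|rewrite ltr_pdivrMr// mulr_natr mulr2n ltrDl].
have du : d <= (u - p.1) / 2 by rewrite !ge_min lexx orbT.
have ds : d <= (star g p.1 - u) / 2 by rewrite !ge_min lexx !orbT.
have cfst : (fun q : R * R => q.1) @ p --> p.1 by exact: cvg_fst.
have csnd : (fun q : R * R => q.2) @ p --> p.2 by exact: cvg_snd.
have cdet w : (fun q : R * R => det2 (derive1 g q.1) w) @ p --> det2 (derive1 g p.1) w.
  have cw := det2_ct (smooth_derive1 sg) (smooth_cst (c := w)).
  exact: (continuous_comp cfst (cw p.1)).
have k1 : p.1 < u - d by lra.
have k2 : u - d < u by lra.
have k3 : u < u + d by lra.
have k4 : u + d < star g p.1 by lra.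
have k5 : u + d - 2 * pi < p.1 by lra.
have N1 : \forall q \near p, q.1 < u - d by exact: (cvgr_lt _ cfst).
have N2 : \forall q \near p, u + d - 2 * pi < q.1 by exact: (cvgr_gt _ cfst).
have N3 : \forall q \near p, 0 < det2 (derive1 g q.1) (derive1 g (u + d)).
  by apply: (cvgr_gt _ (cdet _)); exact: (s3 _ (lt_trans u1 k3) k4).
have N4 : \forall q \near p, 0 < - det2 (derive1 g q.1) (g (u - d) - O) - q.2.
  apply: (cvgr_gt _ (cvgB (cvgN (cdet _)) csnd)).
  by rewrite subr_gt0 u4; exact: (momentum_decr (ltW k1) k2 (ltW us)).
have N5 : \forall q \near p, - det2 (derive1 g q.1) (g (u + d) - O) - q.2 < 0.
  apply: (cvgr_lt _ (cvgB (cvgN (cdet _)) csnd)).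
  by rewrite subr_lt0 u4; exact: (momentum_decr (ltW u1) k3 (ltW k4)).
near=> q.
have q1 : q.1 < u - d by near: q.
have q2 : u + d - 2 * pi < q.1 by near: q.
have q3 : 0 < det2 (derive1 g q.1) (derive1 g (u + d)) by near: q.
have q4 : q.2 < - det2 (derive1 g q.1) (g (u - d) - O) by rewrite -subr_gt0; near: q.
have q5 : - det2 (derive1 g q.1) (g (u + d) - O) < q.2 by rewrite -subr_lt0; near: q.
have cF : continuous (fun v => - det2 (derive1 g q.1) (g v - O)).
  by move=> v; exact: dv_ct (dv_N (dv_det2r (derive1 g q.1) O v sg)).
have ud := ltW (lt_trans k2 k3).
have [|v /andP[v1 v2] vq] := ivt ud cF (v := q.2).
  by rewrite (ltW q4) (ltW q5) orbT.
have qud : q.1 < u + d := lt_le_trans q1 ud.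
have udq : u + d < q.1 + 2 * pi by rewrite -ltrBlDr.
have vs : v < star g q.1 by apply: (le_lt_trans v2); rewrite lt_starP.
have Lv : link g O q v.
  have [_ _ t3 _] := starP g q.1.
  have qv := lt_le_trans q1 v1.
  split; [exact: qv|exact: le_lt_trans v2 udq|exact: t3 _ qv vs|by rewrite vq].
rewrite (next_param_link Lv); split; first exact: Lv.
apply: (@le_lt_trans _ _ d); last exact: de.
by rewrite ler_distlC v1 v2.
Unshelve. all: by end_near. Qed.

(** Implicit differentiation through slopes: subtracting the two equations that
    define the next parameters gives the increment of the next parameter as a
    combination of the increments of t and s with continuous coefficients. *)
Lemma billiard_diff p u : link g O p u ->
  let l := det2 (derive1 g p.1) (derive1 g u) in
  let a := det2 (derive1 (derive1 g) p.1) (g u - O) in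
  let b := det2 (g p.1 - O) (derive1 (derive1 g) u) in
  'd (billiard g O) p =
    dmap (- a / l, l - b * a / l) (- l^-1, - b / l) :> (R * R -> R * R).
Proof.
have E1 (x y z : R) : x - y * z / x = x + y * (- z / x) by ring.
have E2 (x y : R) : - y / x = y * (- x^-1) by ring.
move=> L l a b; have [u1 u2 l0 u4] := L; rewrite -/l in l0.
have sg := @table_smooth R g; have s1 := smooth_derive1 sg.
have [A [A1 A2 A3]] := slope_curve p.1 s1.
have [G [G1 G2 G3]] := slope_curve p.1 sg.
have [B [B1 B2 B3]] := slope_curve u sg.
have [C [C1 C2 C3]] := slope_curve u s1.
pose f q := next_param g O q.
have fp : f p = u by exact: next_param_link.
have cf : f q @[q --> p] --> u.
  apply/cvgrPdist_lt => e e0; near=> q.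
  have [_] : link g O q (f q) /\ `|u - f q| < e by near: q; exact: next_param_near.
  by [].
have cfst : (fun q : R * R => q.1) @ p --> p.1 by exact: cvg_fst.
have cdet (V W : R * R -> R * R) v w : V @ p --> v -> W @ p --> w ->
    (fun q => det2 (V q) (W q)) @ p --> det2 v w.
  move=> Vv Ww; rewrite /det2.
  have v1 : (fun q => (V q).1) @ p --> v.1.
    by apply: (@cvg_comp _ _ _ V fst (nbhs p) (nbhs v)) => //; exact: cvg_fst.
  have v2 : (fun q => (V q).2) @ p --> v.2.
    by apply: (@cvg_comp _ _ _ V snd (nbhs p) (nbhs v)) => //; exact: cvg_snd.
  have w1 : (fun q => (W q).1) @ p --> w.1.
    by apply: (@cvg_comp _ _ _ W fst (nbhs p) (nbhs w)) => //; exact: cvg_fst.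
  have w2 : (fun q => (W q).2) @ p --> w.2.
    by apply: (@cvg_comp _ _ _ W snd (nbhs p) (nbhs w)) => //; exact: cvg_snd.
  exact: (cvgB (cvgM v1 w2) (cvgM v2 w1)).
have cA : (fun q : R * R => A q.1) @ p --> derive1 (derive1 g) p.1.
  by rewrite -A3; exact: (cvg_comp _ _ cfst A2).
have cG : (fun q : R * R => G q.1) @ p --> derive1 g p.1.
  by rewrite -G3; exact: (cvg_comp _ _ cfst G2).
have cB : (fun q : R * R => B (f q)) @ p --> derive1 g u.
  by rewrite -B3; exact: (cvg_comp _ _ cf B2).
have cC : (fun q : R * R => C (f q)) @ p --> derive1 (derive1 g) u.
  by rewrite -C3; exact: (cvg_comp _ _ cf C2).
have cg : continuous g by exact: smooth_ct.
have cg1 : continuous (derive1 g) by exact: smooth_ct.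
have cgf : (fun q : R * R => g (f q) - O) @ p --> g u - O.
  by apply: cvgB; [exact: (cvg_comp _ _ cf (cg u))|exact: cvg_cst].
have cg1f : (fun q : R * R => derive1 g (f q)) @ p --> derive1 g u.
  exact: (cvg_comp _ _ cf (cg1 u)).
pose al q := det2 (A q.1) (g (f q) - O).
pose be q := det2 (derive1 g p.1) (B (f q)).
have cal : al q @[q --> p] --> a by exact: (cdet _ _ _ _ cA cgf).
have cbe : be q @[q --> p] --> l by exact: (cdet _ _ _ _ (cvg_cst _) cB).
pose mu q := - al q / be q.
pose nu q := - (be q)^-1.
have ln0 : l != 0 by exact: lt0r_neq0.
have cnu : nu q @[q --> p] --> - l^-1 by apply: cvgN; exact: cvgV.
have cmu : mu q @[q --> p] --> - a / l.
  by apply: cvgM; [exact: cvgN|exact: cvgV].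
pose ga q := det2 (G q.1) (derive1 g (f q)).
pose de q := det2 (g p.1 - O) (C (f q)).
have cga : ga q @[q --> p] --> l by exact: (cdet _ _ _ _ cG cg1f).
have cde : de q @[q --> p] --> b by exact: (cdet _ _ _ _ (cvg_cst _) cC).
have cm2 : (fun q => ga q + de q * mu q) @ p --> l + b * (- a / l) by exact: (cvgD cga (cvgM cde cmu)).
have cn2 : (fun q => de q * nu q) @ p --> b * (- l^-1) by exact: (cvgM cde cnu).
rewrite (E1 l b a) (E2 l b); apply: (diff_caratheodory2 cmu cm2 cnu cn2).
have N1 : \forall q \near p, link g O q (f q).
  by near=> q; have [] : link g O q (f q) /\ `|u - f q| < 1 by near: q; exact: next_param_near.
have N2 : \forall q \near p, 0 < be q by exact: (cvgr_gt _ cbe).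
near=> q.
have Lq : link g O q (f q) by near: q.
have bq : 0 < be q by near: q.
have eu : f q - u = (q.1 - p.1) * mu q + (q.2 - p.2) * nu q.
  have e1 : q.2 - p.2 = - ((q.1 - p.1) * al q) - (f q - u) * be q.
    have [_ _ _ ->] := Lq; rewrite u4.
    have -> : - det2 (derive1 g q.1) (g (f q) - O) - - det2 (derive1 g p.1) (g u - O) =
      - det2 (derive1 g q.1 - derive1 g p.1) (g (f q) - O) - det2 (derive1 g p.1) (g (f q) - g u).
      move: (derive1 g q.1) (derive1 g p.1) (g (f q)) (g u) O => [? ?] [? ?] [? ?] [? ?] [? ?].
      by rewrite /det2 /=; ring.
    by rewrite A1 B1 det2Zl det2Zr.
  rewrite e1 /mu /nu; have := lt0r_neq0 bq.
  move: (f q - u) (q.1 - p.1) (al q) (be q) => x y z w w0.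
  by field.
have ew : det2 (g q.1 - O) (derive1 g (f q)) - det2 (g p.1 - O) (derive1 g u) =
    (q.1 - p.1) * ga q + (f q - u) * de q.
  have -> : det2 (g q.1 - O) (derive1 g (f q)) - det2 (g p.1 - O) (derive1 g u) =
    det2 (g q.1 - g p.1) (derive1 g (f q)) + det2 (g p.1 - O) (derive1 g (f q) - derive1 g u).
    move: (g q.1) (g p.1) (derive1 g (f q)) (derive1 g u) O => [? ?] [? ?] [? ?] [? ?] [? ?].
    by rewrite /det2 /=; ring.
  by rewrite G1 C1 det2Zl det2Zr.
rewrite (billiard_link L) (billiard_link Lq).
rewrite [LHS]surjective_pairing /= ew eu; congr pair.
move: (q.1 - p.1) (q.2 - p.2) (ga q) (de q) (mu q) (nu q) => *; ring.
Unshelve. all: by end_near. Qed.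

End Billiard.

(** * Shears and turns in SL(2) *)

Definition mat2 (R : realType) (a b c d : R) : 'M[R]_2 :=
  \matrix_(i, j) (if i == ord0 then if j == ord0 then a else b
                  else if j == ord0 then c else d).

Section Mat2.
Context (R : realType).
Implicit Types a b c d : R.
Let i0 : 'I_2 := ord0.
Let i1 : 'I_2 := lift ord0 ord0.

Lemma ord2E (i : 'I_2) : i = i0 \/ i = i1.
Proof. by case: i => -[|[|//]] Hi; [left|right]; apply: val_inj. Qed.

Lemma mat2E (A : 'M[R]_2) : A = mat2 (A i0 i0) (A i0 i1) (A i1 i0) (A i1 i1).
Proof.
by apply/matrixP => i j; rewrite mxE; case: (ord2E i) => ->; case: (ord2E j) => ->.
Qed.

Lemma mat2_mul a b c d a' b' c' d' : mat2 a b c d *m mat2 a' b' c' d' =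
  mat2 (a * a' + b * c') (a * b' + b * d') (c * a' + d * c') (c * b' + d * d').
Proof.
apply/matrixP => i j; rewrite !mxE big_ord_recl big_ord1 !mxE.
by case: (ord2E i) => ->; case: (ord2E j) => ->.
Qed.

Lemma mat2_inj a b c d a' b' c' d' : mat2 a b c d = mat2 a' b' c' d' ->
  [/\ a = a', b = b', c = c' & d = d'].
Proof.
move=> /matrixP e; have := e i0 i0; have := e i0 i1; have := e i1 i0; have := e i1 i1.
by rewrite !mxE.
Qed.

(** The determinant of a 2 x 2 matrix by its entries, so that identities are
    checked by ring. *)
Definition mdet (A : 'M[R]_2) := A i0 i0 * A i1 i1 - A i0 i1 * A i1 i0.

Lemma mdet_mat2 a b c d : mdet (mat2 a b c d) = a * d - b * c.
Proof. by rewrite /mdet !mxE. Qed.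

Lemma mdetM A B : mdet (A *m B) = mdet A * mdet B.
Proof. by rewrite (mat2E A) (mat2E B) mat2_mul !mdet_mat2; ring. Qed.

Lemma Sp1E (A : 'M[R]_2) : @Sp1 R A <-> mdet A = 1.
Proof.
rewrite /Sp1 /= (mat2E A); move: (A _ _) (A _ _) (A _ _) (A _ _) => d c b a.
have -> : (mat2 a b c d)^T = mat2 a c b d.
  by apply/matrixP => i j; rewrite !mxE; case: (ord2E i) => ->; case: (ord2E j) => ->.
have -> : symplectic_form R = mat2 0 1 (-1) 0.
  by apply/matrixP => i j; rewrite !mxE; case: (ord2E i) => ->; case: (ord2E j) => ->.
rewrite !mat2_mul mdet_mat2; split.
  by move=> /mat2_inj[_ e _ _]; rewrite -e; ring.
by move=> e; congr mat2; [ring|rewrite -[RHS]e; ring|transitivity (- (a * d - b * c)); [ring|by rewrite e]|ring].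
Qed.

Lemma mat2_1 : mat2 1 0 0 1 = 1%:M :> 'M[R]_2.
Proof.
by apply/matrixP => i j; rewrite !mxE; case: (ord2E i) => ->; case: (ord2E j) => ->.
Qed.

(** The inverse of a matrix of determinant 1. *)
Definition madj (A : 'M[R]_2) := mat2 (A i1 i1) (- A i0 i1) (- A i1 i0) (A i0 i0).

Lemma madjK A : mdet A = 1 -> madj A *m A = 1%:M /\ A *m madj A = 1%:M.
Proof.
rewrite (mat2E A) mdet_mat2 /madj !mxE /= -mat2_1 !mat2_mul.
by move: (A _ _) (A _ _) (A _ _) (A _ _) => a b c d e; split; (congr mat2; [rewrite -[RHS]e; ring|ring|ring|rewrite -[RHS]e; ring]).
Qed.

Lemma mdet_adj A : mdet (madj A) = mdet A.
Proof. by rewrite (mat2E A) /madj !mdet_mat2 !mxE /=; ring. Qed.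

Definition shear (x : R) := mat2 1 0 x 1.
(** For the billiard map l is the determinant of the tangents at two
    successive bouncing points. *)
Definition turn (l : R) := mat2 0 (- l^-1) l 0.

Lemma shearD x y : shear x *m shear y = shear (x + y).
Proof. by rewrite mat2_mul; congr mat2; ring. Qed.

Lemma mdet_shear x : mdet (shear x) = 1.
Proof. by rewrite mdet_mat2; ring. Qed.

Lemma mdet_turn l : l != 0 -> mdet (turn l) = 1.
Proof. by move=> l0; rewrite mdet_mat2; field. Qed.

Lemma mx_close (Q W A0 : 'M[R]_2) (d : R) : 0 < d -> exists2 e, 0 < e &
  forall A, ball A0 e A -> forall i j, `|(Q *m A *m W) i j - (Q *m A0 *m W) i j| < d.
Proof.
move=> d0.
pose C := (\sum_i \sum_k `|Q i k|) * (\sum_l \sum_j `|W l j|) + 1.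
have C0 : 0 < C.
  by apply: ltr_wpDl => //; rewrite mulr_ge0//; apply: sumr_ge0 => i _; apply: sumr_ge0.
exists (d / C); first exact: divr_gt0.
move=> A [_ AA] i j.
have -> : (Q *m A *m W) i j - (Q *m A0 *m W) i j = (Q *m (A - A0) *m W) i j.
  by rewrite mulmxBr mulmxBl !mxE.
have le_sum (F : 'I_2 -> R) k : (forall k, 0 <= F k) -> F k <= \sum_k F k.
  by move=> F0; rewrite (bigD1 k)//= lerDl sumr_ge0.
have -> : (Q *m (A - A0) *m W) i j = \sum_l \sum_k Q i k * (A - A0) k l * W l j.
  rewrite mxE; apply: eq_bigr => l _; rewrite mxE mulr_suml //.
apply: (@le_lt_trans _ _ (\sum_l \sum_k `|Q i k| * (d / C) * `|W l j|)).
  apply: le_trans (ler_norm_sum _ _ _) _; apply: ler_sum => l _.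
  apply: le_trans (ler_norm_sum _ _ _) _; apply: ler_sum => k _.
  rewrite !normrM; apply: ler_wpM2r => //; apply: ler_wpM2l => //.
  have := AA k l; rewrite /ball /= !mxE distrC => /ltW; exact.
have -> : \sum_l \sum_k `|Q i k| * (d / C) * `|W l j| =
    (d / C) * ((\sum_k `|Q i k|) * (\sum_l `|W l j|)).
  rewrite mulr_sumr mulr_sumr; apply: eq_bigr => l _.
  by rewrite mulr_suml mulr_sumr; apply: eq_bigr => k _; ring.
rewrite -mulrA gtr_pMr//.
rewrite mulrC ltr_pdivrMr// mul1r; apply: (@le_lt_trans _ _ (C - 1)); last by rewrite ltrBlDr ltrDl.
rewrite addrK; apply: ler_pM.
- exact: sumr_ge0.
- exact: sumr_ge0.
- by apply: (le_sum (fun i => \sum_k `|Q i k|)) => ?; exact: sumr_ge0.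
- by apply: ler_sum => l _; exact: (le_sum (fun j => `|W l j|)).
Qed.

Definition block3 l1 l2 c1 c2 c3 := shear c3 *m turn l2 *m shear c2 *m turn l1 *m shear c1.

(** The lower left entry z is left implicit: it is determined by the others
    when c2 is nonzero. *)
Lemma block3E l1 l2 c1 c2 c3 : l1 != 0 -> l2 != 0 -> exists z,
  block3 l1 l2 c1 c2 c3 =
    mat2 (- (l1 / l2) + c1 * c2 / (l1 * l2)) (c2 / (l1 * l2)) z
         (- (l2 / l1) + c3 * c2 / (l1 * l2)).
Proof.
move=> l10 l20; rewrite /block3 !mat2_mul; eexists; congr mat2; last 1 first.
all: try by field; rewrite ?l10 ?l20.
Qed.

(** In SL(2) the lower left entry is determined by the others when the upper
    right one is nonzero. *)
Lemma mat2_det_eq (x y z w z' : R) : y != 0 ->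
  mdet (mat2 x y z w) = 1 -> mdet (mat2 x y z' w) = 1 -> mat2 x y z w = mat2 x y z' w.
Proof.
rewrite !mdet_mat2 => y0 e1 e2; congr mat2; apply: (mulfI y0).
have {}e1 : y * z = x * w - 1 by rewrite -e1; ring.
have {}e2 : y * z' = x * w - 1 by rewrite -e2; ring.
by rewrite e1 e2.
Qed.

Lemma quotient_close (a y eta : R) : y != 0 -> 0 < eta -> exists2 d, 0 < d &
  forall a' y', `|a' - a| < d -> `|y' - y| < d -> y' != 0 /\ `|a' / y' - a / y| <= eta.
Proof.
move=> y0 eta0.
have c1 : (fun v : R * R => v.1) @ (a, y) --> a by exact: cvg_fst.
have c2 : (fun v : R * R => v.2) @ (a, y) --> y by exact: cvg_snd.
have cq : (fun v : R * R => v.1 / v.2) @ (a, y) --> a / y.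
  by apply: cvgM => //; exact: cvgV.
have n1 : \forall v \near (a, y), v.2 != 0 by exact: (cvgr_neq0 _ c2).
have n2 : \forall v \near (a, y), `|a / y - v.1 / v.2| <= eta.
  by move/cvgrPdist_le: cq => /(_ _ eta0).
have /nbhs_ballP : nbhs (a, y) [set v : R * R | v.2 != 0 /\ `|a / y - v.1 / v.2| <= eta] by exact: filterI n1 n2.
move=> [d /= d0 hd].
exists d => // a' y' ha hy; have [] := hd (a', y').
  by split; rewrite /ball /= distrC.
by move=> /= k1 k2; split=> //; rewrite distrC.
Qed.

(** The upper right entry of a block gives its middle shear, and each diagonal
    entry then gives one of the outer shears; the remaining entry is forced by
    the determinant. *)
Lemma solve_three (Q W : 'M[R]_2) (l1 l2 c1 c2 c3 eta : R) :
  mdet Q = 1 -> mdet W = 1 -> 0 < l1 -> 0 < l2 -> c2 != 0 -> 0 < eta ->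
  exists2 e, 0 < e & forall A, mdet A = 1 -> ball (Q *m block3 l1 l2 c1 c2 c3 *m W) e A ->
  exists c1' c2' c3', [/\ `|c1' - c1| <= eta, `|c2' - c2| <= eta, `|c3' - c3| <= eta &
    Q *m block3 l1 l2 c1' c2' c3' *m W = A].
Proof.
move=> dQ dW l1p l2p c20 eta0.
have l10 := lt0r_neq0 l1p; have l20 := lt0r_neq0 l2p.
have [z0 X0E] := block3E c1 c2 c3 l10 l20.
set X0 := block3 _ _ _ _ _ in X0E *.
pose y := c2 / (l1 * l2).
pose a1 := c1 * c2 / (l1 * l2); pose a3 := c3 * c2 / (l1 * l2).
have y0 : y != 0 by rewrite !mulf_neq0 ?invr_neq0 ?mulf_neq0.
have [d1 d10 h1] := quotient_close a1 y0 eta0.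
have [d3 d30 h3] := quotient_close a3 y0 eta0.
have ll : 0 < l1 * l2 by rewrite mulr_gt0.
pose d := Num.min d1 (Num.min d3 (eta / (l1 * l2))).
have d0 : 0 < d by rewrite !lt_min d10 d30 divr_gt0.
have dd1 : d <= d1 by rewrite ge_min lexx.
have dd3 : d <= d3 by rewrite !ge_min lexx orbT.
have dd2 : d <= eta / (l1 * l2) by rewrite !ge_min lexx !orbT.
have [e e0 he] := mx_close (madj Q) (madj W) (Q *m X0 *m W) d0.
exists e => // A dA AA; pose X := madj Q *m A *m madj W.
have [Q1 Q2] := madjK dQ; have [W1 W2] := madjK dW.
have X0K : madj Q *m (Q *m X0 *m W) *m madj W = X0.
  by rewrite !mulmxA Q1 mul1mx -mulmxA W2 mulmx1.
have XK : Q *m X *m W = A.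
  by rewrite /X !mulmxA Q2 mul1mx -mulmxA W1 mulmx1.
have dX : mdet X = 1 by rewrite !mdetM !mdet_adj dQ dA dW !mulr1.
have hX i j : `|X i j - X0 i j| < d by have := he A AA i j; rewrite X0K.
have x00 : X0 i0 i0 = - (l1 / l2) + a1 by rewrite X0E mxE.
have x01 : X0 i0 i1 = y by rewrite X0E mxE.
have x11 : X0 i1 i1 = - (l2 / l1) + a3 by rewrite X0E mxE.
have k1 : `|(X i0 i0 + l1 / l2) - a1| < d1.
  apply: lt_le_trans dd1; have := hX i0 i0; rewrite x00 opprD opprK addrA; exact.
have k2 : `|X i0 i1 - y| < d by have := hX i0 i1; rewrite x01.
have k3 : `|(X i1 i1 + l2 / l1) - a3| < d3.
  apply: lt_le_trans dd3; have := hX i1 i1; rewrite x11 opprD opprK addrA; exact.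
have [X01 r1] := h1 _ _ k1 (lt_le_trans k2 dd1).
have [_ r3] := h3 _ _ k3 (lt_le_trans k2 dd3).
exists ((X i0 i0 + l1 / l2) / X i0 i1), (l1 * l2 * X i0 i1), ((X i1 i1 + l2 / l1) / X i0 i1).
split.
- have <- : a1 / y = c1; last exact: r1.
  by rewrite /a1 /y; field; rewrite l10 l20 c20.
- have -> : l1 * l2 * X i0 i1 - c2 = l1 * l2 * (X i0 i1 - y).
    by rewrite /y; field; rewrite l10 l20.
  rewrite normrM gtr0_norm// mulrC -ler_pdivlMr//.
  exact: le_trans (ltW k2) dd2.
- have <- : a3 / y = c3; last exact: r3.
  by rewrite /a3 /y; field; rewrite l10 l20 c20.
rewrite -[RHS]XK; congr (_ *m _ *m _).
have dB : mdet (block3 l1 l2 ((X i0 i0 + l1 / l2) / X i0 i1) (l1 * l2 * X i0 i1) ((X i1 i1 + l2 / l1) / X i0 i1)) = 1.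
  by rewrite /block3 !mdetM !mdet_shear !mdet_turn// !mulr1.
have [z zE] := block3E ((X i0 i0 + l1 / l2) / X i0 i1) (l1 * l2 * X i0 i1) ((X i1 i1 + l2 / l1) / X i0 i1) l10 l20.
move: dB; rewrite {}zE => dB.
rewrite [RHS]mat2E.
have E1 : - (l1 / l2) + (X i0 i0 + l1 / l2) / X i0 i1 * (l1 * l2 * X i0 i1) / (l1 * l2) = X i0 i0.
  by field; rewrite l10 l20 X01.
have E2 : l1 * l2 * X i0 i1 / (l1 * l2) = X i0 i1 by field; rewrite l10 l20.
have E3 : - (l2 / l1) + (X i1 i1 + l2 / l1) / X i0 i1 * (l1 * l2 * X i0 i1) / (l1 * l2) = X i1 i1.
  by field; rewrite l10 l20 X01.
rewrite E1 E2 E3 in dB *.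
by apply: mat2_det_eq => //; rewrite -mat2E.
Qed.

End Mat2.

(** * Closed products of shears and turns *)

Section SolveClosed.
Context (R : realType).
Let i0 : 'I_2 := ord0.
Let i1 : 'I_2 := lift ord0 ord0.

(** The derivative along an orbit of period 3 without the two half shears at
    its first point. *)
Definition closed3 (l0 l1 l2 c1 c2 : R) :=
  turn l2 *m shear c2 *m turn l1 *m shear c1 *m turn l0.

(** The lower left entry does not depend on the shears: it is the constraint
    that the first bouncing point must repair. *)
Lemma closed3E (l0 l1 l2 c1 c2 : R) : l0 != 0 -> l1 != 0 -> l2 != 0 -> exists z,
  closed3 l0 l1 l2 c1 c2 =
    mat2 (c2 * l0 / (l1 * l2)) z (- (l0 * l2 / l1)) (c1 * l2 / (l0 * l1)).
Proof.
move=> l00 l10 l20; rewrite /closed3 !mat2_mul; eexists; congr mat2.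
all: try by field; rewrite ?l00 ?l10 ?l20.
Qed.

Lemma mdet_closed3 (l0 l1 l2 c1 c2 : R) : l0 != 0 -> l1 != 0 -> l2 != 0 ->
  mdet (closed3 l0 l1 l2 c1 c2) = 1.
Proof. by move=> h0 h1 h2; rewrite !mdetM !mdet_shear !mdet_turn// !mulr1. Qed.

Lemma shear_conj (u v b11 b12 b21 b22 : R) :
  shear u *m mat2 b11 b12 b21 b22 *m shear v =
  mat2 (b11 + b12 * v) b12 (b21 + u * b11 + (b22 + u * b12) * v) (b22 + u * b12).
Proof. by rewrite !mat2_mul; congr mat2; ring. Qed.

(** The polynomial changes sign on [-x0, x0] because its linear coefficient
    -k dominates there. *)
Lemma quadratic_root (m11 m12 m22 p q x0 k b11 b12 b21 b22 m21 d : R) :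
  0 <= p -> 0 <= q -> 0 < x0 -> k = - (q * m11) - p * m22 ->
  p * q * x0 * `|m12| <= k / 2 ->
  d * (1 + q * x0 + p * x0 + p * q * x0 ^+ 2) <= x0 * k / 4 -> 0 < k ->
  `|b11 - m11| <= d -> `|b12 - m12| <= d -> `|b21 - m21| <= d -> `|b22 - m22| <= d ->
  exists2 x, `|x| <= x0 & b21 - q * x * b11 - p * x * b22 + p * q * x ^+ 2 * b12 = m21.
Proof.
move=> p0 q0 x00 kE hk hd k0 h11 h12 h21 h22.
pose F x := b21 - q * x * b11 - p * x * b22 + p * q * x ^+ 2 * b12.
have cF : continuous F.
  move=> x; have dx := dv_id x.
  exact: dv_ct (dv_D (dv_D (dv_D (dv_cst x b21) (dv_N (dv_M (dv_M (dv_cst x q) dx) (dv_cst x b11))))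
    (dv_N (dv_M (dv_M (dv_cst x p) dx) (dv_cst x b22))))
    (dv_M (dv_M (dv_cst x (p * q)) (dv_X 2 dx)) (dv_cst x b12))).
have pq0 : 0 <= p * q by rewrite mulr_ge0.
have px0 : 0 <= p * x0 by rewrite mulr_ge0// ltW.
have qx0 : 0 <= q * x0 by rewrite mulr_ge0// ltW.
have pqx : 0 <= p * q * x0 ^+ 2 by rewrite mulr_ge0// sqr_ge0.
have b0 := normr_ge0 m12.
have N12 : `|p * q * x0 ^+ 2 * m12| <= x0 * k / 2.
  rewrite normrM ger0_norm//.
  have -> : p * q * x0 ^+ 2 * `|m12| = x0 * (p * q * x0 * `|m12|) by ring.
  by rewrite -[leRHS]mulrA ler_pM2l.
have sc c u v : 0 <= c -> `|u - v| <= d -> `|c * u - c * v| <= c * d.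
  by move=> c0 uv; rewrite -mulrBr normrM ger0_norm// ler_wpM2l.
have E1 := sc _ _ _ qx0 h11; have E2 := sc _ _ _ px0 h22; have E3 := sc _ _ _ pqx h12.
have xk : 0 < x0 * k by rewrite mulr_gt0.
have kx : x0 * k = - (q * x0 * m11) - p * x0 * m22 by rewrite kE; ring.
have hd' : d + q * x0 * d + p * x0 * d + p * q * x0 ^+ 2 * d <= x0 * k / 4.
  by apply: le_trans hd; rewrite le_eqVlt; apply/orP; left; apply/eqP; ring.
have Fp : F x0 = b21 - q * x0 * b11 - p * x0 * b22 + p * q * x0 ^+ 2 * b12 by [].
have Fn : F (- x0) = b21 + q * x0 * b11 + p * x0 * b22 + p * q * x0 ^+ 2 * b12.
  by rewrite /F; ring.
have sg : F (- x0) <= m21 <= F x0.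
  rewrite Fp Fn; move: E1 E2 E3 N12 h21 xk kx hd'.
  move: (x0 * k) (q * x0 * m11) (q * x0 * b11) (p * x0 * m22) (p * x0 * b22)
    (p * q * x0 ^+ 2 * m12) (p * q * x0 ^+ 2 * b12) (q * x0 * d) (p * x0 * d) (p * q * x0 ^+ 2 * d).
  clear; move=> K a1 a2 a3 a4 a5 a6 a7 a8 a9.
  rewrite !ler_norml => /andP[? ?] /andP[? ?] /andP[? ?] /andP[? ?] /andP[? ?] *.
  by apply/andP; split; lra.
have [||x /andP[x1 x2] Fx] := ivt (a := - x0) (b := x0) (v := m21) _ cF.
- by apply: (@le_trans _ _ 0); rewrite ?oppr_le0 ltW.
- by rewrite sg.
by exists x => //; rewrite ler_norml x1 x2.
Qed.

(** The perturbed product has the form closed3 exactly when, after removing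
    the two outer shears, its lower left entry is - l0 l2 / l1.  This is a
    quadratic equation in x whose linear coefficient, close to
    - (q m11 + p m22), does not vanish, the diagonal entries m11 and m22 being both negative; the diagonal
    entries of the solution then give c1' and c2'. *)
Lemma solve_closed_pos (l0 l1 l2 c1 c2 a b p q eta : R) :
  0 < l0 -> 0 < l1 -> 0 < l2 -> c1 < 0 -> c2 < 0 -> 0 <= p -> 0 <= q -> 0 < p + q -> 0 < eta ->
  exists2 e, 0 < e & forall A, mdet A = 1 ->
    ball (shear b *m closed3 l0 l1 l2 c1 c2 *m shear a) e A ->
  exists x c1' c2', [/\ `|x| <= eta, `|c1' - c1| <= eta, `|c2' - c2| <= eta &
    shear (b + q * x) *m closed3 l0 l1 l2 c1' c2' *m shear (a + p * x) = A].
Proof.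
move=> l0p l1p l2p c10 c20 p0 q0 pq eta0.
have l00 := lt0r_neq0 l0p; have l10 := lt0r_neq0 l1p; have l20 := lt0r_neq0 l2p.
have [z0 M0E] := closed3E c1 c2 l00 l10 l20.
set M0 := closed3 _ _ _ _ _ in M0E *.
pose m11 := c2 * l0 / (l1 * l2); pose m22 := c1 * l2 / (l0 * l1).
pose m21 := - (l0 * l2 / l1).
pose C11 := l1 * l2 / l0; pose C22 := l0 * l1 / l2.
have m110 : m11 < 0 by rewrite /m11 -mulrA nmulr_rlt0// divr_gt0// mulr_gt0.
have m220 : m22 < 0 by rewrite /m22 -mulrA nmulr_rlt0// divr_gt0// mulr_gt0.
have C11p : 0 < C11 by rewrite divr_gt0// mulr_gt0.
have C22p : 0 < C22 by rewrite divr_gt0// mulr_gt0.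
have m210 : m21 != 0 by rewrite oppr_eq0 !mulf_neq0 ?invr_neq0.
pose k := - (q * m11) - p * m22.
have k0 : 0 < k.
  have n11 : 0 < - m11 by rewrite oppr_gt0.
  have n22 : 0 < - m22 by rewrite oppr_gt0.
  have -> : k = q * - m11 + p * - m22 by rewrite /k !mulrN.
  have [p1|p1] := ltP 0 p.
    exact: (ltr_wpDl (mulr_ge0 q0 (ltW n11)) (mulr_gt0 p1 n22)).
  have q1 : 0 < q by move: pq p1; clear; lra.
  exact: (ltr_pwDl (mulr_gt0 q1 n11) (mulr_ge0 p0 (ltW n22))).
have m120 := normr_ge0 z0.
have pq1 : 0 <= p * q by rewrite mulr_ge0.
pose U := p * q * `|z0| + 1.
have U0 : 0 < U by rewrite ltr_wpDl// mulr_ge0.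
pose V := (p + q) * (C11 + C22) * (`|z0| + 1).
have z1 : 0 < `|z0| + 1 by exact: ltr_wpDl m120 ltr01.
have CC0 : 0 < C11 + C22 by exact: addr_gt0.
have V0 : 0 < V by exact: mulr_gt0 (mulr_gt0 pq CC0) z1.
pose x0 := Num.min eta (Num.min (k / 2 / U) (eta / 2 / V)).
have k20 : 0 < k / 2 by exact: divr_gt0.
have eta20 : 0 < eta / 2 by exact: divr_gt0.
have x00 : 0 < x0.
  rewrite !lt_min eta0; apply/andP; split=> //.
  by apply/andP; split; exact: divr_gt0.
have xe : x0 <= eta by rewrite ge_min lexx.
have xU : U * x0 <= k / 2 by rewrite mulrC -ler_pdivlMr// !ge_min lexx orbT.
have xV : V * x0 <= eta / 2 by rewrite mulrC -ler_pdivlMr// !ge_min lexx !orbT.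
pose S := 1 + q * x0 + p * x0 + p * q * x0 ^+ 2.
have S0 : 0 < S.
  have h := addr_ge0 (mulr_ge0 p0 (ltW x00)) (mulr_ge0 pq1 (sqr_ge0 x0)).
  rewrite /S -!addrA; apply: ltr_pwDl => //; apply: addr_ge0 => //.
  exact: mulr_ge0 q0 (ltW x00).
pose d := Num.min 1 (Num.min (eta / 2 / (C11 + C22)) (x0 * k / 4 / S)).
have xk0 : 0 < x0 * k / 4 by exact: divr_gt0 (mulr_gt0 x00 k0) _.
have d0 : 0 < d.
  rewrite !lt_min ltr01 /=; apply/andP; split; exact: divr_gt0.
have d1 : d <= 1 by rewrite ge_min lexx.
have dC : d * (C11 + C22) <= eta / 2 by rewrite -ler_pdivlMr// !ge_min lexx orbT.
have dS : d * S <= x0 * k / 4 by rewrite -ler_pdivlMr// !ge_min lexx !orbT.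
have hk : p * q * x0 * `|z0| <= k / 2.
  apply: le_trans xU; have -> : p * q * x0 * `|z0| = (p * q * `|z0|) * x0 by ring.
  by apply: ler_wpM2r; [exact: ltW|rewrite lerDl].
have [e e0 he] := mx_close (shear (- b)) (shear (- a)) (shear b *m M0 *m shear a) d0.
exists e => // A dA AA.
pose B := shear (- b) *m A *m shear (- a).
have dB : mdet B = 1 by rewrite !mdetM !mdet_shear dA !mulr1.
have sh0 : shear (0 : R) = 1%:M by rewrite -mat2_1.
have M0K : shear (- b) *m (shear b *m M0 *m shear a) *m shear (- a) = M0.
  rewrite !mulmxA shearD addNr sh0 mul1mx -mulmxA shearD subrr sh0 mulmx1 //.
have hB i j : `|B i j - M0 i j| <= d by have := he A AA i j; rewrite M0K => /ltW.
have [y11 y12 y21 y22] : [/\ M0 i0 i0 = m11, M0 i0 i1 = z0, M0 i1 i0 = m21 & M0 i1 i1 = m22].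
  by rewrite M0E !mxE.
have h11 : `|B i0 i0 - m11| <= d by rewrite -y11; exact: hB.
have h12 : `|B i0 i1 - z0| <= d by rewrite -y12; exact: hB.
have h21 : `|B i1 i0 - m21| <= d by rewrite -y21; exact: hB.
have h22 : `|B i1 i1 - m22| <= d by rewrite -y22; exact: hB.
have [x xx0 xr] := quadratic_root p0 q0 x00 (erefl k) hk dS k0 h11 h12 h21 h22.
pose n11 := B i0 i0 - p * x * B i0 i1; pose n22 := B i1 i1 - q * x * B i0 i1.
have NE : shear (- (q * x)) *m B *m shear (- (p * x)) = mat2 n11 (B i0 i1) m21 n22.
  rewrite {1}(mat2E B) shear_conj -xr /n11 /n22 -/i0 -/i1.
  move: (B i0 i0) (B i0 i1) (B i1 i0) (B i1 i1) => b22 b21 b12 b11.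
  by congr mat2; ring.
have B12 : `|B i0 i1| <= `|z0| + 1.
  rewrite -[B i0 i1](subrK z0); apply: le_trans (ler_normD _ _) _.
  by rewrite addrC lerD2l; exact: le_trans h12 d1.
have near (m B11 r C : R) : 0 <= r -> r <= p + q -> 0 < C -> C <= C11 + C22 -> `|B11 - m| <= d ->
    `|C * (B11 - r * x * B i0 i1) - C * m| <= eta.
  move=> r0 rpq C0 CC hm.
  have -> : C * (B11 - r * x * B i0 i1) - C * m = C * (B11 - m) - C * (r * x * B i0 i1) by ring.
  apply: le_trans (ler_normB _ _) _; rewrite [eta]splitr; apply: lerD.
    rewrite normrM gtr0_norm//; apply: le_trans dC; rewrite mulrC.
    by apply: ler_pM => //; exact: ltW.
  apply: le_trans xV; rewrite !normrM gtr0_norm// ger0_norm//.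
  have -> : V * x0 = (C11 + C22) * ((p + q) * x0 * (`|z0| + 1)) by rewrite /V; ring.
  apply: ler_pM => //; first exact: ltW.
    by rewrite !mulr_ge0.
  by apply: ler_pM => //; [rewrite mulr_ge0|apply: ler_pM].
exists x, (C22 * n22), (C11 * n11); split.
- exact: le_trans xx0 xe.
- have -> : c1 = C22 * m22 by rewrite /C22 /m22; field; rewrite l00 l10 l20.
  have h : q <= p + q by rewrite lerDr.
  by apply: (near m22 (B i1 i1) q C22 q0 h C22p _ h22); rewrite lerDr ltW.
- have -> : c2 = C11 * m11 by rewrite /C11 /m11; field; rewrite l00 l10 l20.
  have h : p <= p + q by rewrite lerDl.
  by apply: (near m11 (B i0 i0) p C11 p0 h C11p _ h11); rewrite lerDl ltW.
have -> : closed3 l0 l1 l2 (C22 * n22) (C11 * n11) = mat2 n11 (B i0 i1) m21 n22.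
  have [z zE] := closed3E (C22 * n22) (C11 * n11) l00 l10 l20.
  have dz := mdet_closed3 (C22 * n22) (C11 * n11) l00 l10 l20.
  rewrite {}zE in dz *.
  have e1 : C11 * n11 * l0 / (l1 * l2) = n11 by rewrite /C11; field; rewrite l00 l10 l20.
  have e2 : C22 * n22 * l2 / (l0 * l1) = n22 by rewrite /C22; field; rewrite l00 l10 l20.
  have dN : mdet (mat2 n11 (B i0 i1) m21 n22) = 1.
    by rewrite -NE 2!mdetM !mdet_shear dB !mulr1.
  rewrite e1 e2 -/m21 in dz *.
  congr mat2; apply: (mulIf m210); move: dz dN; rewrite !mdet_mat2 => <-.
  by move=> /addrI /oppr_inj.
rewrite -NE !mulmxA shearD addrK -!mulmxA shearD.
have -> : - (p * x) + (a + p * x) = a by ring.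
rewrite /B !mulmxA shearD subrr sh0 mul1mx -mulmxA shearD addNr sh0 mulmx1 //.
Qed.

(** Changing the signs of p, q and x reduces to the nonnegative case. *)
Lemma solve_closed (l0 l1 l2 c1 c2 a b p q eta : R) :
  0 < l0 -> 0 < l1 -> 0 < l2 -> c1 < 0 -> c2 < 0 -> 0 <= p * q -> p + q != 0 -> 0 < eta ->
  exists2 e, 0 < e & forall A, mdet A = 1 ->
    ball (shear b *m closed3 l0 l1 l2 c1 c2 *m shear a) e A ->
  exists x c1' c2', [/\ `|x| <= eta, `|c1' - c1| <= eta, `|c2' - c2| <= eta &
    shear (b + q * x) *m closed3 l0 l1 l2 c1' c2' *m shear (a + p * x) = A].
Proof.
move=> h0 h1 h2 h3 h4 pq pq0 h5.
have [[p0 q0]|[p0 q0]] : 0 <= p /\ 0 <= q \/ 0 <= - p /\ 0 <= - q.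
- have [p0|p0] := ltP 0 p; first by left; split; [exact: ltW|rewrite -(pmulr_rge0 _ p0)].
  have [p1|p1] := eqVneq p 0.
    rewrite p1 oppr0; case: (leP 0 q) => q0; first by left.
    by right; split=> //; rewrite oppr_ge0 ltW.
  have p2 : p < 0 by rewrite lt_neqAle p1.
  by right; rewrite !oppr_ge0; split=> //; rewrite -(nmulr_rge0 _ p2).
- by apply: solve_closed_pos => //; rewrite lt_neqAle eq_sym pq0 addr_ge0.
have := @solve_closed_pos l0 l1 l2 c1 c2 a b (- p) (- q) eta h0 h1 h2 h3 h4 p0 q0 _ h5.
rewrite -opprD lt_neqAle eq_sym oppr_eq0 pq0 opprD addr_ge0// => /(_ isT) [e e0 he].
exists e => // A dA AA; have [x [c1' [c2' [k1 k2 k3 k4]]]] := he A dA AA.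
by exists (- x), c1', c2'; split=> //; rewrite ?normrN// !mulrN -!mulNr.
Qed.

End SolveClosed.

(** * Periodic orbits *)

Lemma shear_turn_shear (R : realType) (a b l : R) : l != 0 ->
  shear b *m turn l *m shear a = mat2 (- a / l) (- l^-1) (l - b * a / l) (- b / l).
Proof. by move=> l0; rewrite !mat2_mul; congr mat2; field. Qed.

(** The outer factors are the contributions of the second derivatives at the
    two ends of the step; at each bouncing point the right factor of one step
    meets the left factor of the previous one. *)
Lemma Dbilliard_link (R : realType) (g : table R) (O p : R * R) (u : R) : link g O p u ->
  Dbilliard g O p =
    shear (det2 (g p.1 - O) (derive1 (derive1 g) u)) *m
    turn (det2 (derive1 g p.1) (derive1 g u)) *m
    shear (det2 (derive1 (derive1 g) p.1) (g u - O)).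
Proof.
move=> L; have D := billiard_diff L; have [_ _ l0 _] := L.
have -> : Dbilliard g O p = mat2
    (- det2 (derive1 (derive1 g) p.1) (g u - O) / det2 (derive1 g p.1) (derive1 g u))
    (- (det2 (derive1 g p.1) (derive1 g u))^-1)
    (det2 (derive1 g p.1) (derive1 g u) - det2 (g p.1 - O) (derive1 (derive1 g) u) *
      det2 (derive1 (derive1 g) p.1) (g u - O) / det2 (derive1 g p.1) (derive1 g u))
    (- det2 (g p.1 - O) (derive1 (derive1 g) u) / det2 (derive1 g p.1) (derive1 g u)).
  apply/matrixP => i j; rewrite /Dbilliard !mxE /= D /dmap /GRing.scale /=.
  case: (ord2E i) => ->; case: (ord2E j) => -> /=;
    by rewrite ?scale1r ?scale0r ?addr0 ?add0r.
by rewrite (shear_turn_shear _ _ (lt0r_neq0 l0)).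
Qed.

Section Orbit.
Context (R : realType) (O : R * R) (n : nat) (o : nat -> R * R).

(** The lifts of the points are arbitrary, so the next parameter is that of
    the next point up to a turn. *)
Lemma orbit_link (g : table R) : periodic_orbit g O n o -> forall i, exists u,
  link g O (o i) u /\ circ_eq u (o i.+1).1.
Proof.
move=> [_ ph st _ _] i; have [u L] := (phase_space_link g O (o i)).1 (ph i).
by exists u; split=> //; have [] := st i; rewrite (billiard_link L).
Qed.

Lemma circ_curve (g : table R) (u v : R) : circ_eq u v ->
  [/\ g v = g u, derive1 g v = derive1 g u & derive1 (derive1 g) v = derive1 (derive1 g) u].
Proof.
move=> uv; have p0 := @table_periodic R g; have p1 := derive1_periodic p0.
have p2 := derive1_periodic p1.
by split; [exact: (circ_eqP p0 uv)|exact: (circ_eqP p1 uv)|exact: (circ_eqP p2 uv)].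
Qed.

Lemma orbit_momentum (g : table R) : periodic_orbit g O n o -> forall i,
  [/\ (o i).2 = - det2 (derive1 g (o i).1) (g (o i.+1).1 - O),
      (o i.+1).2 = det2 (g (o i).1 - O) (derive1 g (o i.+1).1) &
      0 < det2 (derive1 g (o i).1) (derive1 g (o i.+1).1)].
Proof.
move=> po i; have [u [L uo]] := orbit_link po i; have [e0 e1 e2] := circ_curve g uo.
have [_ _ st _ _] := po; have [_ h2] := st i.
rewrite (billiard_link L) /= in h2; have [_ _ h3 h4] := L.
by rewrite e0 e1; split.
Qed.

Lemma Dbilliard_orbit (g : table R) : periodic_orbit g O n o -> forall i,
  Dbilliard g O (o i) =
    shear (det2 (g (o i).1 - O) (derive1 (derive1 g) (o i.+1).1)) *m
    turn (det2 (derive1 g (o i).1) (derive1 g (o i.+1).1)) *m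
    shear (det2 (derive1 (derive1 g) (o i).1) (g (o i.+1).1 - O)).
Proof.
move=> po i; have [u [L uo]] := orbit_link po i; have [e0 e1 e2] := circ_curve g uo.
by rewrite (Dbilliard_link L) e0 e1 e2.
Qed.

(** The points and the momenta involve only the 1-jets of the boundary. *)
Lemma orbit_transfer (g h : table R) : periodic_orbit g O n o ->
  (forall i, h (o i).1 = g (o i).1) -> (forall i, derive1 h (o i).1 = derive1 g (o i).1) ->
  periodic_orbit h O n o.
Proof.
move=> po h0 h1; have [n0 ph st on least] := po.
have hl i u : link g O (o i) u -> circ_eq u (o i.+1).1 -> link h O (o i) u.
  move=> [l1 l2 l3 l4] uo; have [e0 e1 _] := circ_curve g uo; have [f0 f1 _] := circ_curve h uo.
  split; [exact: l1|exact: l2| |].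
    by rewrite -f1 !h1 e1; exact: l3.
  by rewrite -f0 h0 h1 e0; exact: l4.
split; [exact: n0| | |exact: on|exact: least] => i;
  have [u [L uo]] := orbit_link po i; have Lh := hl _ _ L uo.
  exact: ((phase_space_link h O (o i)).2 (ex_intro _ u Lh)).
have [e0 e1 _] := circ_curve g uo; have [f0 f1 _] := circ_curve h uo.
have sti := st i; rewrite (billiard_link L) in sti.
rewrite (billiard_link Lh) h0 -f1 h1 e1; exact: sti.
Qed.

Lemma link_shift (g : table R) p u (k : int) : link g O p u ->
  link g O (p.1 + k%:~R * (2 * pi), p.2) (u + k%:~R * (2 * pi)).
Proof.
move=> [l1 l2 l3 l4].
have c1 : circ_eq p.1 (p.1 + k%:~R * (2 * pi)) by exists k.
have c2 : circ_eq u (u + k%:~R * (2 * pi)) by exists k.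
have [e0 e1 _] := circ_curve g c1; have [f0 f1 _] := circ_curve g c2.
split=> /=; [by rewrite ltrD2r|by rewrite addrAC ltrD2r|by rewrite e1 f1|by rewrite e1 f0].
Qed.

Lemma orbit_step_eq (g : table R) : periodic_orbit g O n o -> forall i j,
  phase_eq (o i) (o j) -> phase_eq (o i.+1) (o j.+1).
Proof.
move=> po i j [cij sij]; have [u [Lu uo]] := orbit_link po i.
have [v [Lv vo]] := orbit_link po j.
have [_ mi _] := orbit_momentum po i; have [_ mj _] := orbit_momentum po j.
have cuv : circ_eq u v.
  case: (cij) => k ek; have := link_shift k Lu; rewrite -ek sij -surjective_pairing => L.
  by rewrite -(link_uniq L Lv); exists k.
have c : circ_eq (o i.+1).1 (o j.+1).1.
  exact: circ_trans (circ_trans (circ_sym uo) cuv) vo.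
split; first exact: c.
have [e0 _ _] := circ_curve g cij; have [_ e1 _] := circ_curve g c.
rewrite mi mj e0 e1; reflexivity.
Qed.

Lemma orbit_shift_eq (g : table R) : periodic_orbit g O n o -> forall i j k,
  phase_eq (o i) (o j) -> phase_eq (o (i + k)%N) (o (j + k)%N).
Proof.
move=> po i j k h; elim: k => [|k IH]; first by rewrite !addn0.
rewrite !addnS; exact: (orbit_step_eq po IH).
Qed.

Lemma phase_eq_sym (p q : R * R) : phase_eq p q -> phase_eq q p.
Proof. by move=> [c e]; split; [exact: circ_sym|rewrite e]. Qed.

Lemma phase_eq_trans (p q r : R * R) : phase_eq p q -> phase_eq q r -> phase_eq p r.
Proof. by move=> [c e] [d f]; split; [exact: circ_trans d|rewrite e]. Qed.

Lemma orbit_period (g : table R) : periodic_orbit g O n o -> forall i,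
  phase_eq (o (i + n)%N) (o i).
Proof.
by move=> po i; have [_ _ _ on _] := po; have := orbit_shift_eq po i on; rewrite add0n addnC.
Qed.

(** If two points among the first n agreed, the orbit would have a smaller
    period. *)
Lemma orbit_least (g : table R) : periodic_orbit g O n o -> forall i j,
  (i < n)%N -> (j < n)%N -> phase_eq (o i) (o j) -> i = j.
Proof.
move=> po; suff key i j : (i < j)%N -> (j < n)%N -> ~ phase_eq (o i) (o j).
  move=> i j ni nj pij; have [ij|ji|//] := ltngtP i j.
    by have := key _ _ ij nj.
  by have := key _ _ ji ni; have := phase_eq_sym pij.
move=> ij jn h; have [_ _ _ on least] := po.
have := orbit_shift_eq po (n - i) h.
have ni : (i < n)%N := ltn_trans ij jn.
rewrite subnKC ?(ltnW ni)// => h1.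
have e : (j + (n - i) = (j - i) + n)%N by rewrite addnBA ?(ltnW ni)// addnBAC// ltnW.
apply: (least (j - i)%N); first by rewrite subn_gt0 ij (leq_ltn_trans (leq_subr _ _)).
rewrite e in h1; apply: phase_eq_sym; apply: phase_eq_trans (orbit_period po _).
exact: phase_eq_trans (phase_eq_sym on) h1.
Qed.

Lemma orbit_neq1 (g : table R) : periodic_orbit g O n o -> forall i,
  ~ circ_eq (o i).1 (o i.+1).1.
Proof.
move=> po i c; have [_ _] := orbit_momentum po i; have [_ e _] := circ_curve g c.
by rewrite e det2vv ltxx.
Qed.

(** The two determinants of successive tangents are positive, so the tangents
    at i and i + 2 cannot agree. *)
Lemma orbit_neq2 (g : table R) : periodic_orbit g O n o -> forall i,
  ~ circ_eq (o i).1 (o i.+2).1.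
Proof.
move=> po i c; have [_ _ k1] := orbit_momentum po i; have [_ _] := orbit_momentum po i.+1.
have [_ e _] := circ_curve g c.
by rewrite e det2C oppr_gt0 ltNge (ltW k1).
Qed.

Lemma det2_collinear (a q : R * R) : a != 0 -> det2 a q = 0 -> exists c, q = c *: a.
Proof.
case: a q => [a1 a2] [q1 q2] a0; rewrite /det2 /= => e.
have N0 := speed_gt0 a0; rewrite /= in N0.
exists ((a1 * q1 + a2 * q2) / (a1 ^+ 2 + a2 ^+ 2)); rewrite /GRing.scale /=.
have := lt0r_neq0 N0 => N1.
have {}e : a1 * q2 = a2 * q1 by apply/eqP; rewrite -subr_eq0 e.
congr pair; rewrite /= /GRing.scale /=; apply: (mulfI N1).
  transitivity (a1 * a1 * q1 + a2 * (a2 * q1)); first by ring.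
  by rewrite -e; field.
transitivity (a1 * (a1 * q2) + a2 * a2 * q2); first by ring.
by rewrite e; field.
Qed.

(** The reflection law says that the chord is parallel to the tangent; the
    curve lies on the left of its tangents, which fixes the orientation. *)
Lemma orbit_chord (g : table R) : periodic_orbit g O n o -> forall i,
  exists2 c, 0 < c & g (o i.+2).1 - g (o i).1 = c *: derive1 g (o i.+1).1.
Proof.
move=> po i; have [_ k1 k2] := orbit_momentum po i; have [k3 _ _] := orbit_momentum po i.+1.
have k4 := support_gt0 g (orbit_neq2 po (i := i)).
have h : det2 (derive1 g (o i.+1).1) (g (o i.+2).1 - g (o i).1) = 0.
  have -> : g (o i.+2).1 - g (o i).1 = (g (o i.+2).1 - O) - (g (o i).1 - O).
    by rewrite opprB addrA subrK.
  rewrite det2Br.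
  have ar (s x y z : R) : s = - x -> s = y -> z = - y -> x - z = 0 by move=> -> <- ->; ring.
  exact: (ar _ _ _ _ k3 k1 (det2C _ _)).
have [c ce] := det2_collinear (@table_regular R g _) h.
exists c => //; move: k4; rewrite ce det2Zr.
by rewrite pmulr_lgt0.
Qed.

(** The two shear parameters that meet at a bouncing point add up to the
    determinant of the second derivative and of the chord, which is a positive
    multiple of the tangent. *)
Lemma orbit_bend (g : table R) : periodic_orbit g O n o -> forall i,
  det2 (g (o i).1 - O) (derive1 (derive1 g) (o i.+1).1) +
  det2 (derive1 (derive1 g) (o i.+1).1) (g (o i.+2).1 - O) < 0.
Proof.
move=> po i; have [c c0 ce] := orbit_chord po i.
have -> : det2 (g (o i).1 - O) (derive1 (derive1 g) (o i.+1).1) +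
    det2 (derive1 (derive1 g) (o i.+1).1) (g (o i.+2).1 - O) =
    det2 (derive1 (derive1 g) (o i.+1).1) (g (o i.+2).1 - g (o i).1).
  rewrite det2C addrC -det2Br; congr det2.
  by rewrite opprB addrA subrK.
by rewrite ce det2Zr det2C pmulr_rlt0// oppr_lt0 table_det_gt0.
Qed.

End Orbit.

(** * Bumps on the circle *)

Lemma Cinf_id (R : realType) : Cinf (fun t : R => t).
Proof. by case=> // n; apply: (CnS (fun t => dv_id t)) (Cn_cst _ _). Qed.

Lemma Cinf_dist (R : realType) (t0 : R) : Cinf (fun t => 1 - cos (t - t0)).
Proof.
move=> n; apply: (@CnD R n (fun=> 1) (fun t => - cos (t - t0))); first exact: Cn_cst.
apply: CnN; apply: (@Cn_comp R n (@cos R) (fun t => t - t0)); first exact: Cinf_cos.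
by apply: CnD; [exact: Cinf_id|exact: Cn_cst].
Qed.

Lemma cos_window (R : realType) (r x : R) : 0 < r -> r <= pi -> r <= x <= 2 * pi - r ->
  cos x <= cos r.
Proof.
have p0 := pi_gt0 R.
have key y : 0 < r -> r <= pi -> r <= y -> y <= pi -> cos y <= cos r.
  move=> r0 rp ry yp; rewrite leNgt ltr_cos ?in_itv /= -?leNgt// ?(ltW r0) ?rp// ?yp ?andbT//.
  exact: le_trans (ltW r0) ry.
move=> r0 rp /andP[rx xr]; have [xp|xp] := leP x pi; first exact: key.
have -> : cos x = cos (2 * pi - x).
  by rewrite -cosN -cosD2piE addrC.
by apply: key => //; lra.
Qed.

(** The sublevel sets of 1 - cos are neighbourhoods on the circle. *)
Lemma circ_close (R : realType) (t0 r : R) : 0 < r -> exists2 k, 0 < k &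
  forall t, 1 - cos (t - t0) <= k -> exists2 u, circ_eq t u & `|u - t0| < r.
Proof.
move=> r0; have p0 := pi_gt0 R; pose s := Num.min r pi.
have s0 : 0 < s by rewrite lt_min r0 p0.
have sr : s <= r by rewrite ge_min lexx.
have sp : s <= pi by rewrite ge_min lexx orbT.
have cs : 0 < 1 - cos s by rewrite subr_gt0; apply: cos_lt1; rewrite s0 /=; lra.
exists ((1 - cos s) / 2); first exact: divr_gt0.
move=> t ht; have [v tv /andP[v1 v2]] := circ_window (t0 - s) t.
have cv : cos (t - t0) = cos (v - t0).
  apply/esym; apply: (@circ_eqP R R (fun x => cos (x - t0)) t v _ tv) => x /=.
  by rewrite addrAC cosD2piE.
have [h|h] := ltP (v - t0) s.
  have [h'|h'] := ltP (- s) (v - t0).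
    by exists v => //; rewrite ltr_norml; apply/andP; split; [apply: le_lt_trans h'; rewrite lerN2|exact: lt_le_trans h sr].
  exfalso.
  have e : v - t0 = - s by apply/eqP; rewrite eq_le h'; lra.
  by move: ht; rewrite cv e cosN; move: cs; clear; lra.
exfalso.
have := @cos_window R s (v - t0) s0 sp; rewrite h -cv.
have h2 : v - t0 <= 2 * pi - s by lra.
by rewrite h2 => /(_ isT); move: ht cs; clear; lra.
Qed.

Lemma noncirc_dist (R : realType) (t u : R) : ~ circ_eq t u -> 0 < 1 - cos (u - t).
Proof.
move=> tu; rewrite subr_gt0 lt_neqAle cos_le1 andbT; apply/eqP => e.
by apply: tu; apply: circ_sym; exact: circ_cos1.
Qed.

(** A function with slope 1 at 0 that vanishes beyond 2, namely y times the
    plateau. *)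
Lemma ramp_bounded (R : realType) : exists G G1 G2 : R -> R, exists C : R,
  [/\ Cinf G /\ 0 < C, forall y, is_derive y (1 : R) G (G1 y) /\ is_derive y (1 : R) G1 (G2 y),
   [/\ G 0 = 0 & G1 0 = 1], forall y, 2 < y -> [/\ G y = 0, G1 y = 0 & G2 y = 0] &
   forall y, 0 <= y -> [/\ `|G y| <= C, `|G1 y| <= C & `|G2 y| <= C]].
Proof.
pose G (y : R) := y * step y.
have cG : Cinf G by move=> n; apply: CnM; [exact: Cinf_id|exact: Cinf_step].
have cG1 := Cinf_derive1 cG; have cG2 := Cinf_derive1 cG1.
have d0 y := Cinf_is_derive y cG; have d1 y := Cinf_is_derive y cG1.
have zero y : 2 < y -> [/\ G y = 0, derive1 G y = 0 & derive1 (derive1 G) y = 0].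
  have z0 x : 2 < x -> G x = 0 by move=> x2; rewrite /G step0 ?mulr0// ltW.
  have zd (F : R -> R) (F1 : R -> R) : (forall x, is_derive x (1 : R) F (F1 x)) ->
      (forall x, 2 < x -> F x = 0) -> forall x, 2 < x -> F1 x = 0.
    move=> dF F0 x x2; have [_ e] := dF x; rewrite -e.
    transitivity ('D_1 (fun=> 0 : R) x); last by rewrite derive_cst.
    by apply: near_eq_derive; near=> z; apply: F0; near: z; exact: lt_nbhsr.
  have z1 := zd _ _ d0 z0; have z2 := zd _ _ d1 z1.
  by move=> y2; split; [exact: z0|exact: z1|exact: z2].
have bd (F : R -> R) : continuous F -> (forall y, 2 < y -> F y = 0) ->
    exists2 C, 0 < C & forall y, 0 <= y -> `|F y| <= C.
  move=> cF F0.
  have cn : {within `[0 : R, 2], continuous (fun t => `|F t|)}.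
    by apply: continuous_subspaceT => t; apply: continuous_comp (cF _) _; exact: norm_continuous.
  have [c _ cmax] := EVT_max (ler0n R 2) cn.
  exists (`|F c| + 1); first by rewrite ltr_wpDl.
  move=> y y0; have [y2|y2] := ltP 2 y; first by rewrite F0// normr0 addr_ge0.
  by rewrite ler_wpDr// cmax// in_itv /= y0 y2.
have [C0 C00 h0] := bd G (Cinf_continuous cG) (fun y y2 => let: And3 a _ _ := zero y y2 in a).
have [C1 C10 h1] := bd _ (Cinf_continuous cG1) (fun y y2 => let: And3 _ a _ := zero y y2 in a).
have [C2 C20 h2] := bd _ (Cinf_continuous cG2) (fun y y2 => let: And3 _ _ a := zero y y2 in a).
exists G, (derive1 G), (derive1 (derive1 G)), (C0 + C1 + C2); split.
- by split=> //; rewrite !addr_gt0.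
- by move=> y; split; [exact: d0|exact: d1].
- split; first by rewrite /G mul0r.
  have ds := Cinf_is_derive 0 (@Cinf_step R).
  rewrite derive1E; have [_ ->] := dv_M (dv_id (0 : R)) ds.
  by rewrite mul1r mul0r addr0 step1.
- exact: zero.
move=> y y0; split.
- by apply: le_trans (h0 y y0) _; rewrite -addrA lerDl addr_ge0 ?ltW.
- by apply: le_trans (h1 y y0) _; rewrite addrAC lerDr addr_ge0 ?ltW.
- by apply: le_trans (h2 y y0) _; rewrite lerDr addr_ge0 ?ltW.
Unshelve. all: by end_near. Qed.

(** The function k G ((1 - cos (t - t0)) / k): as 1 - cos t is of the order of
    t^2, rescaling by k shrinks the support and keeps the second derivatives
    bounded, with value 1 at t0. *)
Lemma curvature_bump (R : realType) : exists2 C : R, 0 < C & forall k t0 : R, 0 < k -> k <= 1 ->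
  exists f : R -> R, [/\ Cinf f, forall t, f (t + 2 * pi) = f t,
    forall j t, (j <= 2)%N -> `|derive1n j f t| <= C,
    [/\ f t0 = 0, derive1 f t0 = 0 & derive1 (derive1 f) t0 = 1] &
    forall t, 2 * k < 1 - cos (t - t0) ->
      [/\ f t = 0, derive1 f t = 0 & derive1 (derive1 f) t = 0]].
Proof.
have [G [G1 [G2 [C [[cG C0] d01 [G00 G10] zero bd]]]]] := ramp_bounded R.
have d0 y : is_derive y (1 : R) G (G1 y) by have [] := d01 y.
have d1 y : is_derive y (1 : R) G1 (G2 y) by have [] := d01 y.
exists (5 * C); first by rewrite mulr_gt0.
move=> k t0 k0 k1; have kn := lt0r_neq0 k0.
pose z t := (1 - cos (t - t0)) / k.
have dz t : is_derive t (1 : R) z (sin (t - t0) / k).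
  apply: (dv_eq (dv_M (dv_D (dv_cst t 1) (dv_N (dv_cos (dv_D (dv_id t) (dv_cst t (- t0)))))) (dv_cst t k^-1))).
  by rewrite !addr0 !mulr0 !mulr1 addr0 add0r opprK.
pose f t := k * G (z t).
pose f1 t := G1 (z t) * sin (t - t0).
pose f2 t := G2 (z t) * (sin (t - t0) ^+ 2 / k) + G1 (z t) * cos (t - t0).
have df t : is_derive t (1 : R) f (f1 t).
  apply: (dv_eq (dv_M (dv_cst t k) (dv_comp (d0 (z t)) (dz t)))).
  by rewrite mul0r add0r /f1; field.
have df1 t : is_derive t (1 : R) f1 (f2 t).
  apply: (dv_eq (dv_M (dv_comp (d1 (z t)) (dz t)) (dv_sin (dv_D (dv_id t) (dv_cst t (- t0)))))).
  by rewrite addr0 mulr1 /f2; congr (_ + _); ring.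
have e1 : derive1 f = f1 := derive1_eq df.
have e2 : derive1 f1 = f2 := derive1_eq df1.
have z0 t : 0 <= z t by rewrite divr_ge0 ?subr_ge0 ?cos_le1 ?ltW.
have s1 t : `|sin (t - t0)| <= 1 by exact: sin_max.
have c1 t : `|cos (t - t0)| <= 1 by exact: cos_max.
have CC : C <= 5 * C by move: C0; clear; lra.
exists f; split.
- move=> n; apply: (@CnM R n (fun=> k) (fun t => G (z t))); first exact: Cn_cst.
  apply: (@Cn_comp R n G z); first exact: cG.
  by apply: CnM; [exact: Cinf_dist|exact: Cn_cst].
- by move=> t; rewrite /f /z addrAC cosD2piE.
- move=> [|[|[|//]]] t _.
  + have [h _ _] := bd _ (z0 t); rewrite /= /f normrM (gtr0_norm k0).
    apply: le_trans CC; apply: le_trans _ h; rewrite ler_piMl//.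
  + have [_ h _] := bd _ (z0 t).
    rewrite [derive1n _ _]e1 /f1 normrM; apply: le_trans CC; rewrite -[C]mulr1.
    exact: ler_pM.
  + have [_ h h2] := bd _ (z0 t).
    have -> : derive1n 2 f t = f2 t by rewrite -e2 -e1.
    rewrite /f2; apply: le_trans (ler_normD _ _) _.
    have k2 : `|G1 (z t) * cos (t - t0)| <= C by rewrite normrM -[C]mulr1; exact: ler_pM.
    suff k3 : `|G2 (z t) * (sin (t - t0) ^+ 2 / k)| <= 4 * C.
      by move: (lerD k3 k2); congr (_ <= _); ring.
    have [z2|z2] := ltP 2 (z t).
      by have [_ _ ->] := zero _ z2; rewrite mul0r normr0 mulr_ge0// ltW.
    rewrite normrM mulrC; apply: ler_pM => //.
    have sk : 0 <= sin (t - t0) ^+ 2 / k by exact: divr_ge0 (sqr_ge0 _) (ltW k0).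
    rewrite (ger0_norm sk) ler_pdivrMr// sin2cos2.
    move: z2; rewrite /z ler_pdivrMr// => z2.
    have := cos_le1 (t - t0); have := cos_geN1 (t - t0).
    move: (cos (t - t0)) z2 k0; clear => c h1 k0 h2 h3.
    have : (1 - c) * (1 + c) <= (2 * k) * 2 by apply: ler_pM; lra.
    by move=> h; apply: le_trans (le_trans h _); rewrite le_eqVlt; apply/orP; left; apply/eqP; ring.
- rewrite e1 e2 /f /f1 /f2 /z subrr cos0 sin0 subrr mul0r G00 G10.
  by split; [rewrite mulr0|rewrite mulr0|rewrite expr0n /= mul0r mulr0 add0r mulr1].
move=> t ht; have z2 : 2 < z t by rewrite /z ltr_pdivlMr.
have [g0 g1 g2] := zero _ z2.
by rewrite e1 e2 /f /f1 /f2 g0 g1 g2 mulr0 !mul0r addr0.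
Qed.

(** * Changing the curvature at three points *)

Lemma nbhs_curve (R : realType) (g : table R) (t0 : R) (V : set (R * R)) : nbhs (g t0) V ->
  exists2 k, 0 < k & forall t, 1 - cos (t - t0) <= k -> V (g t).
Proof.
move=> hV; have cg : continuous g by exact: smooth_ct (@table_smooth R g).
have /nbhs_ballP[r /= r0 hr] : nbhs t0 (g @^-1` V) by exact: cg.
have [k k0 hk] := circ_close t0 r0; exists k => // t /hk [u tu ut].
rewrite -(circ_eqP (@table_periodic R g) tu); apply: hr.
by rewrite -ball_normE /= distrC.
Qed.

Lemma pos_below (R : realType) (s : seq R) : (forall x, x \in s -> 0 < x) ->
  exists2 k : R, 0 < k & forall x, x \in s -> k < x.
Proof.
elim: s => [|x s IH] h; first by exists 1.
have [|k k0 hk] := IH; first by move=> y ys; apply: h; rewrite inE ys orbT.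
have x0 : 0 < x by apply: h; rewrite mem_head.
exists (Num.min k (x / 2)); first by rewrite lt_min k0 divr_gt0.
move=> y; rewrite inE => /orP[/eqP ->|/hk ky].
  by rewrite gt_min [x / 2 < x]ltr_pdivrMr// mulr_natr mulr2n ltrDl x0 orbT.
by rewrite gt_min ky.
Qed.

Lemma smooth3 (R : realType) (f1 f2 f3 : R -> R) (w1 w2 w3 : R * R) :
  Cinf f1 -> Cinf f2 -> Cinf f3 ->
  let F t := f1 t *: w1 + (f2 t *: w2 + f3 t *: w3) in
  smooth F /\ forall n t, derive1n n F t =
    derive1n n f1 t *: w1 + (derive1n n f2 t *: w2 + derive1n n f3 t *: w3).
Proof.
move=> c1 c2 c3 F.
have s1 := smooth_scalar (v := w1) c1; have s2 := smooth_scalar (v := w2) c2.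
have s3 := smooth_scalar (v := w3) c3; have s23 := smooth_add s2 s3.
split; first exact: (smooth_add s1 s23).
move=> n t; rewrite (congr1 (fun K => K t) (derive1n_add n s1 s23)).
rewrite (congr1 (fun K => _ + K t) (derive1n_add n s2 s3)).
rewrite (congr1 (fun K => K t + _) (derive1n_scalar w1 n c1)).
rewrite (congr1 (fun K => _ + (K t + _)) (derive1n_scalar w2 n c2)).
by rewrite (congr1 (fun K => _ + (_ + K t)) (derive1n_scalar w3 n c3)).
Qed.

(** eta is chosen before V: the C^2 size of the bumps does not depend on their
    support.  S lists points where the boundary must stay as it is. *)
Lemma three_point_perturb (R : realType) (g : table R) (O : R * R) (U : set (table R))
    (t1 t2 t3 : R) : table_interior g O -> Ck_nbhs 2 g U ->
  ~ circ_eq t1 t2 -> ~ circ_eq t1 t3 -> ~ circ_eq t2 t3 ->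
  exists2 eta : R, 0 < eta & forall w1 w2 w3 : R * R,
    `|w1| <= eta -> `|w2| <= eta -> `|w3| <= eta ->
  forall V : set (R * R), nbhs (g t1) V -> nbhs (g t2) V -> nbhs (g t3) V ->
  forall S : seq R, exists h : table R,
  [/\ U h, table_interior h O, forall t, ~ V (g t) -> h t = g t,
      [/\ [/\ h t1 = g t1, derive1 h t1 = derive1 g t1 &
              derive1 (derive1 h) t1 = derive1 (derive1 g) t1 + w1],
          [/\ h t2 = g t2, derive1 h t2 = derive1 g t2 &
              derive1 (derive1 h) t2 = derive1 (derive1 g) t2 + w2] &
          [/\ h t3 = g t3, derive1 h t3 = derive1 g t3 &
              derive1 (derive1 h) t3 = derive1 (derive1 g) t3 + w3]] &
      forall s, s \in S -> ~ circ_eq t1 s -> ~ circ_eq t2 s -> ~ circ_eq t3 s ->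
        [/\ h s = g s, derive1 h s = derive1 g s &
            derive1 (derive1 h) s = derive1 (derive1 g) s]].
Proof.
move=> Og [e e0 hU] n12 n13 n23.
have sg := @table_smooth R g.
have [C C0 bump] := curvature_bump R.
have [d1 d10 hd1] := table_perturb g.
have [d2 d20 hd2] := interior_perturb Og.
pose d := Num.min (e / 2) (Num.min d1 d2).
have d0 : 0 < d by rewrite !lt_min d10 d20 divr_gt0.
have de : d < e.
  by apply: (@le_lt_trans _ _ (e / 2)); [rewrite ge_min lexx|rewrite ltr_pdivrMr// mulr_natr mulr2n ltrDl].
have dd1 : d <= d1 by rewrite !ge_min lexx orbT.
have dd2 : d <= d2 by rewrite !ge_min lexx !orbT.
have C3 : 0 < 3 * C by rewrite mulr_gt0.
exists (d / (3 * C)); first exact: divr_gt0.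
move=> w1 w2 w3 hw1 hw2 hw3 V V1 V2 V3 S.
have [k1 k10 hk1] := nbhs_curve V1; have [k2 k20 hk2] := nbhs_curve V2.
have [k3 k30 hk3] := nbhs_curve V3.
pose T := [seq s <- S | `[< ~ circ_eq t1 s /\ ~ circ_eq t2 s /\ ~ circ_eq t3 s >]].
pose D (t s : R) := 1 - cos (s - t).
pose L := [:: 1; k1; k2; k3; D t1 t2; D t1 t3; D t2 t1; D t2 t3; D t3 t1; D t3 t2] ++
  ([seq D t1 s | s <- T] ++ ([seq D t2 s | s <- T] ++ [seq D t3 s | s <- T])).
have Dsym t s : D t s = D s t by rewrite /D -cosN opprB.
have TP s : s \in T -> ~ circ_eq t1 s /\ ~ circ_eq t2 s /\ ~ circ_eq t3 s.
  by rewrite mem_filter => /andP[/asboolP].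
have [k' k'0 hk'] : exists2 k, 0 < k & forall x, x \in L -> k < x.
  apply: pos_below => x; rewrite !mem_cat => /orP[|/or3P[]].
  - rewrite !inE => /orP[/eqP ->//|/orP[/eqP ->//|/orP[/eqP ->//|/orP[/eqP ->//|]]]].
    rewrite (Dsym t2 t1) (Dsym t3 t1) (Dsym t3 t2).
    have D12 := noncirc_dist n12; have D13 := noncirc_dist n13; have D23 := noncirc_dist n23.
    by move=> /orP[|/orP[|/orP[|/orP[|/orP[]]]]] => /eqP ->.
  - by move=> /mapP[s /TP [h _] ->]; exact: noncirc_dist.
  - by move=> /mapP[s /TP [_ [h _]] ->]; exact: noncirc_dist.
  - by move=> /mapP[s /TP [_ [_ h]] ->]; exact: noncirc_dist.
pose k := k' / 2.
have kk' : 2 * k = k' by rewrite mulrC divfK// pnatr_eq0.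
have k0 : 0 < k by exact: divr_gt0.
have inL x : x \in L -> 2 * k < x by rewrite kk'; exact: hk'.
have kle1 : k <= 1.
  have : 2 * k < 1 by apply: inL; rewrite mem_cat inE eqxx.
  by move: k0; move: (k) => z; clear; lra.
have [f1 [c1 p1 b1 [a10 a11 a12] z1]] := bump k t1 k0 kle1.
have [f2 [c2 p2 b2 [a20 a21 a22] z2]] := bump k t2 k0 kle1.
have [f3 [c3 p3 b3 [a30 a31 a32] z3]] := bump k t3 k0 kle1.
have [sF dF] := smooth3 w1 w2 w3 c1 c2 c3.
pose F t := f1 t *: w1 + (f2 t *: w2 + f3 t *: w3).
have {}sF : smooth F by exact: sF.
have {}dF n t : derive1n n F t = derive1n n f1 t *: w1 + (derive1n n f2 t *: w2 + derive1n n f3 t *: w3).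
  exact: dF.
have pF t : F (t + 2 * pi) = F t by rewrite /F p1 p2 p3.
have bF j t : (j <= 2)%N -> `|derive1n j F t| <= d.
  move=> j2; rewrite dF.
  have dE : d = C * (d / (3 * C)) + (C * (d / (3 * C)) + C * (d / (3 * C))).
    by have := lt0r_neq0 C0 => CN; field.
  rewrite [leRHS]dE; apply: le_trans (ler_normD _ _) _; apply: lerD.
    by rewrite normrZ; apply: ler_pM => //; exact: b1.
  apply: le_trans (ler_normD _ _) _; apply: lerD.
    by rewrite normrZ; apply: ler_pM => //; exact: b2.
  by rewrite normrZ; apply: ler_pM => //; exact: b3.
have [h hF] := hd1 F sF pF (fun j t j2 => le_trans (bF j t j2) dd1).
have hE : table_fun h = (fun t => g t + F t) by apply/funext.
have jet t : derive1 h t = derive1 g t + derive1 F t /\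
    derive1 (derive1 h) t = derive1 (derive1 g) t + derive1 (derive1 F) t.
  by rewrite hE; exact: curve_jets.
have F1 t : derive1 F t = derive1 f1 t *: w1 + (derive1 f2 t *: w2 + derive1 f3 t *: w3).
  exact: (dF 1%N t).
have F2 t : derive1 (derive1 F) t = derive1 (derive1 f1) t *: w1 +
    (derive1 (derive1 f2) t *: w2 + derive1 (derive1 f3) t *: w3).
  exact: (dF 2%N t).
have L12 : 2 * k < 1 - cos (t2 - t1) by apply: inL; rewrite mem_cat !inE eqxx !orbT.
have L13 : 2 * k < 1 - cos (t3 - t1) by apply: inL; rewrite mem_cat !inE eqxx !orbT.
have L21 : 2 * k < 1 - cos (t1 - t2) by apply: inL; rewrite mem_cat !inE eqxx !orbT.
have L23 : 2 * k < 1 - cos (t3 - t2) by apply: inL; rewrite mem_cat !inE eqxx !orbT.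
have L31 : 2 * k < 1 - cos (t1 - t3) by apply: inL; rewrite mem_cat !inE eqxx !orbT.
have L32 : 2 * k < 1 - cos (t2 - t3) by apply: inL; rewrite mem_cat !inE eqxx !orbT.
have addE0 (x y z : R * R) : x = y + z -> z = 0 -> x = y by move=> -> ->; rewrite addr0.
have addEw (x y z w : R * R) : x = y + z -> z = w -> x = y + w by move=> -> ->.
have c3E (a b c a' b' c' : R) : a = a' -> b = b' -> c = c' ->
    a *: w1 + (b *: w2 + c *: w3) = a' *: w1 + (b' *: w2 + c' *: w3) by move=> -> -> ->.
have c000 : (0 : R) *: w1 + ((0 : R) *: w2 + (0 : R) *: w3) = 0 by rewrite !scale0r !addr0.
have c100 : (1 : R) *: w1 + ((0 : R) *: w2 + (0 : R) *: w3) = w1 by rewrite !scale0r !addr0 scale1r.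
have c010 : (0 : R) *: w1 + ((1 : R) *: w2 + (0 : R) *: w3) = w2 by rewrite !scale0r addr0 add0r scale1r.
have c001 : (0 : R) *: w1 + ((0 : R) *: w2 + (1 : R) *: w3) = w3 by rewrite !scale0r !add0r scale1r.
exists h; split.
- apply: hU; apply: le_lt_trans de; apply: Ck_norm_le_bound; first exact: ltW.
  have -> : h \- g = F by apply/funext => t; rewrite /= hF addrC addKr.
  by move=> j t; exact: bF.
- apply: hd2 => t.
    by rewrite hF addrC addKr; apply: le_trans dd2; exact: (bF 0%N).
  have [-> _] := jet t; rewrite addrC addKr; apply: le_trans dd2; exact: (bF 1%N).
- move=> t Vt; rewrite hF /F.
  have far kk t' : (forall t, 1 - cos (t - t') <= kk -> V (g t)) -> kk \in L -> 2 * k < 1 - cos (t - t').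
    move=> hh kL; apply: lt_trans (inL _ kL) _; rewrite ltNge; apply/negP => hc.
    by apply: Vt; exact: hh.
  have [-> _ _] := z1 t (far _ _ hk1 ltac:(by rewrite mem_cat !inE eqxx !orbT)).
  have [-> _ _] := z2 t (far _ _ hk2 ltac:(by rewrite mem_cat !inE eqxx !orbT)).
  have [-> _ _] := z3 t (far _ _ hk3 ltac:(by rewrite mem_cat !inE eqxx !orbT)).
  by rewrite !scale0r !addr0.
- have [j11 j12] := jet t1; have [j21 j22] := jet t2; have [j31 j32] := jet t3.
  have [u0 u1 u2] := z2 t1 L21; have [v0 v1 v2] := z3 t1 L31.
  have [x0 x1 x2] := z1 t2 L12; have [y0 y1 y2] := z3 t2 L32.
  have [s0 s1 s2] := z1 t3 L13; have [r0 r1 r2] := z2 t3 L23.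
  split; split.
  + exact: addE0 _ _ _ (hF t1) (etrans (c3E _ _ _ _ _ _ a10 u0 v0) c000).
  + exact: addE0 _ _ _ j11 (etrans (F1 t1) (etrans (c3E _ _ _ _ _ _ a11 u1 v1) c000)).
  + exact: addEw _ _ _ _ j12 (etrans (F2 t1) (etrans (c3E _ _ _ _ _ _ a12 u2 v2) c100)).
  + exact: addE0 _ _ _ (hF t2) (etrans (c3E _ _ _ _ _ _ x0 a20 y0) c000).
  + exact: addE0 _ _ _ j21 (etrans (F1 t2) (etrans (c3E _ _ _ _ _ _ x1 a21 y1) c000)).
  + exact: addEw _ _ _ _ j22 (etrans (F2 t2) (etrans (c3E _ _ _ _ _ _ x2 a22 y2) c010)).
  + exact: addE0 _ _ _ (hF t3) (etrans (c3E _ _ _ _ _ _ s0 r0 a30) c000).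
  + exact: addE0 _ _ _ j31 (etrans (F1 t3) (etrans (c3E _ _ _ _ _ _ s1 r1 a31) c000)).
  + exact: addEw _ _ _ _ j32 (etrans (F2 t3) (etrans (c3E _ _ _ _ _ _ s2 r2 a32) c001)).
move=> s sS m1 m2 m3.
have sT : s \in T by rewrite mem_filter sS andbT; apply/asboolP.
have M1 : 2 * k < 1 - cos (s - t1).
  by apply: inL; rewrite !mem_cat; apply/orP; right; apply/orP; left; apply/mapP; exists s.
have M2 : 2 * k < 1 - cos (s - t2).
  by apply: inL; rewrite !mem_cat; apply/orP; right; apply/orP; right; apply/orP; left; apply/mapP; exists s.
have M3 : 2 * k < 1 - cos (s - t3).
  by apply: inL; rewrite !mem_cat; apply/orP; right; apply/orP; right; apply/orP; right; apply/mapP; exists s.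
have [j1 j2] := jet s; have [u0 u1 u2] := z1 s M1; have [v0 v1 v2] := z2 s M2.
have [w0 w1' w2'] := z3 s M3.
split.
- exact: addE0 _ _ _ (hF s) (etrans (c3E _ _ _ _ _ _ u0 v0 w0) c000).
- exact: addE0 _ _ _ j1 (etrans (F1 s) (etrans (c3E _ _ _ _ _ _ u1 v1 w1') c000)).
- exact: addE0 _ _ _ j2 (etrans (F2 s) (etrans (c3E _ _ _ _ _ _ u2 v2 w2') c000)).
Qed.

(** * The derivative along an orbit *)

Section OrbitPerturbation.
Context (R : realType) (O : R * R) (n : nat) (o : nat -> R * R).

(** With bend_in and twist, the three parameters of the derivative of the
    billiard map at the i-th point. *)
Definition bend_out (g : R -> R * R) i :=
  det2 (derive1 (derive1 g) (o i).1) (g (o i.+1).1 - O).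
Definition bend_in (g : R -> R * R) i :=
  det2 (g (o i).1 - O) (derive1 (derive1 g) (o i.+1).1).
Definition twist (g : R -> R * R) i :=
  det2 (derive1 g (o i).1) (derive1 g (o i.+1).1).

Lemma orbit_mod (g : table R) : periodic_orbit g O n o -> forall i,
  circ_eq (o i).1 (o (i %% n)%N).1.
Proof.
move=> po i; rewrite {1}(divn_eq i n); elim: (i %/ n)%N => [|q IH].
  by rewrite mul0n add0n; exact: circ_refl.
rewrite mulSn -addnA addnC.
have [c _] := orbit_period po (q * n + i %% n)%N.
exact: circ_trans c IH.
Qed.

Definition same1 (g h : R -> R * R) (t : R) := h t = g t /\ derive1 h t = derive1 g t.
Definition same2 (g h : R -> R * R) (t : R) :=
  [/\ h t = g t, derive1 h t = derive1 g t & derive1 (derive1 h) t = derive1 (derive1 g) t].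

Lemma same1_circ (g h : table R) (t u : R) : circ_eq t u -> same1 g h t -> same1 g h u.
Proof.
move=> c [e0 e1]; have [g0 g1 _] := circ_curve g c; have [h0 h1 _] := circ_curve h c.
split; first exact: (etrans h0 (etrans e0 (esym g0))).
exact: (etrans h1 (etrans e1 (esym g1))).
Qed.

Lemma same2_circ (g h : table R) (t u : R) : circ_eq t u -> same2 g h t -> same2 g h u.
Proof.
move=> c [e0 e1 e2]; have [g0 g1 g2] := circ_curve g c; have [h0 h1 h2] := circ_curve h c.
split; first exact: (etrans h0 (etrans e0 (esym g0))).
  exact: (etrans h1 (etrans e1 (esym g1))).
exact: (etrans h2 (etrans e2 (esym g2))).
Qed.

Lemma same1_all (g h : table R) : periodic_orbit g O n o ->
  (forall i, (i < n)%N -> same1 g h (o i).1) -> forall i, same1 g h (o i).1.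
Proof.
move=> po H i; have [n0 _ _ _ _] := po; apply: (same1_circ (circ_sym (orbit_mod po i))).
by apply: H; rewrite ltn_mod.
Qed.

Lemma same2_bend (g h : table R) i : same1 g h (o i).1 -> same2 g h (o i.+1).1 ->
  bend_in h i = bend_in g i.
Proof.
by move=> [e0 _] [_ _ e2]; exact: (congr2 (fun a b => det2 (a - O) b) e0 e2).
Qed.

Lemma same2_bend_out (g h : table R) i : same2 g h (o i).1 -> same1 g h (o i.+1).1 ->
  bend_out h i = bend_out g i.
Proof.
by move=> [_ _ e2] [e0 _]; exact: (congr2 (fun a b => det2 a (b - O)) e2 e0).
Qed.

Lemma same1_twist (g h : table R) i : same1 g h (o i).1 -> same1 g h (o i.+1).1 ->
  twist h i = twist g i.
Proof. by move=> [_ e1] [_ f1]; exact: (congr2 (fun a b => det2 a b) e1 f1). Qed.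

Lemma DbilliardE (g : table R) : periodic_orbit g O n o -> forall i,
  Dbilliard g O (o i) = shear (bend_in g i) *m turn (twist g i) *m shear (bend_out g i).
Proof. exact: Dbilliard_orbit. Qed.

Lemma twist_gt0 (g : table R) : periodic_orbit g O n o -> forall i, 0 < twist g i.
Proof. by move=> po i; have [] := orbit_momentum po i. Qed.

Lemma mdet_Dbilliard (g : table R) : periodic_orbit g O n o -> forall i,
  mdet (Dbilliard g O (o i)) = 1.
Proof.
move=> po i; rewrite (DbilliardE po) !mdetM !mdet_shear mdet_turn ?mulr1//.
exact: lt0r_neq0 (twist_gt0 po i).
Qed.

Lemma mdet_prod (g : table R) : periodic_orbit g O n o -> forall s : seq nat,
  mdet (\prod_(i <- s) Dbilliard g O (o i)) = 1.
Proof.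
move=> po s; elim: s => [|i s IH].
  by rewrite big_nil /mdet !mxE /= mulr1 mulr0 subr0.
by rewrite big_cons mdetM mdet_Dbilliard// mul1r IH.
Qed.

Lemma Dorbit_Sp1 (g : table R) : periodic_orbit g O n o -> @Sp1 R (Dorbit g O n o).
Proof. by move=> po; apply/Sp1E; exact: mdet_prod. Qed.

(** Rescaling the second derivative by c' / c takes a parameter linear in it
    from c to c'. *)
Lemma scaled_bend (v : R * R) (c c' : R) : c != 0 ->
  v + ((c' / c - 1) *: v) = (c' / c) *: v.
Proof. by move=> c0; rewrite scalerBl scale1r addrC subrK. Qed.

Lemma scaled_size (v : R * R) (c c' eta : R) : c != 0 -> 0 < eta ->
  `|c' - c| <= eta * `|c| / (`|v| + 1) -> `|(c' / c - 1) *: v| <= eta.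
Proof.
move=> c0 eta0 h; rewrite normrZ.
have v1 : 0 < `|v| + 1 by rewrite ltr_wpDl.
have -> : c' / c - 1 = (c' - c) / c by field.
rewrite normf_div mulrAC ler_pdivrMr ?normr_gt0//.
rewrite ler_pdivlMr// in h; apply: le_trans h.
by apply: ler_wpM2l => //; rewrite lerDl.
Qed.

End OrbitPerturbation.

(** Shears that meet at a bouncing point merge; Q stands for the rest of the
    orbit. *)
Lemma chain4 (R : realType) (Q : 'M[R]_2) (i0 i1 i2 i3 l0 l1 l2 l3 u0 u1 u2 u3 : R) :
  Q * ((shear i3 *m turn l3 *m shear u3) * ((shear i2 *m turn l2 *m shear u2) *
   ((shear i1 *m turn l1 *m shear u1) * (shear i0 *m turn l0 *m shear u0)))) =
  (Q *m (shear i3 *m turn l3)) *m block3 l1 l2 (i0 + u1) (i1 + u2) (i2 + u3) *m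
  (turn l0 *m shear u0).
Proof.
by rewrite -!mulmxE /block3 (addrC i0) (addrC i1) (addrC i2) -!shearD !mulmxA.
Qed.

Lemma chain4_congr (R : realType) (Q Q' : 'M[R]_2)
    (i i' l3 l3' l1 l1' l2 l2' c1 c1' c2 c2' c3 c3' l0 l0' u u' : R) :
  Q = Q' -> i = i' -> l3 = l3' -> l1 = l1' -> l2 = l2' -> c1 = c1' -> c2 = c2' ->
  c3 = c3' -> l0 = l0' -> u = u' ->
  (Q *m (shear i *m turn l3)) *m block3 l1 l2 c1 c2 c3 *m (turn l0 *m shear u) =
  (Q' *m (shear i' *m turn l3')) *m block3 l1' l2' c1' c2' c3' *m (turn l0' *m shear u').
Proof. by move=> -> -> -> -> -> -> -> -> -> ->. Qed.

(** * Orbits of period at least four *)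

Lemma prod_last4 (R : pzSemiRingType) (D : nat -> R) m :
  \prod_(i <- rev (iota 0 m.+4)) D i =
  (\prod_(i <- rev (iota 4 m)) D i) * (D 3 * (D 2 * (D 1 * D 0%N))).
Proof.
have -> : rev (iota 0 m.+4) = rev (iota 4 m) ++ [:: 3; 2; 1; 0]%N.
  by rewrite -[iota 0 m.+4]/([:: 0; 1; 2; 3]%N ++ iota 4 m) rev_cat.
by rewrite big_cat !big_cons big_nil /= mulr1.
Qed.

Lemma common_bound (R : realType) (a b c : R) : 0 < a -> 0 < b -> 0 < c ->
  exists2 d, 0 < d & [/\ d <= a, d <= b & d <= c].
Proof.
move=> a0 b0 c0; exists (Num.min a (Num.min b c)).
  by rewrite !lt_min a0 b0 c0.
by split; rewrite ?ge_min ?lexx ?orbT.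
Qed.

Section SimpleOrbit.
Context (R : realType) (O : R * R) (o : nat -> R * R).

Lemma bend_scaled (g h : table R) i (r : R) :
  same1 g h (o i).1 -> same1 g h (o i.+2).1 ->
  derive1 (derive1 h) (o i.+1).1 = r *: derive1 (derive1 g) (o i.+1).1 ->
  bend_in O o h i + bend_out O o h i.+1 = r * (bend_in O o g i + bend_out O o g i.+1).
Proof.
move=> [e0 _] [e2 _] e; rewrite /bend_in /bend_out mulrDr -det2Zr -det2Zl.
exact: (congr2 +%R (congr2 (fun a b => det2 (a - O) b) e0 e)
                   (congr2 (fun a b => det2 a (b - O)) e e2)).
Qed.

(** A step depends on the boundary through its 2-jets at both ends. *)
Lemma same2_Dbilliard n (g h : table R) : periodic_orbit g O n o -> periodic_orbit h O n o ->
  forall i, same2 g h (o i).1 -> same2 g h (o i.+1).1 ->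
  Dbilliard h O (o i) = Dbilliard g O (o i).
Proof.
move=> pg ph i s1 s2; rewrite (DbilliardE pg) (DbilliardE ph).
have [a0 a1 _] := s1; have [b0 b1 _] := s2.
have r1 : same1 g h (o i).1 by exact: conj a0 a1.
have r2 : same1 g h (o i.+1).1 by exact: conj b0 b1.
have e1 : bend_in O o h i = bend_in O o g i by exact: (same2_bend O r1 s2).
have e2 : bend_out O o h i = bend_out O o g i by exact: (same2_bend_out O s1 r2).
have e3 : twist o h i = twist o g i by exact: (same1_twist r1 r2).
by rewrite e1 e2 e3.
Qed.

Lemma Dorbit_chain4 (g : table R) m : periodic_orbit g O m.+4 o ->
  Dorbit g O m.+4 o =
  ((\prod_(i <- rev (iota 4 m)) Dbilliard g O (o i)) *m
    (shear (bend_in O o g 3) *m turn (twist o g 3))) *m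
  block3 (twist o g 1) (twist o g 2) (bend_in O o g 0 + bend_out O o g 1)
    (bend_in O o g 1 + bend_out O o g 2) (bend_in O o g 2 + bend_out O o g 3) *m
  (turn (twist o g 0) *m shear (bend_out O o g 0)).
Proof.
move=> po; rewrite /Dorbit prod_last4; set Q := \prod_(_ <- _) _.
rewrite !(DbilliardE po); exact: chain4.
Qed.

(** The perturbation is supported near the points 1, 2, 3.  By distinctness the
    steps from 4 on are unchanged, and so are the half shears at 0 and at 4. *)
Lemma simple_orbit_moves m (g : table R) (U : set (table R)) :
  table_interior g O -> periodic_orbit g O m.+4 o ->
  (forall i j, (i < m.+4)%N -> (j < m.+4)%N -> circ_eq (o i).1 (o j).1 -> i = j) ->
  Ck_nbhs 2 g U ->
  exists2 e : R, 0 < e &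
  forall A : 'M[R]_2, Sp1 A -> ball (Dorbit g O m.+4 o) e A ->
  forall V : set (R * R),
    nbhs (g (o 1).1) V -> nbhs (g (o 2).1) V -> nbhs (g (o 3).1) V ->
  exists h : table R,
    [/\ U h, table_interior h O, periodic_orbit h O m.+4 o,
        Dorbit h O m.+4 o = A &
        forall t, ~ V (g t) -> h t = g t].
Proof.
move=> gO po simp Ug.
have no i j : (i < m.+4)%N -> (j < m.+4)%N -> i != j -> ~ circ_eq (o i).1 (o j).1.
  by move=> im jm ij c; rewrite (simp i j im jm c) eqxx in ij.
have [eta eta0 Hp] := three_point_perturb gO Ug (no 1%N 2%N isT isT isT)
  (no 1%N 3%N isT isT isT) (no 2%N 3%N isT isT isT).
set c1 := bend_in O o g 0 + bend_out O o g 1.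
set c2 := bend_in O o g 1 + bend_out O o g 2.
set c3 := bend_in O o g 2 + bend_out O o g 3.
have c1n : c1 != 0 by exact: (ltr0_neq0 (orbit_bend po 0%N)).
have c2n : c2 != 0 by exact: (ltr0_neq0 (orbit_bend po 1%N)).
have c3n : c3 != 0 by exact: (ltr0_neq0 (orbit_bend po 2%N)).
set v1 := derive1 (derive1 g) (o 1).1.
set v2 := derive1 (derive1 g) (o 2).1.
set v3 := derive1 (derive1 g) (o 3).1.
have pos (c : R) (v : R * R) : c != 0 -> 0 < eta * `|c| / (`|v| + 1).
  by move=> cn; rewrite divr_gt0 ?mulr_gt0 ?normr_gt0// ltr_wpDl.
have [d d0 [d1 d2 d3]] := common_bound (pos c1 v1 c1n) (pos c2 v2 c2n) (pos c3 v3 c3n).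
have mQ : mdet ((\prod_(i <- rev (iota 4 m)) Dbilliard g O (o i)) *m
    (shear (bend_in O o g 3) *m turn (twist o g 3))) = 1.
  rewrite !mdetM (mdet_prod po) mdet_shear mdet_turn ?mulr1//.
  exact: lt0r_neq0 (twist_gt0 po 3).
have mW : mdet (turn (twist o g 0) *m shear (bend_out O o g 0)) = 1.
  rewrite !mdetM mdet_shear mdet_turn ?mulr1//.
  exact: lt0r_neq0 (twist_gt0 po 0).
have [e e0 He] := solve_three c1 c3 mQ mW (twist_gt0 po 1%N) (twist_gt0 po 2%N) c2n d0.
exists e => // A /Sp1E mA bA V V1 V2 V3.
rewrite (Dorbit_chain4 po) in bA.
have [c1' [c2' [c3' [k1 k2 k3 EA]]]] := He A mA bA.
have s1 := scaled_size c1n eta0 (le_trans k1 d1).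
have s2 := scaled_size c2n eta0 (le_trans k2 d2).
have s3 := scaled_size c3n eta0 (le_trans k3 d3).
have [h [Uh hO hV [[a0 a1 a2] [b0 b1 b2] [e0' e1' e2']] hS]] := Hp _ _ _ s1 s2 s3 V V1 V2 V3
  [seq (o i).1 | i <- iota 0 m.+4].
have other i : (i < m.+4)%N -> i != 1%N -> i != 2%N -> i != 3%N -> same2 g h (o i).1.
  move=> im i1 i2 i3; apply: hS.
  - by apply/mapP; exists i => //; rewrite mem_iota.
  - by apply: (no 1%N i isT im); rewrite eq_sym.
  - by apply: (no 2%N i isT im); rewrite eq_sym.
  - by apply: (no 3%N i isT im); rewrite eq_sym.
have s1all i : same1 g h (o i).1.
  apply: (same1_all po) => {}i im.
  have [->|i1] := eqVneq i 1%N; first exact: conj a0 a1.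
  have [->|i2] := eqVneq i 2%N; first exact: conj b0 b1.
  have [->|i3] := eqVneq i 3%N; first exact: conj e0' e1'.
  by have [x0 x1 _] := other i im i1 i2 i3; exact: conj x0 x1.
have ph : periodic_orbit h O m.+4 o.
  by apply: (orbit_transfer po) => i; have [] := s1all i.
have s2n i : (3 < i <= m.+4)%N -> same2 g h (o i).1.
  move=> /andP[i3 im]; have [im'|im'] := ltnP i m.+4.
    by apply: other => //; apply/eqP => ii; rewrite ii in i3.
  have -> : i = (0 + m.+4)%N by apply/eqP; rewrite add0n eqn_leq im im'.
  have [cc _] := orbit_period po 0%N.
  by apply: (same2_circ (circ_sym cc)); apply: other.
have E4 : \prod_(i <- rev (iota 4 m)) Dbilliard h O (o i) =
          \prod_(i <- rev (iota 4 m)) Dbilliard g O (o i).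
  apply: eq_big_seq => i; rewrite mem_rev mem_iota => /andP[i3 im].
  apply: (same2_Dbilliard po ph); apply: s2n.
  - by rewrite i3 /=; apply: ltnW; rewrite addnC addn4 in im.
  - by rewrite ltnW //=; rewrite addnC addn4 in im.
have tw i : twist o h i = twist o g i by exact: (same1_twist (s1all i) (s1all i.+1)).
have i3E : bend_in O o h 3 = bend_in O o g 3.
  exact: (same2_bend O (s1all 3) (s2n 4 isT)).
have u0E : bend_out O o h 0 = bend_out O o g 0.
  exact: (same2_bend_out O (other 0%N isT isT isT isT) (s1all 1%N)).
have B1 : bend_in O o h 0 + bend_out O o h 1 = c1'.
  have E := bend_scaled (s1all 0%N) (s1all 2%N) (etrans a2 (scaled_bend v1 c1' c1n)).
  by rewrite E -/c1 divfK.
have B2 : bend_in O o h 1 + bend_out O o h 2 = c2'.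
  have E := bend_scaled (s1all 1%N) (s1all 3%N) (etrans b2 (scaled_bend v2 c2' c2n)).
  by rewrite E -/c2 divfK.
have B3 : bend_in O o h 2 + bend_out O o h 3 = c3'.
  have E := bend_scaled (s1all 2%N) (s1all 4%N) (etrans e2' (scaled_bend v3 c3' c3n)).
  by rewrite E -/c3 divfK.
exists h; split; [exact: Uh|exact: hO|exact: ph| |exact: hV].
apply: (etrans (Dorbit_chain4 ph)); apply: etrans EA.
exact: (chain4_congr E4 i3E (tw 3) (tw 1%N) (tw 2) B1 B2 B3 (tw 0%N) u0E).
Qed.

End SimpleOrbit.

(** * Orbits of period three *)

Lemma chain3 (R : realType) (i0 i1 i2 l0 l1 l2 u0 u1 u2 : R) :
  (shear i2 *m turn l2 *m shear u2) * ((shear i1 *m turn l1 *m shear u1) *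
   ((shear i0 *m turn l0 *m shear u0) * 1)) =
  shear i2 *m closed3 l0 l1 l2 (i0 + u1) (i1 + u2) *m shear u0 :> 'M[R]_2.
Proof.
by rewrite mulr1 -!mulmxE /closed3 (addrC i0) (addrC i1) -!shearD !mulmxA.
Qed.

Lemma chain3_congr (R : realType) (i i' l0 l0' l1 l1' l2 l2' c1 c1' c2 c2' u u' : R) :
  i = i' -> l0 = l0' -> l1 = l1' -> l2 = l2' -> c1 = c1' -> c2 = c2' -> u = u' ->
  shear i *m closed3 l0 l1 l2 c1 c2 *m shear u =
  shear i' *m closed3 l0' l1' l2' c1' c2' *m shear u'.
Proof. by move=> -> -> -> -> -> -> ->. Qed.

(** The parameters of the two half shears at the first bouncing point are
    linear in v, with coefficients det2 v P and det2 Q v, where P and Q are the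
    positions of the next and of the previous point.  Their sum is proportional
    to the determinant of v and of the tangent a, so v = Q does unless the
    momentum s is zero; then P and Q lie on the tangent direction a, on
    opposite sides of the origin, and the second derivative b does. *)
Lemma balanced_direction (R : realType) (P Q a b : R * R) (c s x1 x2 : R) :
  0 < c -> P - Q = c *: a -> s = det2 Q a -> 0 < det2 a b ->
  (s = 0 -> [/\ P = x1 *: a, Q = x2 *: a, 0 < x1 & x2 < 0]) ->
  exists v, 0 <= det2 v P * det2 Q v /\ det2 v P + det2 Q v != 0.
Proof.
move=> c0 E sE k0 H.
have sum v : det2 v P + det2 Q v = c * det2 v a.
  by rewrite -det2Zr -E det2Br (det2C Q).
have [s0|s0] := eqVneq s 0; last first.
  exists Q; split; first by rewrite det2vv mulr0.
  by rewrite sum -sE mulf_neq0 // gt_eqF.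
have [PE QE x1p x2n] := H s0; exists b; split; last first.
  have n0 : det2 b a != 0 by rewrite det2C oppr_eq0 (lt0r_neq0 k0).
  rewrite sum; exact: (mulf_neq0 (lt0r_neq0 c0) n0).
rewrite PE QE det2Zr det2Zl det2C.
have -> : x1 * - det2 a b * (x2 * det2 a b) = (x1 * - x2) * det2 a b ^+ 2.
  by move: (det2 a b) => k; ring.
by rewrite mulr_ge0 ?sqr_ge0// mulr_ge0 ?oppr_ge0 ?ltW.
Qed.

(** p - O is parallel to the tangent a of another bouncing point, and O lies on
    the left of the tangent b at p. *)
Lemma collinear_inside (R : realType) (a b p O : R * R) (x : R) :
  p - O = x *: a -> 0 < det2 b (O - p) ->
  (0 < det2 a b -> 0 < x) /\ (0 < det2 b a -> x < 0).
Proof.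
move=> e; have -> : O - p = - x *: a by rewrite scaleNr -e opprB.
rewrite det2Zr mulNr oppr_gt0 => h; split=> k; last by rewrite -(pmulr_llt0 x k).
by move: h; rewrite det2C mulrN oppr_lt0 pmulr_lgt0.
Qed.

Section Triangle.
Context (R : realType) (O : R * R) (o : nat -> R * R).

Lemma Dorbit_chain3 (g : table R) : periodic_orbit g O 3 o ->
  Dorbit g O 3 o = shear (bend_in O o g 2) *m
    closed3 (twist o g 0) (twist o g 1) (twist o g 2) (bend_in O o g 0 + bend_out O o g 1)
      (bend_in O o g 1 + bend_out O o g 2) *m shear (bend_out O o g 0).
Proof.
move=> po; rewrite /Dorbit -[rev (iota 0 3)]/([:: 2; 1; 0]%N) !big_cons big_nil.
rewrite !(DbilliardE po); exact: chain3.
Qed.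

Lemma triangle_direction (g : table R) : table_interior g O -> periodic_orbit g O 3 o ->
  exists v, 0 <= det2 v (g (o 1%N).1 - O) * det2 (g (o 2).1 - O) v /\
            det2 v (g (o 1%N).1 - O) + det2 (g (o 2).1 - O) v != 0.
Proof.
move=> gO po.
have [[c3 s3] [c4 _]] := (orbit_period po 0%N, orbit_period po 1%N).
have [g3 d3 _] := circ_curve g c3; have [g4 _ _] := circ_curve g c4.
have [c cp chord] := orbit_chord po 2.
have E : (g (o 1%N).1 - O) - (g (o 2).1 - O) = c *: derive1 g (o 0%N).1.
  have -> : (g (o 1%N).1 - O) - (g (o 2).1 - O) = g (o 1%N).1 - g (o 2).1.
    by rewrite opprB addrA subrK.
  exact: (etrans (congr1 (fun z => z - g (o 2).1) g4) (etrans chord (congr1 (fun z => c *: z) (esym d3)))).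
have [m0 _ l0] := orbit_momentum po 0%N; have [_ m2 l2] := orbit_momentum po 2.
have m2' : (o 0%N).2 = det2 (g (o 2).1 - O) (derive1 g (o 0%N).1).
  exact: (etrans (esym s3) (etrans m2 (congr1 (det2 _) (esym d3)))).
have l2' : 0 < det2 (derive1 g (o 2).1) (derive1 g (o 0%N).1).
  by rewrite (congr1 (det2 _) d3 : det2 (derive1 g (o 2).1) _ = _).
have a0 := @table_regular R g (o 0%N).1.
have k0 := table_det_gt0 g (o 0%N).1.
have i1 := table_interior_inside gO (o 1%N).1.
have i2 := table_interior_inside gO (o 2).1.
have H : (o 0%N).2 = 0 -> exists x1, exists x2, [/\ g (o 1%N).1 - O = x1 *: derive1 g (o 0%N).1,
   g (o 2).1 - O = x2 *: derive1 g (o 0%N).1, 0 < x1 & x2 < 0].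
  move=> s0.
  have z1 : det2 (derive1 g (o 0%N).1) (g (o 1%N).1 - O) = 0.
    by apply/eqP; rewrite -oppr_eq0 -m0 s0.
  have z2 : det2 (derive1 g (o 0%N).1) (g (o 2).1 - O) = 0.
    by rewrite det2C -m2' s0 oppr0.
  have [x1 e1] := det2_collinear a0 z1; have [x2 e2] := det2_collinear a0 z2.
  exists x1, x2; split; [exact: e1|exact: e2| |].
    have [K _] := collinear_inside e1 i1; exact: (K l0).
  have [_ K] := collinear_inside e2 i2; exact: (K l2').
have [s0|/eqP s0] := eqVneq (o 0%N).2 0.
  have [x1 [x2 K]] := H s0.
  exact: (balanced_direction cp E m2' k0 (fun=> K)).
by apply: (balanced_direction (x1 := 0) (x2 := 0) cp E m2' k0) => /s0.
Qed.

(** The second derivative moves along the direction v at the point 0 and is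
    rescaled at the points 1 and 2. *)
Lemma triangle_moves (g : table R) (U : set (table R)) :
  table_interior g O -> periodic_orbit g O 3 o -> Ck_nbhs 2 g U ->
  exists2 e : R, 0 < e &
  forall A : 'M[R]_2, Sp1 A -> ball (Dorbit g O 3 o) e A ->
  forall V : set (R * R),
    nbhs (g (o 0%N).1) V -> nbhs (g (o 1%N).1) V -> nbhs (g (o 2).1) V ->
  exists h : table R,
    [/\ U h, table_interior h O, periodic_orbit h O 3 o,
        Dorbit h O 3 o = A &
        forall t, ~ V (g t) -> h t = g t].
Proof.
move=> gO po Ug.
have [eta eta0 Hp] := three_point_perturb gO Ug (orbit_neq1 (i := 0%N) po) (orbit_neq2 (i := 0%N) po)
  (orbit_neq1 (i := 1%N) po).
have [v [pq0 pq]] := triangle_direction gO po.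
have [[c3 _] [c4 _]] := (orbit_period po 0%N, orbit_period po 1%N).
set c1 := bend_in O o g 0 + bend_out O o g 1.
set c2 := bend_in O o g 1 + bend_out O o g 2.
have c1l : c1 < 0 by exact: (orbit_bend po 0%N).
have c2l : c2 < 0 by exact: (orbit_bend po 1%N).
have c1n := ltr0_neq0 c1l; have c2n := ltr0_neq0 c2l.
set v1 := derive1 (derive1 g) (o 1%N).1.
set v2 := derive1 (derive1 g) (o 2).1.
have pos (c : R) (u : R * R) : c != 0 -> 0 < eta * `|c| / (`|u| + 1).
  by move=> cn; rewrite divr_gt0 ?mulr_gt0 ?normr_gt0// ltr_wpDl.
have [d d0 [d1 d2 d3]] := common_bound (pos c1 v1 c1n) (pos c2 v2 c2n) (pos 1 v (oner_neq0 _)).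
have [e e0 He] := solve_closed (bend_out O o g 0) (bend_in O o g 2)
  (twist_gt0 po 0%N) (twist_gt0 po 1%N) (twist_gt0 po 2) c1l c2l pq0 pq d0.
exists e => // A /Sp1E mA bA V V0 V1 V2.
rewrite (Dorbit_chain3 po) in bA.
have [x [c1' [c2' [k0 k1 k2 EA]]]] := He A mA bA.
have s1 := scaled_size c1n eta0 (le_trans k1 d1).
have s2 := scaled_size c2n eta0 (le_trans k2 d2).
have s0 : `|x *: v| <= eta.
  have k : `|(1 + x) - 1| <= eta * `|1| / (`|v| + 1).
    by rewrite addrC addKr; exact: le_trans k0 d3.
  by have := scaled_size (oner_neq0 _) eta0 k; rewrite divr1 addrC addKr.
have [h [Uh hO hV [[a0 a1 a2] [b0 b1 b2] [e0' e1' e2']] _]] := Hp _ _ _ s0 s1 s2 V V0 V1 V2 [::].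
have s1all i : same1 g h (o i).1.
  apply: (same1_all po) => {}i im.
  have [->|i1] := eqVneq i 0%N; first exact: conj a0 a1.
  have [->|i2] := eqVneq i 1%N; first exact: conj b0 b1.
  have -> : i = 2 by move: i im i1 i2 => [|[|[|]]].
  exact: conj e0' e1'.
have ph : periodic_orbit h O 3 o.
  by apply: (orbit_transfer po) => i; have [] := s1all i.
have tw i : twist o h i = twist o g i by exact: (same1_twist (s1all i) (s1all i.+1)).
have B1 : bend_in O o h 0 + bend_out O o h 1 = c1'.
  have E := bend_scaled O (s1all 0%N) (s1all 2%N) (etrans b2 (scaled_bend v1 c1' c1n)).
  by rewrite E -/c1 divfK.
have B2 : bend_in O o h 1 + bend_out O o h 2 = c2'.
  have E := bend_scaled O (s1all 1%N) (s1all 3%N) (etrans e2' (scaled_bend v2 c2' c2n)).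
  by rewrite E -/c2 divfK.
have Bo : bend_out O o h 0 = bend_out O o g 0 + det2 v (g (o 1%N).1 - O) * x.
  have [f0 _] := s1all 1%N.
  rewrite mulrC -det2Zl -det2Dl.
  exact: (congr2 (fun a b => det2 a (b - O)) a2 f0).
have Bi : bend_in O o h 2 = bend_in O o g 2 + det2 (g (o 2).1 - O) v * x.
  have [f0 _] := s1all 2.
  have [_ _ g3] := circ_curve g c3; have [_ _ h3] := circ_curve h c3.
  have e3 : derive1 (derive1 h) (o 3).1 = derive1 (derive1 g) (o 3).1 + x *: v.
    exact: (etrans (esym h3) (etrans a2 (congr1 (fun z => z + x *: v) g3))).
  rewrite mulrC -det2Zr -det2Dr.
  exact: (congr2 (fun a b => det2 (a - O) b) f0 e3).
exists h; split; [exact: Uh|exact: hO|exact: ph| |exact: hV].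
apply: (etrans (Dorbit_chain3 ph)); apply: etrans EA.
exact: (chain3_congr Bi (tw 0%N) (tw 1%N) (tw 2) B1 B2 Bo).
Qed.

End Triangle.

(** * Compactness and counting *)

(** If P failed for K, the sets that contain K up to a part satisfying P would
    form a proper filter, and a cluster point of it would contradict the local
    hypothesis. *)
Lemma compact_induction (T : topologicalType) (K : set T) (P : set T -> Prop) :
  compact K -> P set0 -> (forall X Y, X `<=` Y -> P Y -> P X) ->
  (forall X Y, P X -> P Y -> P (X `|` Y)) ->
  (forall u, K u -> exists2 N, nbhs u N & P (K `&` N)) -> P K.
Proof.
move=> cK P0 mono union loc; apply: contrapT => nP.
pose F : set_system T := [set S | P (K `\` S)].
have FF : Filter F.
  split; rewrite /F /=.
  - by rewrite setDT.
  - by move=> A B PA PB; move: (union _ _ PA PB); rewrite -setDIr.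
  - by move=> A B AB; apply: mono; exact: setDS.
have PF : ProperFilter F.
  by split=> //; rewrite /F /= setD0.
have FK : F K by rewrite /F /= setDv.
have [u [Ku cu]] := cK F PF FK.
have [N uN PN] := loc u Ku.
have FN : F (~` N) by rewrite /F /= setDE setCK.
by have [x []] := cu _ _ FN uN.
Qed.

(** A grid of N^(n+1) points z against a subdivision of the cube of u's into
    (L N)^n cells: for N > L^n two distinct grid points are bad for u's in a
    common cell, which contradicts the Lipschitz bound when L is large. *)
Lemma lipschitz_pigeonhole (R : realType) n (bad : ('I_n.+1 -> R) -> ('I_n -> R) -> Prop)
    (u0 : 'I_n -> R) (rho C delta : R) : 0 < rho -> 0 <= C -> 0 < delta ->
  (forall z z' u u', (forall i, 0 <= z i <= delta) -> (forall i, 0 <= z' i <= delta) ->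
     (forall j, `|u j - u0 j| <= rho) -> (forall j, `|u' j - u0 j| <= rho) ->
     bad z u -> bad z' u' -> forall s, 0 <= s -> (forall j, `|u j - u' j| <= s) ->
     forall i, `|z i - z' i| <= C * s) ->
  exists2 z, forall i, 0 <= z i <= delta &
    forall u, (forall j, `|u j - u0 j| <= rho) -> ~ bad z u.
Proof.
move=> rho0 C0 delta0 lip; apply: contrapT => none.
have hit z : (forall i, 0 <= z i <= delta) ->
    exists u, (forall j, `|u j - u0 j| <= rho) /\ bad z u.
  move=> hz; apply: contrapT => nu; apply: none; exists z => // u hu bu.
  by apply: nu; exists u.
pose L := (Num.truncn (3 * rho * C / delta)).+1.
have L0 : (0 < L%:R :> R) by rewrite ltr0n.
have hL : 3 * rho * C / delta < L%:R by exact: truncnS_gt.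
pose N := (L ^ n).+1.
have N0 : (0 < N%:R :> R) by rewrite ltr0n.
pose zf (f : {ffun 'I_n.+1 -> 'I_N}) (i : 'I_n.+1) : R := delta * (f i)%:R / N%:R.
have hzf f i : 0 <= zf f i <= delta.
  rewrite /zf divr_ge0 ?mulr_ge0 ?ler0n ?(ltW delta0)//= ler_pdivrMr// ler_wpM2l ?(ltW delta0)//.
  by rewrite ler_nat ltnW.
pose uf f := projT1 (cid (hit _ (hzf f))).
have uf1 f j : `|uf f j - u0 j| <= rho by rewrite /uf; case: cid => u /= [].
have uf2 f : bad (zf f) (uf f) by rewrite /uf; case: cid => u /= [].
pose K := (L * N)%N.
have K0 : (0 < K%:R :> R) by rewrite ltr0n muln_gt0.
(* Dividing by 3 rho instead of 2 rho keeps the right end of the cube in the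
   last cell. *)
pose y f j := (uf f j - u0 j + rho) / (3 * rho) * K%:R.
have r3 : 0 < 3 * rho by rewrite mulr_gt0.
have hy f j : 0 <= y f j < K%:R.
  have := uf1 f j; rewrite ler_norml => /andP[h1 h2].
  have a0 : 0 <= uf f j - u0 j + rho by move: h1; clear; lra.
  rewrite /y mulr_ge0 ?divr_ge0 ?(ltW r3) ?(ltW K0)//= gtr_pMl// ltr_pdivrMr// mul1r.
  by move: h2 rho0; clear; lra.
have hc f j : (Num.truncn (y f j) < K)%N.
  by have /andP[h1 h2] := hy f j; rewrite -(ltr_nat R); apply: le_lt_trans h2; rewrite truncn_le.
pose c (f : {ffun 'I_n.+1 -> 'I_N}) : {ffun 'I_n -> 'I_K} := [ffun j => Ordinal (hc f j)].
have [f [f' [ff' cc]]] : exists f, exists f', f != f' /\ c f = c f'.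
  apply: contrapT => inj.
  have ci : injective c.
    move=> f f' e; apply: contrapT => /eqP ne; apply: inj; by exists f, f'.
  have := leq_card c ci; rewrite !card_ffun !card_ord /K expnMn expnS.
  by rewrite leq_mul2r expn_eq0 /= /N ltnn.
have near j : `|uf f j - uf f' j| <= 3 * rho / K%:R.
  have := congr1 (fun h : {ffun 'I_n -> 'I_K} => nat_of_ord (h j)) cc; rewrite !ffunE /= => e.
  have /andP[p1 _] := hy f j; have /andP[p2 _] := hy f' j.
  have a1 : (Num.truncn (y f j))%:R <= y f j by rewrite truncn_le.
  have a2 : (Num.truncn (y f' j))%:R <= y f' j by rewrite truncn_le.
  have b1 := truncnS_gt (y f j); have b2 := truncnS_gt (y f' j).
  rewrite e in a1 b1.
  have : `|y f j - y f' j| <= 1.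
    rewrite -natr1 in b1 b2; rewrite ler_norml; move: a1 a2 b1 b2; clear; lra.
  have -> : y f j - y f' j = (uf f j - uf f' j) * (K%:R / (3 * rho)).
    rewrite /y; field; exact: lt0r_neq0.
  rewrite normrM (gtr0_norm (divr_gt0 K0 r3)) => h.
  have -> : 3 * rho / K%:R = (K%:R / (3 * rho))^-1 by rewrite invf_div.
  by rewrite -[leRHS]mul1r ler_pdivlMr ?divr_gt0.
have [i fi] : exists i, f i != f' i.
  apply: contrapT => h; move/eqP: ff'; apply; apply/ffunP => i.
  by apply: contrapT => /eqP k; apply: h; exists i.
have s0 : 0 <= 3 * rho / K%:R by rewrite divr_ge0 ?ltW.
have := lip _ _ _ _ (hzf f) (hzf f') (uf1 f) (uf1 f') (uf2 f) (uf2 f') _ s0 near i.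
have -> : zf f i - zf f' i = ((f i)%:R - (f' i)%:R) * (delta / N%:R) by rewrite /zf; field; exact: lt0r_neq0.
rewrite normrM (gtr0_norm (divr_gt0 delta0 N0)) => h.
have one : 1 <= `|(f i)%:R - (f' i)%:R : R|.
  have ne : (nat_of_ord (f i)) != (f' i) by [].
  rewrite -[(f i)%:R]/((f i)%:Z%:~R) -[(f' i)%:R]/((f' i)%:Z%:~R) -intrB -intr_norm.
  rewrite -[1]/(1%:~R) ler_int; move: ne; clear; lia.
have h1 : delta / N%:R <= C * (3 * rho / K%:R).
  by apply: le_trans h; rewrite ler_peMl// ltW// divr_gt0.
have : delta * L%:R <= 3 * rho * C.
  move: h1; rewrite /K natrM ler_pdivrMr// => h1; rewrite -ler_pdivlMr//; apply: le_trans h1 _.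
  by rewrite le_eqVlt; apply/orP; left; apply/eqP; field; rewrite !lt0r_neq0.
move: hL; rewrite ltr_pdivrMr// [L%:R * _]mulrC => k1 k2.
by have := le_lt_trans k2 k1; rewrite ltxx.
Qed.

(** * A family of perturbations with prescribed jets *)

(** Squaring the plateau e makes its derivative vanish wherever e does, in
    particular on the boundary of the support; beta is e^2 times a sine, and
    the factor 1 - d sin in gamma cancels the derivative of e^2 at t0. *)
Lemma jet_bumps (R : realType) (t0 k : R) : 0 < k -> exists beta gamma : R -> R,
  [/\ Cinf beta /\ Cinf gamma,
      (forall t, beta (t + 2 * pi) = beta t) /\ (forall t, gamma (t + 2 * pi) = gamma t),
      beta t0 = 0 /\ derive1 beta t0 = 1,
      gamma t0 = 1 /\ derive1 gamma t0 = 0 &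
      forall t, 2 * k <= 1 - cos (t - t0) ->
        [/\ beta t = 0, derive1 beta t = 0, gamma t = 0 & derive1 gamma t = 0]].
Proof.
move=> k0; have kn := lt0r_neq0 k0.
pose e t := step ((1 - cos (t - t0)) / k).
have ce : Cinf e.
  move=> n; apply: (@Cn_comp R n (@step R) (fun t => (1 - cos (t - t0)) / k)); first exact: Cinf_step.
  by apply: CnM; [exact: Cinf_dist|exact: Cn_cst].
have cs : Cinf (fun t => sin (t - t0)).
  move=> n; apply: (@Cn_comp R n (@sin R) (fun t => t - t0)); first exact: Cinf_sin.
  by apply: CnD; [exact: Cinf_id|exact: Cn_cst].
have pe t : e (t + 2 * pi) = e t by rewrite /e addrAC cosD2piE.
have ps t : sin (t + 2 * pi - t0) = sin (t - t0) by rewrite addrAC sinD2piE.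
have e0 : e t0 = 1 by rewrite /e subrr cos0 subrr mul0r step1.
pose d := 2 * derive1 e t0.
have dsin t : is_derive t (1 : R) (fun t => sin (t - t0)) (cos (t - t0)).
  by apply: (dv_eq (dv_sin (dv_D (dv_id t) (dv_cst t (- t0))))); rewrite addr0 mulr1.
have de t : is_derive t (1 : R) e (derive1 e t) by exact: Cinf_is_derive.
have de2 t : is_derive t (1 : R) (fun t => e t * e t) (derive1 e t * e t + e t * derive1 e t).
  exact: dv_M.
pose beta t := e t * e t * sin (t - t0).
pose gamma t := e t * e t * (1 - d * sin (t - t0)).
have db t : derive1 beta t = (derive1 e t * e t + e t * derive1 e t) * sin (t - t0) + e t * e t * cos (t - t0).
  by rewrite derive1E; have [] := dv_M (de2 t) (dsin t).
have dg t : derive1 gamma t = (derive1 e t * e t + e t * derive1 e t) * (1 - d * sin (t - t0)) +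
    e t * e t * (0 - (0 * sin (t - t0) + d * cos (t - t0))).
  by rewrite derive1E; have [] := dv_M (de2 t) (dv_D (dv_cst t 1) (dv_N (dv_M (dv_cst t d) (dsin t)))).
exists beta, gamma; split.
- split=> n; apply: (@CnM R n (fun t => e t * e t)).
  + exact: CnM.
  + exact: cs.
  + exact: CnM.
  + apply: CnD; first exact: Cn_cst.
    by apply: CnN; apply: CnM; [exact: Cn_cst|exact: cs].
- by split=> t; rewrite /beta /gamma pe ps.
- split; first by rewrite /beta subrr sin0 mulr0.
  by rewrite db subrr sin0 cos0 e0 mulr0 add0r !mulr1.
- split; first by rewrite /gamma subrr sin0 e0 mulr0 subr0 !mulr1.
  rewrite dg subrr sin0 cos0 e0 /d; move: (derive1 e t0) => x; ring.
move=> t ht.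
have et : e t = 0 by rewrite /e step0// ler_pdivlMr.
by rewrite db dg /beta /gamma et !(mulr0, mul0r, addr0).
Qed.

Lemma smooth_lipschitz (R : realType) (f : R -> R * R) (M : R) : smooth f ->
  (forall t, `|derive1 f t| <= M) -> forall s t, `|f t - f s| <= M * `|t - s|.
Proof.
move=> sf fM.
have wlog1 s t : s < t -> `|f t - f s| <= M * `|t - s|.
  move=> st; apply/norm_pair_le; split.
  - have [c _ e] := mvt st (fun x _ => smooth_dv1 x sf).
    rewrite [_.1]e normrM; apply: ler_wpM2r => //; exact: le_trans (norm1_le _) (fM c).
  - have [c _ e] := mvt st (fun x _ => smooth_dv2 x sf).
    rewrite [_.2]e normrM; apply: ler_wpM2r => //; exact: le_trans (norm2_le _) (fM c).
move=> s t; have [st|ts|->] := ltgtP s t; [exact: wlog1| |by rewrite !subrr !normr0 mulr0].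
by rewrite distrC (distrC t); exact: wlog1.
Qed.

Lemma det1_partner (R : realType) (v : R * R) : v != 0 -> exists w, det2 v w = 1.
Proof.
move=> v0; have n0 := speed_gt0 v0.
exists ((v.1 ^+ 2 + v.2 ^+ 2)^-1 *: (- v.2, v.1)).
rewrite det2Zr /det2 /=; move: n0; move: v.1 v.2 => a b n0.
have -> : a * a - b * - b = a ^+ 2 + b ^+ 2 by ring.
by rewrite mulVf// lt0r_neq0.
Qed.

Section Family.
Context (R : realType) (q : nat) (v0 : 'I_q -> R) (k : R) (bb : 'I_q)
  (nu : 'I_q -> R * R) (w : R * R).
Hypothesis (k0 : 0 < k) (sep : forall i j, i != j -> 2 * k <= 1 - cos (v0 j - v0 i)).

(** Index r + 1 moves the tangent at v0 r in the direction nu r, and index 0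
    moves the point at v0 bb in the direction w; at the other points of the
    configuration nothing changes to first order. *)
Lemma jet_family : exists phi : 'I_q.+1 -> R -> R * R,
  [/\ forall i, smooth (phi i), forall i t, phi i (t + 2 * pi) = phi i t &
   forall (z : 'I_q.+1 -> R) j,
     \sum_i z i *: phi i (v0 j) = (z ord0 * (j == bb)%:R) *: w /\
     \sum_i z i *: derive1 (phi i) (v0 j) = z (lift ord0 j) *: nu j].
Proof.
have /choice[beta hb] := fun r => jet_bumps (v0 r) k0.
have /choice[gamma hg] := hb.
pose phi (i : 'I_q.+1) (t : R) : R * R :=
  if unlift ord0 i is Some r then beta r t *: nu r else gamma bb t *: w.
have phi0 : phi ord0 = fun t => gamma bb t *: w by apply/funext => t; rewrite /phi unlift_none.
have phiS r : phi (lift ord0 r) = fun t => beta r t *: nu r by apply/funext => t; rewrite /phi liftK.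
have cb r : Cinf (beta r) by have [[]] := hg r.
have cg r : Cinf (gamma r) by have [[]] := hg r.
have d0 t : derive1 (phi ord0) t = derive1 (gamma bb) t *: w.
  rewrite phi0; exact: (congr1 (fun f => f t) (derive1n_scalar w 1 (cg bb))).
have dS r t : derive1 (phi (lift ord0 r)) t = derive1 (beta r) t *: nu r.
  rewrite phiS; exact: (congr1 (fun f => f t) (derive1n_scalar (nu r) 1 (cb r))).
exists phi; split.
- move=> i; case: (unliftP ord0 i) => [r ->|->].
  + by rewrite phiS; apply: smooth_scalar.
  + by rewrite phi0; apply: smooth_scalar.
- move=> i t; have [] := (hg bb); case: (unliftP ord0 i) => [r ->|->].
  + by move=> *; have [_ [pb _] _ _ _] := hg r; rewrite phiS pb.
  + by move=> _ [_ pg] _ _ _; rewrite phi0 pg.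
move=> z j; rewrite !big_ord_recl d0 phi0; split.
- rewrite big1 ?addr0 => [|r _]; last first.
    rewrite phiS; have [_ _ [b0 _] _ far] := hg r.
    have [<-|rj] := eqVneq r j; first by rewrite b0 scale0r scaler0.
    by have [-> _ _ _] := far _ (sep rj); rewrite scale0r scaler0.
  rewrite -scalerA; congr (_ *: (_ *: _)).
  have [_ _ _ [g0 _] far] := hg bb; have [->|jb] := eqVneq j bb; first exact: g0.
  by rewrite eq_sym in jb; have [_ _ -> _] := far _ (sep jb).
- have -> : derive1 (gamma bb) (v0 j) = 0.
    have [_ _ _ [_ g0] far] := hg bb; have [->|jb] := eqVneq j bb; first exact: g0.
    by rewrite eq_sym in jb; have [_ _ _ K] := far _ (sep jb); exact: K.
  rewrite scale0r scaler0 add0r (bigD1 j)//= big1 ?addr0 => [|r rj].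
    by rewrite dS; have [_ _ [_ b0] _ _] := hg j; rewrite b0 scale1r.
  by rewrite dS; have [_ _ _ _ far] := hg r; have [_ K _ _] := far _ (sep rj); rewrite K scale0r scaler0.
Qed.

(** The combinations of jet_family, with bounds that are linear in the
    coefficients. *)
Lemma perturbation_family : exists Phi : ('I_q.+1 -> R) -> R -> R * R,
  [/\ forall z, smooth (Phi z) /\ forall t, Phi z (t + 2 * pi) = Phi z t,
   forall z z' t, Phi z t = Phi z' t + Phi (fun i => z i - z' i) t /\
     derive1 (Phi z) t = derive1 (Phi z') t + derive1 (Phi (fun i => z i - z' i)) t,
   forall m, exists2 C, 0 < C & forall z d, (forall i, `|z i| <= d) ->
     forall j t, (j <= m)%N -> `|derive1n j (Phi z) t| <= C * d &
   forall z j, Phi z (v0 j) = (z ord0 * (j == bb)%:R) *: w /\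
     derive1 (Phi z) (v0 j) = z (lift ord0 j) *: nu j].
Proof.
have [phi [sphi pphi jets]] := jet_family.
pose Phi z t := \sum_(i : 'I_q.+1) z i *: phi i t.
have sz (z : 'I_q.+1 -> R) i : smooth (fun t => z i *: phi i t) by exact: smooth_scale.
have SP z : smooth (Phi z) by have [] := derive1n_sum (index_enum _) 0 (sz z).
have DP z m t : derive1n m (Phi z) t = \sum_i z i *: derive1n m (phi i) t.
  have [_ e] := derive1n_sum (index_enum _) m (sz z).
  apply: (etrans (congr1 (fun f => f t) e)); apply: eq_bigr => i _.
  exact: (congr1 (fun f => f t) (derive1n_scale (z i) m (sphi i))).
have DP1 z t : derive1 (Phi z) t = \sum_i z i *: derive1 (phi i) t := DP z 1%N t.
exists Phi; split.
- by move=> z; split; [exact: SP|move=> t; apply: eq_bigr => i _; rewrite pphi].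
- move=> z z' t; rewrite !DP1 /Phi -!big_split /=.
  by split; apply: eq_bigr => i _; rewrite -scalerDl addrC subrK.
- move=> m; have /choice[C hC] : forall i, exists c, 0 < c /\ forall j t, (j <= m)%N -> `|derive1n j (phi i) t| <= c.
    by move=> i; have [c c0 hc] := smooth_bounded_upto m (sphi i) (pphi i); exists c.
  exists (\sum_i C i).
    rewrite (bigD1 ord0)//=; apply: ltr_pwDl; first by have [] := hC ord0.
    by apply: sumr_ge0 => i _; have [/ltW] := hC i.
  move=> z d zd j t jm; rewrite DP mulr_suml; apply: le_trans (ler_norm_sum _ _ _) _.
  apply: ler_sum => i _; rewrite normrZ mulrC; apply: ler_pM => //.
  by have [_] := hC i; exact.
- by move=> z j; rewrite DP1; exact: jets.
Qed.

End Family.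

(** * Variation of the reflection equations *)

Lemma det2_bound (R : realType) (u v : R * R) (x y : R) : `|u| <= x -> `|v| <= y ->
  `|det2 u v| <= 2 * x * y.
Proof.
move=> ux vy; apply: le_trans (det2_le u v) _.
by rewrite -!mulrA ler_pM2l// ler_pM.
Qed.

Lemma det2_variation (R : realType) (X Y c c0 G G0 X1 Y1 : R * R) (N s d : R) :
  `|X - Y| <= N * d * s -> `|Y| <= N * d -> `|c| <= 2 * N -> `|c - c0| <= 6 * N * s ->
  `|G - G0| <= 3 * N * s -> `|X1| <= 2 * N * d -> `|G0| <= N -> `|X1 - Y1| <= 2 * (N * d * s) ->
  `|det2 X c + det2 G X1 - (det2 Y c0 + det2 G0 Y1)| <= 32 * N ^+ 2 * s * d.
Proof.
move=> h1 h2 h3 h4 h5 h6 h7 h8.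
have -> : det2 X c + det2 G X1 - (det2 Y c0 + det2 G0 Y1) =
    det2 (X - Y) c + det2 Y (c - c0) + (det2 (G - G0) X1 + det2 G0 (X1 - Y1)).
  by rewrite !det2Bl !det2Br; ring.
apply: le_trans (ler_normD _ _) _.
have a1 := le_trans (ler_normD (det2 (X - Y) c) (det2 Y (c - c0))) (lerD (det2_bound h1 h3) (det2_bound h2 h4)).
have a2 := le_trans (ler_normD (det2 (G - G0) X1) (det2 G0 (X1 - Y1))) (lerD (det2_bound h5 h6) (det2_bound h7 h8)).
apply: le_trans (lerD a1 a2) _.
by rewrite le_eqVlt; apply/orP; left; apply/eqP; ring.
Qed.

Lemma det2_lipschitz (R : realType) (G G' c c' : R * R) (N s : R) :
  `|G - G'| <= N * s -> `|c| <= 2 * N -> `|G'| <= N -> `|c - c'| <= 2 * (N * s) ->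
  `|det2 G c - det2 G' c'| <= 8 * N ^+ 2 * s.
Proof.
move=> h1 h2 h3 h4.
have -> : det2 G c - det2 G' c' = det2 (G - G') c + det2 G' (c - c').
  by rewrite !det2Bl !det2Br; ring.
have a1 := le_trans (ler_normD (det2 (G - G') c) (det2 G' (c - c'))) (lerD (det2_bound h1 h2) (det2_bound h3 h4)).
by apply: le_trans a1 _; rewrite le_eqVlt; apply/orP; left; apply/eqP; ring.
Qed.

Lemma chord_close (R : realType) (x y x' y' : R * R) (e : R) :
  `|x - x'| <= e -> `|y - y'| <= e -> `|(x - y) - (x' - y')| <= 2 * e.
Proof.
move=> h1 h2; have -> : (x - y) - (x' - y') = (x - x') - (y - y') by rewrite !opprB (addrC y' (- x')) (addrC y' (- y)) addrACA.
by apply: le_trans (ler_normB _ _) _; rewrite (_ : 2 * e = e + e); [exact: lerD|ring].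
Qed.

Lemma chord_bound (R : realType) (x y : R * R) (e : R) :
  `|x| <= e -> `|y| <= e -> `|x - y| <= 2 * e.
Proof.
move=> h1 h2; apply: le_trans (ler_normB _ _) _.
by rewrite (_ : 2 * e = e + e); [exact: lerD|ring].
Qed.

(** F and Fz are two perturbed boundaries, which differ by P, and G is the
    unperturbed one; F1, Fz1, G1 and P1 stand for the derivatives.  Comparing
    the equation of Fz at u with that of F at u' shows that the first variation
    of the equation along P, computed on G at v, is controlled by the distance
    s from u to u', up to an error that is small relative to the size d of P. *)
Lemma triple_variation (R : realType) (F F1 Fz Fz1 G G1 P P1 : R -> R * R)
    (u1 u2 u3 u1' u2' u3' v1 v2 v3 N sg s d : R) : 1 <= N -> 0 <= sg -> 0 <= d ->
  (forall t, Fz t = F t + P t) -> (forall t, Fz1 t = F1 t + P1 t) ->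
  (forall t, `|F1 t| <= N) -> (forall t, `|Fz t| <= N) -> (forall t, `|F t| <= N) ->
  (forall t, `|G1 t| <= N) ->
  (forall t t', `|F t - F t'| <= N * `|t - t'|) ->
  (forall t t', `|F1 t - F1 t'| <= N * `|t - t'|) ->
  (forall t t', `|Fz t - Fz t'| <= N * `|t - t'|) ->
  (forall t, `|P t| <= N * d) -> (forall t, `|P1 t| <= N * d) ->
  (forall t t', `|P t - P t'| <= N * d * `|t - t'|) ->
  (forall t t', `|P1 t - P1 t'| <= N * d * `|t - t'|) ->
  (forall t, `|Fz t - G t| <= 2 * sg) -> (forall t, `|F1 t - G1 t| <= 2 * sg) ->
  `|u1 - v1| <= sg -> `|u2 - v2| <= sg -> `|u3 - v3| <= sg ->
  `|u1 - u1'| <= s -> `|u2 - u2'| <= s -> `|u3 - u3'| <= s ->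
  det2 (Fz1 u1) (Fz u3 - Fz u2) = 0 -> det2 (F1 u1') (F u3' - F u2') = 0 ->
  `|det2 (P1 v1) (G v3 - G v2) + det2 (G1 v1) (P v3 - P v2)| <=
     8 * N ^+ 2 * s + 32 * N ^+ 2 * sg * d.
Proof.
move=> N1 sg0 d0 eF eF1 bF1 bFz bF bG1 lF lF1 lFz bP bP1 lP lP1 cF cF1 a1 a2 a3 b1 b2 b3 z z'.
have N0 : 0 <= N by exact: le_trans N1.
have Nd : 0 <= N * d by rewrite mulr_ge0.
have tau (x y : R * R) (y' : R * R) : `|x - y| <= N * sg -> `|y - y'| <= 2 * sg -> `|x - y'| <= 3 * N * sg.
  move=> k1 k2; have -> : x - y' = (x - y) + (y - y') by rewrite addrA subrK.
  apply: le_trans (ler_normD _ _) _; apply: le_trans (lerD k1 k2) _.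
  have : 2 * sg * 1 <= 2 * sg * N by rewrite ler_wpM2l// mulr_ge0.
  by clear; lra.
have S0 : `|det2 (P1 u1) (Fz u3 - Fz u2) + det2 (F1 u1) (P u3 - P u2)| <= 8 * N ^+ 2 * s.
  have -> : det2 (P1 u1) (Fz u3 - Fz u2) + det2 (F1 u1) (P u3 - P u2) =
     det2 (F1 u1') (F u3' - F u2') - det2 (F1 u1) (F u3 - F u2).
    rewrite z' -z eF1 !eF.
    have -> : F u3 + P u3 - (F u2 + P u2) = (F u3 - F u2) + (P u3 - P u2) by rewrite opprD addrACA.
    by rewrite det2Dl !det2Dr; ring.
  rewrite distrC; apply: det2_lipschitz.
  - by apply: le_trans (lF1 _ _) _; rewrite ler_wpM2l.
  - exact: chord_bound.
  - exact: bF1.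
  - by apply: chord_close; apply: le_trans (lF _ _) _; rewrite ler_wpM2l.
have V := @det2_variation R (P1 u1) (P1 v1) (Fz u3 - Fz u2) (G v3 - G v2) (F1 u1) (G1 v1)
   (P u3 - P u2) (P v3 - P v2) N sg d.
have -> : det2 (P1 v1) (G v3 - G v2) + det2 (G1 v1) (P v3 - P v2) =
  (det2 (P1 u1) (Fz u3 - Fz u2) + det2 (F1 u1) (P u3 - P u2)) -
  (det2 (P1 u1) (Fz u3 - Fz u2) + det2 (F1 u1) (P u3 - P u2) -
   (det2 (P1 v1) (G v3 - G v2) + det2 (G1 v1) (P v3 - P v2))) by rewrite subKr.
apply: le_trans (ler_normB _ _) _; apply: lerD S0 _; apply: V.
- by apply: le_trans (lP1 _ _) _; rewrite ler_wpM2l.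
- exact: bP1.
- exact: chord_bound.
- rewrite (_ : 6 * N * sg = 2 * (3 * N * sg)); last by ring.
  apply: chord_close; [apply: (tau _ (Fz v3))|apply: (tau _ (Fz v2))] => //.
  + by apply: le_trans (lFz _ _) _; rewrite ler_wpM2l.
  + by apply: le_trans (lFz _ _) _; rewrite ler_wpM2l.
- apply: (tau _ (F1 v1)) => //; by apply: le_trans (lF1 _ _) _; rewrite ler_wpM2l.
- by rewrite -mulrA; exact: chord_bound.
- exact: bG1.
- by apply: chord_close; apply: le_trans (lP _ _) _; rewrite ler_wpM2l.
Qed.

(** The equation at p gives the coefficient of p, the extra equation then gives
    that of index 0, and the other equations give the others. *)
Lemma triangular_bound (R : realType) q (D : 'I_q.+1 -> R) (p : 'I_q) (m : 'I_q -> R)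
    (ka B e : R) : 0 <= e -> 0 <= B -> `|ka| <= B -> (forall r, `|m r| <= B) ->
  `|D (lift ord0 p)| <= e -> `|D (lift ord0 p) * ka + D ord0| <= e ->
  (forall r, `|D (lift ord0 r) + D ord0 * m r| <= e) ->
  forall i, `|D i| <= (1 + B) ^+ 2 * e.
Proof.
move=> e0 B0 hk hm hp h0 hr.
have D0 : `|D ord0| <= (1 + B) * e.
  have -> : D ord0 = (D (lift ord0 p) * ka + D ord0) - D (lift ord0 p) * ka by rewrite addrC addKr.
  apply: le_trans (ler_normB _ _) _; rewrite normrM.
  have k : `|D (lift ord0 p)| * `|ka| <= e * B by exact: ler_pM.
  by apply: le_trans (lerD h0 k) _; rewrite le_eqVlt; apply/orP; left; apply/eqP; ring.
move=> i; case: (unliftP ord0 i) => [r ->|->]; last first.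
  by apply: le_trans D0 _; rewrite expr2 -mulrA ler_peMl ?mulr_ge0// ?addr_ge0 ?lerDl.
have -> : D (lift ord0 r) = (D (lift ord0 r) + D ord0 * m r) - D ord0 * m r by rewrite addrK.
apply: le_trans (ler_normB _ _) _; rewrite normrM.
have k : `|D ord0| * `|m r| <= (1 + B) * e * B by exact: ler_pM.
apply: le_trans (lerD (hr r) k) _.
have : 0 <= B * e by exact: mulr_ge0.
have -> : (1 + B) ^+ 2 * e = e + (1 + B) * e * B + B * e by ring.
by rewrite lerDl.
Qed.

Lemma derive1n_add_le (R : realType) (f g : R -> R * R) m (x y : R) : smooth f -> smooth g ->
  (forall j t, (j <= m)%N -> `|derive1n j f t| <= x) ->
  (forall j t, (j <= m)%N -> `|derive1n j g t| <= y) ->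
  forall j t, (j <= m)%N -> `|derive1n j (fun t => f t + g t) t| <= x + y.
Proof.
move=> sf sg hf hg j t jm.
have e := congr1 (fun F => F t) (derive1n_add j sf sg).
rewrite e; exact: le_trans (ler_normD _ _) (lerD (hf j t jm) (hg j t jm)).
Qed.

Lemma norm_near_le (R : realType) (x y : R * R) (M s : R) : `|x| <= M -> `|y - x| <= s ->
  `|y| <= M + s.
Proof.
move=> h1 h2; have -> : y = x + (y - x) by rewrite addrC subrK.
exact: le_trans (ler_normD _ _) (lerD h1 h2).
Qed.

Lemma bool_diff_le (R : realType) (x y : bool) (c : R) : `|(x%:R - y%:R) * c| <= `|c|.
Proof.
rewrite normrM ler_piMl//; case: x y => [] []; rewrite ?subrr ?subr0 ?sub0r ?normrN ?normr0 ?normr1 //.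
Qed.

Section Degenerate.
Context (R : realType) (q : nat) (A B : 'I_q -> 'I_q) (p a b : 'I_q).

Definition triple (f : R -> R * R) (u : 'I_q -> R) r i j :=
  det2 (derive1 f (u r)) (f (u j) - f (u i)).

(** The parameters u satisfy the reflection law at every point r, with
    neighbours A r and B r, and at p also with the neighbours a and b. *)
Definition degenerate (f : R -> R * R) (u : 'I_q -> R) :=
  (forall r, triple f u r (A r) (B r) = 0) /\ triple f u p a b = 0.

Hypothesis (ab : a != b) (Ab : A p != b) (Bb : B p != b).

(** The first variation of the equations is triangular.  In the main equation
    at p the displacement of the point b does not appear, since b is neither
    A p nor B p; in the extra one it appears with coefficient 1. *)
Lemma jets_exclude (N s d sg : R) (v0 : 'I_q -> R) (g g1 P P1 : R -> R * R)
    (D : 'I_q.+1 -> R) (nu : 'I_q -> R * R) (w : R * R) :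
  1 <= N -> 0 <= s -> 0 <= sg -> 0 <= d ->
  (forall j, P (v0 j) = (D ord0 * (j == b)%:R) *: w /\ P1 (v0 j) = D (lift ord0 j) *: nu j) ->
  (forall r, det2 (nu r) (g (v0 (B r)) - g (v0 (A r))) = 1) -> det2 (g1 (v0 p)) w = 1 ->
  (forall t, `|g t| <= N) -> (forall t, `|g1 t| <= N) -> (forall r, `|nu r| <= N) -> `|w| <= N ->
  (forall r, `|det2 (P1 (v0 r)) (g (v0 (B r)) - g (v0 (A r))) +
               det2 (g1 (v0 r)) (P (v0 (B r)) - P (v0 (A r)))| <= 8 * N ^+ 2 * s + 32 * N ^+ 2 * sg * d) ->
  `|det2 (P1 (v0 p)) (g (v0 b) - g (v0 a)) +
    det2 (g1 (v0 p)) (P (v0 b) - P (v0 a))| <= 8 * N ^+ 2 * s + 32 * N ^+ 2 * sg * d ->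
  forall i, `|D i| <= (1 + 4 * N ^+ 2) ^+ 2 * (8 * N ^+ 2 * s + 32 * N ^+ 2 * sg * d).
Proof.
move=> N1 s0 sg0 d0 jets nuE wE bg bg1 bnu bw hr hp.
have N0 : 0 <= N by exact: le_trans N1.
have NN : 0 <= N ^+ 2 by exact: sqr_ge0.
have form r i j : det2 (P1 (v0 r)) (g (v0 j) - g (v0 i)) + det2 (g1 (v0 r)) (P (v0 j) - P (v0 i)) =
    D (lift ord0 r) * det2 (nu r) (g (v0 j) - g (v0 i)) +
    D ord0 * (((j == b)%:R - (i == b)%:R) * det2 (g1 (v0 r)) w).
  have [_ ->] := jets r; have [-> _] := jets j; have [-> _] := jets i.
  by rewrite det2Zl -scalerBl det2Zr; ring.
have bound (c : R) : `|c| <= 2 * N * N -> `|c| <= 4 * N ^+ 2.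
  by move=> h; apply: le_trans h _; rewrite -mulrA -expr2 ler_wpM2r// ler_nat.
apply: (triangular_bound (p := p) (m := fun r => ((B r == b)%:R - (A r == b)%:R) * det2 (g1 (v0 r)) w)
   (ka := det2 (nu p) (g (v0 b) - g (v0 a)))).
- by rewrite addr_ge0 ?mulr_ge0.
- by rewrite mulr_ge0.
- have -> : 4 * N ^+ 2 = 2 * N * (2 * N) by ring.
  by apply: det2_bound; [exact: bnu|exact: chord_bound].
- move=> r; apply: bound; apply: le_trans (bool_diff_le _ _ _) _.
  by apply: det2_bound.
- have := hr p; rewrite form nuE (negbTE Ab) (negbTE Bb) subrr mul0r mulr0 addr0 mulr1.
  exact.
- by move: hp; rewrite form (negbTE ab) eqxx subr0 wE !mulr1.
- by move=> r; have := hr r; rewrite form nuE mulr1.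
Qed.

End Degenerate.

(** * Local removal of degenerate configurations *)

Lemma four_bounds (R : realType) (M C w y : R) : 0 < M -> 0 < C -> 0 <= w -> 0 <= y ->
  let N := (M + 2) + C + w + y in [/\ 1 <= N, M + 2 <= N, C <= N & w <= N].
Proof. by move=> M0 C0 w0 y0 N; rewrite /N; split; lra. Qed.

Section LocalRemoval.
Context (R : realType) (q : nat) (A B : 'I_q -> 'I_q) (p a b : 'I_q).
Hypothesis (AB : forall r, A r != B r) (ab : a != b) (Ab : A p != b) (Bb : B p != b).

Lemma family_bounds (g : R -> R * R) (M x : R) : smooth g ->
  (forall j t, (j <= 2)%N -> `|derive1n j g t| <= M) -> M <= x ->
  [/\ forall t, `|g t| <= x, forall t, `|derive1 g t| <= x,
      forall t t', `|g t - g t'| <= x * `|t - t'| &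
      forall t t', `|derive1 g t - derive1 g t'| <= x * `|t - t'|].
Proof.
move=> sg h Mx.
have b0 t : `|g t| <= x := le_trans (h 0%N t isT) Mx.
have b1 t : `|derive1 g t| <= x := le_trans (h 1%N t isT) Mx.
have b2 t : `|derive1 (derive1 g) t| <= x := le_trans (h 2 t isT) Mx.
split; [exact: b0|exact: b1| |].
- by move=> t t'; exact: (smooth_lipschitz sg b1 t' t).
- by move=> t t'; exact: (smooth_lipschitz (smooth_derive1 sg) b2 t' t).
Qed.

Lemma small_param (N : R) : 1 <= N -> exists2 sg : R, 0 < sg &
  sg <= 1 /\ (1 + 4 * N ^+ 2) ^+ 2 * (32 * N ^+ 2 * sg) = 2^-1.
Proof.
move=> N1; have N0 : 0 < N by exact: lt_le_trans N1.
have N21 : 1 <= N ^+ 2 by exact: exprn_ege1.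
have N20 : 0 < N ^+ 2 by exact: lt_le_trans N21.
set Y := (1 + 4 * N ^+ 2) ^+ 2 * N ^+ 2.
have Y1 : 1 <= Y.
  have h : 1 <= (1 + 4 * N ^+ 2) ^+ 2 by apply: exprn_ege1; rewrite lerDl mulr_ge0// ltW.
  by rewrite /Y; apply: le_trans h _; rewrite ler_peMr// sqr_ge0.
have Y0 : 0 < Y by exact: lt_le_trans Y1.
exists (64 * Y)^-1; first by rewrite invr_gt0 mulr_gt0.
have Y64 : 1 <= 64 * Y by apply: le_trans Y1 _; rewrite ler_peMl ?ler1n// ltW.
split; first by rewrite invf_le1// (lt_le_trans _ Y64).
have -> : (1 + 4 * N ^+ 2) ^+ 2 * (32 * N ^+ 2 * (64 * Y)^-1) = Y * 32 / (64 * Y).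
  by rewrite /Y; ring.
by field; exact: lt0r_neq0.
Qed.

Lemma absorb_half (d x y : R) : d <= x + 2^-1 * d -> 2 * x <= y -> d <= y.
Proof. by lra. Qed.

(** A move z that leaves a solution u depends on u in a Lipschitz way, so the
    q + 1 coordinates of z outnumber the q coordinates of u. *)
Lemma local_removal (g : table R) (v0 : 'I_q -> R) (k : R) : 0 < k ->
  (forall i j, i != j -> 2 * k <= 1 - cos (v0 j - v0 i)) ->
  exists2 sg : R, 0 < sg & forall h : table R,
    (forall j t, (j <= 2)%N -> `|derive1n j h t - derive1n j g t| <= sg) ->
  forall m (e : R), 0 < e -> exists2 h' : table R,
    (forall j t, (j <= m)%N -> `|derive1n j h' t - derive1n j h t| <= e) &
    forall u, (forall j, `|u j - v0 j| <= sg) -> ~ degenerate A B p a b h' u.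
Proof.
move=> k0 sep.
have distinct i j : i != j -> g (v0 j) - g (v0 i) != 0.
  move=> ij; rewrite subr_eq0; apply/eqP => /table_inj [z e].
  have := sep _ _ ij; rewrite -cosN opprB e addrAC subrr add0r.
  have c1 : cos (z%:~R * (2 * pi)) = 1 :> R.
    by have := periodic_int (@cosD2piE R) z 0; rewrite add0r cos0.
  by rewrite c1 subrr pmulr_rle0// leNgt k0.
have /choice[nu hnu] : forall r, exists w, det2 w (g (v0 (B r)) - g (v0 (A r))) = 1.
  move=> r; have [w w1] := det1_partner (distinct _ _ (AB r)).
  by exists (-1 *: w); rewrite det2Zl (det2C w) w1 mulN1r opprK.
have [w hw] := det1_partner (@table_regular R g (v0 p)).
have [Phi [sP lin bP jets]] := perturbation_family b nu w k0 sep.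
have [C C0 hC] := bP 2.
have sg := @table_smooth R g.
have [M M0 hM] := smooth_bounded_upto 2 sg (@table_periodic R g).
pose N := (M + 2) + C + `|w| + \sum_r `|nu r|.
have w0 : 0 <= `|w| by [].
have nu0 : 0 <= \sum_r `|nu r| by rewrite sumr_ge0.
have [N1 NM NC Nw] : [/\ 1 <= N, M + 2 <= N, C <= N & `|w| <= N].
  exact: (four_bounds M0 C0 w0 nu0).
have Nnu r : `|nu r| <= N.
  have : `|nu r| <= \sum_r `|nu r| by rewrite (bigD1 r)//= lerDl sumr_ge0.
  by move=> kn; apply: le_trans kn _; rewrite /N lerDr; exact: (addr_ge0 (addr_ge0 (addr_ge0 (ltW M0) (ler0n R 2)) (ltW C0)) w0).
have N0 : 0 <= N by exact: le_trans N1.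
have [sg1 sg0 [sgle sgE]] := small_param N1.
have M2N : M <= N by apply: le_trans NM; rewrite lerDl.
have [g0 g1 _ _] := family_bounds sg hM M2N.
exists sg1 => // h hh m e e0.
have sh := @table_smooth R h.
have hM1 j t : (j <= 2)%N -> `|derive1n j h t| <= M + 1.
  move=> j2; apply: le_trans (norm_near_le (hM j t j2) (hh j t j2)) _.
  by rewrite lerD2l.
have [dh dh0 hdh] := table_perturb h.
have [Cm Cm0 hCm] := bP m.
have [dl dl0 [dl1 dl2 dl3]] := common_bound (divr_gt0 sg0 C0) (divr_gt0 dh0 C0) (divr_gt0 e0 Cm0).
have Cdl : C * dl <= sg1 by move: dl1; rewrite ler_pdivlMr// mulrC.
have Cdh : C * dl <= dh by move: dl2; rewrite ler_pdivlMr// mulrC.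
have Cme : Cm * dl <= e by move: dl3; rewrite ler_pdivlMr// mulrC.
pose F z t := h t + Phi z t.
have sF z : smooth (F z) by exact: smooth_add sh (sP z).1.
have F1 z t : derive1 (F z) t = derive1 h t + derive1 (Phi z) t.
  by have [K _] := curve_jets t sh (sP z).1.
have hF z : (forall i, `|z i| <= dl) -> forall j t, (j <= 2)%N -> `|derive1n j (F z) t| <= N.
  move=> hz j t j2; apply: le_trans (derive1n_add_le sh (sP z).1 hM1 (hC z dl hz) t j2) _.
  apply: le_trans NM; rewrite (_ : M + 2 = M + 1 + 1); last by ring.
  by rewrite lerD2l; exact: le_trans Cdl sgle.
have small (x : R) : 0 <= x <= dl -> `|x| <= dl by move=> /andP[z0 z1]; rewrite ger0_norm.
pose K := (1 + 4 * N ^+ 2) ^+ 2.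
have K0 : 0 <= K by exact: sqr_ge0.
have c8 : 0 <= 8 * N ^+ 2 := mulr_ge0 (ler0n R 8) (sqr_ge0 N).
have c32 : 0 <= 32 * N ^+ 2 := mulr_ge0 (ler0n R 32) (sqr_ge0 N).
have lipC : 0 <= 2 * (K * (8 * N ^+ 2)) := mulr_ge0 (ler0n R 2) (mulr_ge0 K0 c8).
have lip z z' u u' : (forall i, 0 <= z i <= dl) -> (forall i, 0 <= z' i <= dl) ->
     (forall j, `|u j - v0 j| <= sg1) -> (forall j, `|u' j - v0 j| <= sg1) ->
     degenerate A B p a b (F z) u -> degenerate A B p a b (F z') u' ->
     forall s, 0 <= s -> (forall j, `|u j - u' j| <= s) ->
     forall i, `|z i - z' i| <= 2 * (K * (8 * N ^+ 2)) * s.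
  move=> hz hz' hu hu' [bz bpz] [bz' bpz'] s s0 us.
  have az i := small _ (hz i); have az' i := small _ (hz' i).
  pose D i := z i - z' i.
  pose d := \big[Num.max/0]_i `|D i|.
  have hd i : `|D i| <= d by exact: (le_bigmax _ (fun i => `|D i|) i).
  have d0 : 0 <= d by exact: bigmax_ge_id.
  have CdN : C * d <= N * d by rewrite ler_wpM2r.
  have [P0 P1 lP lP1] := family_bounds (sP D).1 (hC D d hd) CdN.
  have [Fz0 Fz1 lFz lFz1] := family_bounds (sF z) (hF z az) (lexx N).
  have [F0' F1' lF lF1] := family_bounds (sF z') (hF z' az') (lexx N).
  have eF t : F z t = F z' t + Phi D t.
    by rewrite /F -addrA; congr (_ + _); have [] := lin z z' t.
  have eF1 t : derive1 (F z) t = derive1 (F z') t + derive1 (Phi D) t.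
    have [_ e1] := lin z z' t.
    apply: (etrans (F1 z t)); apply: (etrans (congr1 (fun x => derive1 h t + x) e1)).
    by apply: (etrans (addrA _ _ _)); exact: (congr1 (fun x => x + derive1 (Phi D) t) (esym (F1 z' t))).
  have cF t : `|F z t - g t| <= 2 * sg1.
    have -> : F z t - g t = (h t - g t) + Phi z t by rewrite /F addrAC.
    have := lerD (hh 0%N t isT) (le_trans (hC z dl az 0%N t isT) Cdl).
    by move=> k1; apply: le_trans (ler_normD _ _) _; rewrite mulr_natl mulr2n.
  have cF1 t : `|derive1 (F z') t - derive1 g t| <= 2 * sg1.
    have -> : derive1 (F z') t - derive1 g t = (derive1 h t - derive1 g t) + derive1 (Phi z') t.
      by apply: (etrans (congr1 (fun x => x - derive1 g t) (F1 z' t))); exact: addrAC.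
    have := lerD (hh 1%N t isT) (le_trans (hC z' dl az' 1%N t isT) Cdl).
    by move=> k1; apply: le_trans (ler_normD _ _) _; rewrite mulr_natl mulr2n.
  have V r i j : triple (F z) u r i j = 0 -> triple (F z') u' r i j = 0 ->
     `|det2 (derive1 (Phi D) (v0 r)) (g (v0 j) - g (v0 i)) +
       det2 (derive1 g (v0 r)) (Phi D (v0 j) - Phi D (v0 i))| <=
     8 * N ^+ 2 * s + 32 * N ^+ 2 * sg1 * d.
    exact: (triple_variation N1 (ltW sg0) d0 eF eF1 F1' Fz0 F0' g1 lF lF1 lFz P0 P1 lP lP1 cF cF1
      (hu r) (hu i) (hu j) (us r) (us i) (us j)).
  have est := jets_exclude ab Ab Bb N1 s0 (ltW sg0) d0 (jets D) hnu hw g0 g1 Nnu Nw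
    (fun r => V r _ _ (bz r) (bz' r)) (V _ _ _ bpz bpz').
  have dle : d <= K * (8 * N ^+ 2 * s + 32 * N ^+ 2 * sg1 * d).
    apply: bigmax_le => [|i _]; last exact: est.
    exact: (mulr_ge0 K0 (addr_ge0 (mulr_ge0 c8 s0) (mulr_ge0 (mulr_ge0 c32 (ltW sg0)) d0))).
  (* sg1 is such that the error term is half of d, which is absorbed. *)
  have dle2 : d <= 2 * (K * (8 * N ^+ 2)) * s.
    apply: (@absorb_half d (K * (8 * N ^+ 2 * s))); last by rewrite -!mulrA.
    apply: le_trans dle _; rewrite mulrDr; apply: lerD => //.
    by rewrite -sgE -/K le_eqVlt; apply/orP; left; apply/eqP; rewrite -!mulrA.
  by move=> i; exact: le_trans (hd i) dle2.
have [z hz nobad] := lipschitz_pigeonhole (bad := fun z u => degenerate A B p a b (F z) u)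
  (u0 := v0) sg0 lipC dl0 lip.
have az i := small _ (hz i).
have [h' hE] := hdh (Phi z) (sP z).1 (sP z).2
  (fun j t j2 => le_trans (hC z dl az j t j2) Cdh).
have hF' : (h' : R -> R * R) = F z by apply/funext => t; exact: hE.
exists h'.
  move=> j t jm; rewrite hF'.
  have e1 := congr1 (fun f => f t) (derive1n_add j sh (sP z).1).
  have -> : derive1n j (F z) t - derive1n j h t = derive1n j (Phi z) t.
    by apply: (etrans (congr1 (fun x => x - derive1n j h t) e1)); rewrite addrC addKr.
  exact: le_trans (hCm z dl az j t jm) Cme.
by move=> u hu; rewrite hF'; exact: nobad.
Qed.

End LocalRemoval.

(** * Open and dense conditions on tables *)

Definition near_table (R : realType) m (e : R) (g h : table R) :=
  forall j t, (j <= m)%N -> `|derive1n j h t - derive1n j g t| <= e.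

Lemma norm_chain (R : realType) (x y z : R * R) (c d : R) : `|y - x| <= c -> `|z - y| <= d ->
  `|z - x| <= c + d.
Proof.
move=> h1 h2; have -> : z - x = (y - x) + (z - y) by rewrite [RHS]addrC addrA subrK.
exact: le_trans (ler_normD _ _) (lerD h1 h2).
Qed.

Lemma near_table_refl (R : realType) m (e : R) (g : table R) : 0 <= e -> near_table m e g g.
Proof. by move=> e0 j t _; rewrite subrr normr0. Qed.

Lemma near_table_trans (R : realType) m (e e' : R) (g h f : table R) :
  near_table m e g h -> near_table m e' h f -> near_table m (e + e') g f.
Proof.
by move=> h1 h2 j t jm; exact: norm_chain (h1 j t jm) (h2 j t jm).
Qed.

Lemma near_tableW (R : realType) m m' (e e' : R) (g h : table R) : (m' <= m)%N -> e <= e' ->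
  near_table m e g h -> near_table m' e' g h.
Proof. by move=> mm ee H j t jm; exact: le_trans (H j t (leq_trans jm mm)) ee. Qed.

Lemma near_table_norm (R : realType) m (e : R) (g h : table R) : 0 <= e -> near_table m e g h ->
  Ck_norm m (h \- g) <= e.
Proof.
move=> e0 H; apply: Ck_norm_le_bound => // j t jm.
rewrite (derive1n_sub j t (@table_smooth R h) (@table_smooth R g)); exact: H.
Qed.

Lemma norm_near_table (R : realType) m (e : R) (g h : table R) : Ck_norm m (h \- g) < e ->
  near_table m e g h.
Proof.
move=> H j t jm.
have ph u : (h \- g) (u + 2 * pi) = (h \- g) u by rewrite /= !table_periodic.
have := Ck_norm_lt (smooth_sub (@table_smooth R h) (@table_smooth R g)) ph H t jm.
by rewrite (derive1n_sub j t (@table_smooth R h) (@table_smooth R g)) => /ltW.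
Qed.

Lemma row_nbhs (R : realType) q (v : 'rV[R]_q) (s : R) : 0 < s ->
  nbhs v [set u : 'rV[R]_q | forall j, `|u ord0 j - v ord0 j| <= s].
Proof.
move=> s0; apply/nbhs_ballP; exists s => // u [_ vu] j.
by have := vu ord0 j; rewrite /ball /= distrC => /ltW.
Qed.

Section Avoidance.
Context (R : realType) (q : nat) (A B : 'I_q -> 'I_q) (p a b : 'I_q).

(** The condition holds uniformly on a C^1 neighbourhood of g, which makes it
    open by definition. *)
Definition avoids (X : set 'rV[R]_q) (g : table R) :=
  exists2 d : R, 0 < d & forall f : table R, near_table 1 d g f ->
    forall v, X v -> ~ degenerate A B p a b f (v ord0).

Lemma avoidsS X Y g : X `<=` Y -> avoids Y g -> avoids X g.
Proof. by move=> XY [d d0 H]; exists d => // f gf v /XY; exact: H. Qed.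

Lemma avoids_near X g : avoids X g -> exists2 d, 0 < d & forall h, near_table 1 d g h -> avoids X h.
Proof.
move=> [d d0 H]; exists (d / 2); first by rewrite divr_gt0.
move=> h gh; exists (d / 2); first by rewrite divr_gt0.
move=> f hf; apply: H; have := near_table_trans gh hf.
by rewrite -splitr.
Qed.

Lemma avoids_open X : open [set g | avoids X g].
Proof.
move=> g /= /avoids_near [d d0 H]; exists 1%N, d => // h /norm_near_table; exact: H.
Qed.

Lemma triple_stable (g : table R) (v : 'I_q -> R) r i j : triple g v r i j != 0 ->
  exists2 s : R, 0 < s & forall (f : table R) u, near_table 1 s g f ->
    (forall l, `|u l - v l| <= s) -> triple f u r i j != 0.
Proof.
move=> c0; have sg := @table_smooth R g.
have [M M0 hM] := smooth_bounded_upto 2 sg (@table_periodic R g).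
pose N := M + 1; have N0 : 0 < N by rewrite addr_gt0.
have MN : M <= N by rewrite lerDl.
have [g0 g1 lg lg1] := family_bounds sg hM (lexx M).
set c := triple g v r i j in c0.
have N2 : 0 < 16 * N ^+ 2 by rewrite mulr_gt0// exprn_gt0.
have s0 : 0 < Num.min 1 (`|c| / (16 * N ^+ 2)) by rewrite lt_min ltr01 divr_gt0// normr_gt0.
set s := Num.min _ _ in s0.
have s1 : s <= 1 by rewrite ge_min lexx.
have s2 : s * (16 * N ^+ 2) <= `|c| by rewrite -ler_pdivlMr// ge_min lexx orbT.
exists s => // f u gf uv; apply/eqP => z.
have moved (x y y' : R * R) l : `|x - y| <= s -> `|y - y'| <= M * `|u l - v l| -> `|x - y'| <= N * s.
  move=> k1 k2; have -> : x - y' = (x - y) + (y - y') by rewrite addrA subrK.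
  apply: le_trans (ler_normD _ _) _.
  have k3 := le_trans k2 (ler_wpM2l (ltW M0) (uv l)).
  by apply: le_trans (lerD k1 k3) _; rewrite /N mulrDl mul1r addrC.
have m0 l : `|f (u l) - g (v l)| <= N * s := moved _ _ _ l (gf 0%N _ isT) (lg _ _).
have m1 l : `|derive1 f (u l) - derive1 g (v l)| <= N * s := moved _ _ _ l (gf 1%N _ isT) (lg1 _ _).
have bf t : `|f t| <= N.
  by apply: le_trans (norm_near_le (g0 t) (gf 0%N t isT)) _; rewrite lerD2l.
have := @det2_lipschitz R (derive1 f (u r)) (derive1 g (v r)) (f (u j) - f (u i)) (g (v j) - g (v i)) N s
  (m1 r) (chord_bound (bf _) (bf _)) (le_trans (g1 _) MN) (chord_close (m0 j) (m0 i)).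
rewrite [X in `|X - _|]z sub0r normrN -/(triple g v r i j) -/c => k.
have c1 : 0 < `|c| by rewrite normr_gt0.
have k2 : `|c| * 2 <= `|c|.
  apply: le_trans (ler_wpM2r (ler0n R 2) k) _; apply: le_trans s2.
  by rewrite le_eqVlt; apply/orP; left; apply/eqP; ring.
by move: k2; rewrite ger_pMr// leNgt ltr1n.
Qed.

(** Near each point of K one of the equations fails, and keeps failing for
    nearby parameters and tables. *)
Lemma avoids_compact (K : set 'rV[R]_q) (g : table R) : compact K ->
  (forall v : 'rV[R]_q, K v -> ~ degenerate A B p a b g (v ord0)) -> avoids K g.
Proof.
move=> cK H.
apply: (@compact_induction _ K (fun X => avoids X g) cK).
- by exists 1.
- by move=> X Y; exact: avoidsS.
- move=> X Y [d d0 hd] [e e0 he]; exists (Num.min d e); first by rewrite lt_min d0.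
  move=> f gf v [Xv|Yv].
  + by apply: (hd f _ v Xv); apply: near_tableW gf; rewrite ?ge_min ?lexx.
  + by apply: (he f _ v Yv); apply: near_tableW gf; rewrite ?ge_min ?lexx ?orbT.
move=> v Kv.
have [r [i [j [nz sing]]]] : exists r, exists i, exists j, triple g (v ord0) r i j != 0 /\
    forall (f : R -> R * R) (u : 'I_q -> R), degenerate A B p a b f u -> triple f u r i j = 0.
  apply: contrapT => none; apply: (H v Kv); split.
  - move=> r; apply: contrapT => /eqP nz; apply: none; exists r, (A r), (B r); split=> //.
    by move=> f u [].
  - apply: contrapT => /eqP nz; apply: none; exists p, a, b; split=> //.
    by move=> f u [].
have [s s0 hs] := triple_stable nz.
exists [set u : 'rV[R]_q | forall j, `|u ord0 j - v ord0 j| <= s]; first exact: row_nbhs.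
exists s => // f gf u [_ uv] deg.
by have := hs f (u ord0) gf uv; rewrite (sing _ _ deg) eqxx.
Qed.

End Avoidance.

Section Density.
Context (R : realType) (q : nat) (A B : 'I_q -> 'I_q) (p a b : 'I_q).
Hypothesis (AB : forall r, A r != B r) (ab : a != b) (Ab : A p != b) (Bb : B p != b).

(** 1 - cos is a squared distance on the circle; the lower bound keeps the
    configurations away from collisions, where the equations degenerate. *)
Definition spread (c : R) : set 'rV[R]_q :=
  [set v : 'rV[R]_q | (forall j, 0 <= v ord0 j <= 2 * pi) /\
     forall ij : 'I_q * 'I_q, ij.1 != ij.2 -> c <= 1 - cos (v ord0 ij.2 - v ord0 ij.1)].

Lemma spread_compact (c : R) : compact (spread c).
Proof.
have E : spread c = [set v : 'rV[R]_q | forall j, 0 <= v ord0 j <= 2 * pi] `&`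
   \bigcap_(ij in [set ij : 'I_q * 'I_q | ij.1 != ij.2])
     ((fun v : 'rV[R]_q => 1 - cos (v ord0 ij.2 - v ord0 ij.1)) @^-1` [set x | c <= x]).
  by apply/seteqP; split=> v [v1 v2].
have cB := @compact_box R q (fun=> 0) (fun=> 2 * pi).
rewrite E; apply: (subclosed_compact _ cB) => [|v []//].
apply: closedI; first exact: (compact_closed (@norm_hausdorff _ _) cB).
apply: closed_bigI => ij _.
have cc : continuous (fun v : 'rV[R]_q => 1 - cos (v ord0 ij.2 - v ord0 ij.1)).
  move=> v.
  have e1 : {for v, continuous (fun v : 'rV[R]_q => v ord0 ij.1)} by exact: coord_continuous.
  have e2 : {for v, continuous (fun v : 'rV[R]_q => v ord0 ij.2)} by exact: coord_continuous.
  have ct := continuous_comp (cvgB e2 e1) (@continuous_cos R (v ord0 ij.2 - v ord0 ij.1)).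
  exact: (cvgB (cvg_cst (1 : R)) (ct _)).
by apply: preimage_closed; [move=> v _; exact: cc|exact: closed_ge].
Qed.

(** Every table close to g can be perturbed arbitrarily little so as to avoid
    the degenerate configurations in X.  The uniformity in h is what allows
    several sets to be treated in turn. *)
Definition settled (g : table R) (X : set 'rV[R]_q) :=
  exists2 eta : R, 0 < eta & forall h, near_table 2 eta g h -> forall m (e : R), 0 < e ->
  exists2 h', near_table m e h h' & avoids A B p a b X h'.

(** The second perturbation is chosen so small that it does not destroy what
    the first has achieved. *)
Lemma settledU g X Y : settled g X -> settled g Y -> settled g (X `|` Y).
Proof.
move=> [e1 e10 H1] [e2 e20 H2].
have [eta eta0 [k1 k2 _]] := common_bound e10 e20 e20.
have half (x : R) : 0 < x -> 0 < x / 2 by move=> x0; rewrite divr_gt0.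
have halfle (x : R) : 0 < x -> x / 2 <= x by move=> x0; rewrite ler_pdivrMr// ler_peMr ?ler1n ?ltW.
exists (eta / 2); first exact: half.
move=> h gh m e e0.
have [c c0 [c1 c2 _]] := common_bound (half _ e0) (half _ eta0) (half _ eta0).
have gh1 : near_table 2 e1 g h by apply: near_tableW gh => //; apply: le_trans (halfle _ eta0) k1.
have [h1 hh1 av1] := H1 h gh1 (maxn 2 m) c c0.
have [d d0 hd] := avoids_near av1.
have gh2 : near_table 2 e2 g h1.
  have n1 : near_table 2 (eta / 2) h h1 by apply: near_tableW hh1; rewrite ?leq_maxl.
  by apply: near_tableW (near_table_trans gh n1) => //; rewrite -splitr.
have [c' c'0 [c'1 c'2 _]] := common_bound (half _ e0) d0 d0.
have [h2 hh2 av2] := H2 h1 gh2 (maxn 2 m) c' c'0.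
exists h2.
  have n1 : near_table m (e / 2) h h1 by apply: near_tableW hh1; rewrite ?leq_maxr.
  have n2 : near_table m (e / 2) h1 h2 by apply: near_tableW hh2; rewrite ?leq_maxr.
  by have := near_table_trans n1 n2; rewrite -splitr.
have n3 : near_table 1 d h1 h2.
  by apply: near_tableW hh2 => //; apply: leq_trans (leq_maxl 2 m).
have [x x0 hx] := hd h2 n3; have [y y0 hy] := av2.
exists (Num.min x y); first by rewrite lt_min x0.
move=> f hf v [Xv|Yv].
- by apply: (hx f _ v Xv); apply: near_tableW hf; rewrite ?ge_min ?lexx.
- by apply: (hy f _ v Yv); apply: near_tableW hf; rewrite ?ge_min ?lexx ?orbT.
Qed.

Lemma settled_spread g (c : R) : 0 < c -> settled g (spread c).
Proof.
move=> c0; apply: (compact_induction (@spread_compact c)).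
- exists 1 => // h _ m e e0; exists h; first exact/near_table_refl/ltW.
  by exists 1.
- move=> X Y XY [eta eta0 H]; exists eta => // h gh m e e0.
  by have [h' n1 av] := H h gh m e e0; exists h' => //; exact: avoidsS av.
- exact: settledU.
move=> v [_ vsep].
have c20 : 0 < c / 2 by rewrite divr_gt0.
have sep i j : i != j -> 2 * (c / 2) <= 1 - cos (v ord0 j - v ord0 i).
  by move=> ij; rewrite mulrC divfK//; exact: (vsep (i, j)).
have [s s0 H] := local_removal AB ab Ab Bb g c20 sep.
exists [set u : 'rV[R]_q | forall j, `|u ord0 j - v ord0 j| <= s]; first exact: row_nbhs.
exists s => // h gh m e e0; have [h' n1 hh] := H h gh m e e0; exists h' => //.
apply: (@avoidsS _ _ _ _ _ _ _ _ [set u : 'rV[R]_q | forall j, v ord0 j - s <= u ord0 j <= v ord0 j + s]).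
  by move=> u [_ uv] j; have := uv j; rewrite ler_distl.
apply: avoids_compact; first exact: compact_box.
by move=> u uv; apply: hh => j; rewrite ler_distl.
Qed.

Lemma avoids_dense (c : R) : 0 < c -> dense [set g : table R | avoids A B p a b (spread c) g].
Proof.
move=> c0 V [g Vg] oV; have [m [e e0 He]] := oV g Vg.
have [eta eta0 H] := settled_spread g c0.
have e20 : 0 < e / 2 by rewrite divr_gt0.
have [h gh av] := H g (near_table_refl (m := 2) g (ltW eta0)) m _ e20.
exists h; split=> //; apply: He.
apply: le_lt_trans (near_table_norm (ltW e20) gh) _.
by rewrite ltr_pdivrMr// ltr_pMr// ltr1n.
Qed.

End Density.

(** * Orbits of generic tables *)

(** The conditions on A, B, a, b express that the extra equation is
    independent of the others. *)
Definition generic (R : realType) (g : table R) :=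
  forall q (A B : 'I_q -> 'I_q) (p a b : 'I_q) m,
    (forall r, A r != B r) -> a != b -> A p != b -> B p != b ->
    avoids A B p a b (@spread R q m.+1%:R^-1) g.

Lemma circ_window_eq (R : realType) (x y : R) : circ_eq x y -> 0 <= x < 2 * pi ->
  0 <= y < 2 * pi -> x = y.
Proof.
move=> xy /andP[x0 x1] /andP[y0 y1]; apply/esym; apply: (circ_near xy).
by rewrite ltr_norml; apply/andP; split; lra.
Qed.

Lemma distinct_spread (R : realType) (s : seq R) : uniq s ->
  (forall x, x \in s -> 0 <= x < 2 * pi) ->
  exists m, @spread R (size s) m.+1%:R^-1 (\row_(j < size s) nth 0 s j).
Proof.
move=> us hs.
have in_s (i : 'I_(size s)) : nth 0 s i \in s by rewrite mem_nth.
pose D (x : 'I_(size s) * 'I_(size s)) := 1 - cos (nth 0 s x.2 - nth 0 s x.1).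
have [k k0 hk] : exists2 k : R, 0 < k & forall y, y \in [seq D x | x <- enum [pred x : 'I_(size s) * 'I_(size s) | x.1 != x.2]] -> k < y.
  apply: pos_below => y /mapP[x]; rewrite mem_enum inE => ne ->.
  apply: noncirc_dist => /circ_window_eq e.
  move: ne; rewrite -(inj_eq val_inj) /= -(nth_uniq 0 (ltn_ord x.1) (ltn_ord x.2) us).
  by rewrite (e (hs _ (in_s _)) (hs _ (in_s _))) eqxx.
exists (Num.truncn k^-1); split=> [j|ij ne]; rewrite !mxE.
  by have /andP[-> /ltW ->] := hs _ (in_s j).
have kD : k < D ij by apply: hk; apply/mapP; exists ij; rewrite ?mem_enum ?inE.
apply: ltW; apply: le_lt_trans kD; rewrite -[leRHS]invrK lef_pV2 ?posrE ?invr_gt0 ?ltr0n//.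
by apply: ltW; exact: truncnS_gt.
Qed.

Section SimpleOrbits.
Context (R : realType) (O : R * R) (n : nat) (o : nat -> R * R) (g : table R).
Hypothesis (po : periodic_orbit g O n o).

(** The momentum is determined by the next bouncing point. *)
Lemma same_next i j : circ_eq (o i).1 (o j).1 -> circ_eq (o i.+1).1 (o j.+1).1 ->
  phase_eq (o i) (o j).
Proof.
move=> c c1; split=> //; have [-> _ _] := orbit_momentum po i; have [-> _ _] := orbit_momentum po j.
have [_ e1 _] := circ_curve g c; have [e2 _ _] := circ_curve g c1.
exact: (congr2 (fun x y => - det2 x (y - O)) (esym e1) (esym e2)).
Qed.

(** The momentum is also determined by the previous bouncing point. *)
Lemma same_prev i j : circ_eq (o i.+1).1 (o j.+1).1 -> circ_eq (o i).1 (o j).1 ->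
  phase_eq (o i.+1) (o j.+1).
Proof.
move=> c1 c; split=> //; have [_ -> _] := orbit_momentum po i; have [_ -> _] := orbit_momentum po j.
have [e2 _ _] := circ_curve g c; have [_ e1 _] := circ_curve g c1.
exact: (congr2 (fun x y => det2 (x - O) y) (esym e2) (esym e1)).
Qed.

(** Both chords are positive multiples of the same tangent, so they cannot be
    opposite. *)
Lemma no_backtrack i j : circ_eq (o i.+1).1 (o j.+1).1 -> circ_eq (o i).1 (o j.+2).1 ->
  ~ circ_eq (o i.+2).1 (o j).1.
Proof.
move=> c ca cb; have [x x0 ex] := orbit_chord po i; have [y y0 ey] := orbit_chord po j.
have [_ e1 _] := circ_curve g c; have [e2 _ _] := circ_curve g ca; have [e3 _ _] := circ_curve g cb.
have : (y + x) *: derive1 g (o i.+1).1 = 0.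
  rewrite scalerDl -ex -(etrans ey (congr1 (fun z => y *: z) e1)) e2 e3.
  by rewrite -opprB addNr.
move=> /eqP; rewrite scaler_eq0 => /orP[/eqP k|k].
  by have := addr_gt0 y0 x0; rewrite k ltxx.
by have := @table_regular R g (o i.+1).1; rewrite k.
Qed.

(** Let u list the distinct bouncing points, each with the neighbours it has at
    one of its visits.  If a point P is visited twice, another visit x of it has
    different neighbours: the next points differ and so do the previous ones,
    as otherwise the two visits would be the same phase point.  The orbit not
    being reversed at x, one of the neighbours at x is new, and the reflection
    law at x is the extra equation. *)
Lemma generic_simple : generic g -> forall i j, (i < n)%N -> (j < n)%N ->
  circ_eq (o i).1 (o j).1 -> i = j.
Proof.
move=> gen i j im jm cij; apply: contrapT => nij.
have [n0 _ _ _ _] := po.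
have /choice[tau htau] : forall i, exists u, circ_eq (o i).1 u /\ 0 <= u < 2 * pi.
  by move=> l; have [u cu hu] := circ_window 0 (o l).1; exists u; rewrite add0r in hu.
have tau_circ k l : tau k = tau l -> circ_eq (o k).1 (o l).1.
  move=> e; have [ck _] := htau k; have [cl _] := htau l; rewrite -e in cl.
  exact: circ_trans ck (circ_sym cl).
have circ_tau k l : circ_eq (o k).1 (o l).1 -> tau k = tau l.
  move=> c; have [ck wk] := htau k; have [cl wl] := htau l.
  exact: (circ_window_eq (circ_trans (circ_sym ck) (circ_trans c cl)) wk wl).
(* Visits are numbered from 1 so that each of them has a predecessor. *)
pose s := undup [seq tau l | l <- iota 1 n].
have us : uniq s by exact: undup_uniq.
have in_s l : tau l \in s.
  rewrite mem_undup (circ_tau _ _ (orbit_mod po l)).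
  have : (l %% n < n)%N by rewrite ltn_mod.
  case: (l %% n)%N => [_|l' l'n].
    have [c _] := orbit_period po 0%N; rewrite add0n in c.
    by rewrite -(circ_tau _ _ c); apply: map_f; rewrite mem_iota n0 add1n ltnS leqnn.
  by apply: map_f; rewrite mem_iota /= add1n ltnS ltnW.
have sw x : x \in s -> 0 <= x < 2 * pi.
  by rewrite mem_undup => /mapP[l _ ->]; have [] := htau l.
have lbl_lt l : (index (tau l) s < size s)%N by rewrite index_mem.
pose lbl l : 'I_(size s) := Ordinal (lbl_lt l).
have lblE k l : (lbl k == lbl l) = (tau k == tau l).
  rewrite -(inj_eq val_inj) /=; apply/eqP/eqP => [e|->//].
  by rewrite -(nth_index 0 (in_s k)) e nth_index.
have lbl_neq k l : ~ circ_eq (o k).1 (o l).1 -> lbl k != lbl l.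
  by move=> nc; rewrite lblE; apply/eqP => /tau_circ.
have [m sepm] := distinct_spread us sw.
set v := \row__ _ in sepm.
have vE l : v ord0 (lbl l) = tau l by rewrite mxE /= nth_index.
have tripleE x y z : triple g (v ord0) (lbl x) (lbl y) (lbl z) =
    det2 (derive1 g (o x).1) (g (o z).1 - g (o y).1).
  rewrite /triple !vE.
  have [_ e1 _] := circ_curve g (htau x).1; have [e2 _ _] := circ_curve g (htau y).1.
  have [e3 _ _] := circ_curve g (htau z).1.
  rewrite e2 e3; exact: (congr1 (fun w => det2 w _) e1).
have triple0 l : triple g (v ord0) (lbl l.+1) (lbl l) (lbl l.+2) = 0.
  by rewrite tripleE; have [c _ ->] := orbit_chord po l; rewrite det2Zr det2vv mulr0.
have /choice[occ hocc] : forall r : 'I_(size s), exists l, lbl l.+1 = r.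
  move=> r; have : nth 0 s r \in s by rewrite mem_nth.
  rewrite mem_undup => /mapP[[|l]]; rewrite mem_iota // => _ e; exists l.
  by apply: val_inj; rewrite /= -e index_uniq.
pose A r := lbl (occ r); pose B r := lbl (occ r).+2.
have AB r : A r != B r by apply: lbl_neq; exact: (orbit_neq2 po).
have main r : triple g (v ord0) r (A r) (B r) = 0 by rewrite -{1}(hocc r); exact: triple0.
pose P := lbl i.
have [x [xP nx]] : exists x, lbl x.+1 = P /\ ~ phase_eq (o x.+1) (o (occ P).+1).
  apply: contrapT => none.
  have key k : (k < n)%N -> circ_eq (o k).1 (o i).1 -> phase_eq (o k) (o (occ P).+1).
    move=> kn ck; have pk := orbit_period po k.
    have E : (k + n)%N = (k + n).-1.+1 by rewrite prednK// addn_gt0 n0 orbT.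
    apply: contrapT => nph; apply: none; exists (k + n).-1; rewrite -E; split.
      apply/eqP; rewrite lblE; apply/eqP; apply: circ_tau; exact: circ_trans pk.1 ck.
    by move=> h; apply: nph; exact: phase_eq_trans (phase_eq_sym pk) h.
  apply: nij; apply: (orbit_least po im jm).
  apply: phase_eq_trans (key i im (circ_refl _)) (phase_eq_sym (key j jm (circ_sym cij))).
set l := occ P in nx.
have cxl : circ_eq (o x.+1).1 (o l.+1).1.
  by apply: tau_circ; apply/eqP; rewrite -lblE xP /l hocc.
have H0 : lbl x != lbl x.+2 by apply: lbl_neq; exact: (orbit_neq2 po).
have H1 : ~ circ_eq (o x.+2).1 (o l.+2).1 by move=> c; apply: nx; exact: same_next.
have H2 : ~ circ_eq (o x).1 (o l).1 by move=> c; apply: nx; exact: same_prev.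
have extra : triple g (v ord0) P (lbl x) (lbl x.+2) = 0 by rewrite -xP; exact: triple0.
have contra a b : a != b -> A P != b -> B P != b -> triple g (v ord0) P a b = 0 -> False.
  move=> ab Ab Bb z; have [d d0 H] := gen _ A B P a b m AB ab Ab Bb.
  exact: (H g (near_table_refl (m := 1) g (ltW d0)) v sepm (conj main z)).
have [c|nc] := pselect (circ_eq (o x.+2).1 (o l).1).
  have nxl : ~ circ_eq (o x).1 (o l.+2).1.
    by move=> c'; exact: (no_backtrack cxl c' c).
  apply: (contra (lbl x.+2) (lbl x)).
  - by rewrite eq_sym.
  - by rewrite eq_sym; exact: lbl_neq.
  - by rewrite eq_sym; exact: lbl_neq.
  - rewrite -xP tripleE; rewrite -xP tripleE in extra.
    by rewrite -opprB -scaleN1r det2Zr extra mulr0.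
apply: (contra (lbl x) (lbl x.+2)) => //.
- by rewrite eq_sym; exact: lbl_neq.
- by rewrite eq_sym; exact: lbl_neq.
Qed.

End SimpleOrbits.

(** * The theorem *)

(** The combinatorial types are countably many. *)
Lemma generic_residual (R : realType) : residual [set g : table R | generic g].
Proof.
pose I : Type := {q : nat & ({ffun 'I_q -> 'I_q} * {ffun 'I_q -> 'I_q} * ('I_q * 'I_q * 'I_q) * nat)%type}.
pose set_of (x : I) : set (table R) :=
  let: existT q (A, B, (p, a, b), m) := x in
  if [&& [forall r, A r != B r], a != b, A p != b & B p != b]
  then [set g | avoids A B p a b (@spread R q m.+1%:R^-1) g] else setT.
pose U n : set (table R) := if @unpickle I n is Some x then set_of x else setT.
exists U.
  move=> n; rewrite /U; case: unpickle => [[q [[[A B] [[p a] b]] m]]|] /=; last first.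
    by split; [exact: openT|move=> V V0 _; rewrite setIT].
  case: ifP => [/and4P[/forallP AB ab Ab Bb]|_]; last first.
    by split; [exact: openT|move=> V V0 _; rewrite setIT].
  split; first exact: avoids_open.
  by apply: avoids_dense => //; rewrite invr_gt0 ltr0n.
move=> g Ug q A B p a b m AB ab Ab Bb.
pose x : I := existT _ q ([ffun r => A r], [ffun r => B r], (p, a, b), m).
have := Ug (pickle x) Logic.I; rewrite /U pickleK /= !ffunE ab Ab Bb.
have -> : [forall r, [ffun r => A r] r != [ffun r => B r] r].
  by apply/forallP => r; rewrite !ffunE.
rewrite /=.
have eA : ([ffun r => A r] : 'I_q -> 'I_q) = A by apply/funext => r; rewrite ffunE.
have eB : ([ffun r => B r] : 'I_q -> 'I_q) = B by apply/funext => r; rewrite ffunE.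
by rewrite eA eB.
Qed.

Theorem theoremC (R : realType) :
  exists2 T : set (table R), residual T &
  forall g : table R, T g ->
  forall O : R * R, table_interior g O ->
  forall (n : nat) (o : nat -> R * R), (3 <= n)%N -> periodic_orbit g O n o ->
  exists j : nat,
  forall U : set (table R), Ck_nbhs 2 g U ->
  Sp1 (Dorbit g O n o) /\
  exists2 e : R, 0 < e &
  forall A : 'M[R]_2, Sp1 A -> ball (Dorbit g O n o) e A ->
  forall V : set (R * R),
    nbhs (g (o j).1) V -> nbhs (g (o j.+1).1) V -> nbhs (g (o j.+2).1) V ->
  exists h : table R,
    [/\ U h, table_interior h O, periodic_orbit h O n o,
        Dorbit h O n o = A &
        forall t, ~ V (g t) -> h t = g t].
Proof.
exists [set g : table R | generic g]; first exact: generic_residual.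
move=> g gen O gO [|[|[|[|m]]]] // o _ po.
  exists 0%N => U Ug; split; first exact: Dorbit_Sp1 po.
  exact: triangle_moves gO po Ug.
exists 1%N => U Ug; split; first exact: Dorbit_Sp1 po.
exact: simple_orbit_moves gO po (generic_simple po gen) Ug.
Qed.
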